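(* Let $g\ge0$ and $d>0$ be integers, let $\lambda,\mu$ be partitions of $d$, put $r=l(\lambda)+l(\mu)+2g-2$, and assume $r>0$ and $\{\lambda,\mu\}\not\subset\{(2k),(k,k)\}$ for every $k\geq 1$. Assume that $l(\lambda_0,\mu_0)\le2$ and $(\lambda_{o,o},\mu_{o,o})\neq\emptyset$. Set $\lambda_{\mathrm{tail}}=(\lambda_{2e},\lambda_{2o},\lambda_{o,o})$ and $\mu_{\mathrm{tail}}=(\mu_{2e},\mu_{2o},\mu_{o,o})$. (a) If $k\in\lambda_0$, then $$Z_g(\lambda,\mu)\ge l(\lambda_{o,o})!\cdot l(\mu_{o,o})!\cdot\lfloor B/2\rfloor!\cdot\lceil B/2\rceil!,\qquad B=B(k,2\lambda_{\mathrm{tail}},2\mu_{\mathrm{tail}}).$$ (b) If $(\lambda_0,\mu_0)=\emptyset$, $g=0$ and $k\in\lambda_{o,o}$, then $$Z_g(\lambda,\mu)\ge (l(\lambda_{o,o})-1)!\cdot l(\mu_{o,o})!\cdot\lfloor B/2\rfloor!\cdot\lceil B/2\rceil!,\qquad B=B(k,2(\lambda_{\mathrm{tail}}\setminus(k)),2\mu_{\mathrm{tail}}).$$ (c) If $(\lambda_0,\mu_0)=\emptyset$ and $g>0$, then $$Z_g(\lambda,\mu)\ge l(\lambda_{o,o})!\cdot l(\mu_{o,o})!\cdot\big((B/2)!\big)^2,\qquad B=B(1,2\lambda_{\mathrm{tail}},2\mu_{\mathrm{tail}}).$$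
   Context: Partitions. $l(\cdot)$ is the number of parts; $(\lambda,\mu)$ denotes concatenation; $2\lambda$ doubles every part; $\lambda^2=(\lambda_1,\lambda_1,\dots,\lambda_n,\lambda_n)$; $k\in\lambda$ means $k$ is a part of $\lambda$; if $\lambda=(\lambda_1,\lambda_2)$ is a concatenation then $\lambda\setminus\lambda_2=\lambda_1$ (so in (b) one copy of the part $k$, taken from $\lambda_{o,o}$, is removed). A partition is even (odd) if all its parts are even (odd). Every partition decomposes uniquely as $\lambda=(2\lambda_{2e},2\lambda_{2o},\lambda_{o,o}^2,\lambda_0)$ with $\lambda_{2e}$ even, $\lambda_{2o}$ and $\lambda_{o,o}$ odd, and $\lambda_0$ odd without repeated entries. The numbers $B$. Given $k\in\mathbf N$ and partitions $\alpha,\beta$, consider all finite sequences whose first entry is $k$ and in which each subsequent entry is obtained from the previous one by either adding a part of $\alpha$ or subtracting a part of $\beta$, each part of $\alpha$ and $\beta$ being used exactly once. $B(k,\alpha,\beta)$ is the maximal number of sign changes occurring in such a sequence. Tropical covers. A graph is a finite connected graph without two-valent vertices (multiple edges allowed). One-valent vertices are called ends, other vertices inner vertices; edges adjacent to an end are leaves, other edges are inner edges. $C^\circ$ is $C$ minus its ends. A tropical curve $C$ is a graph with a length $l(e)\in(0,\infty)$ for each inner edge; this gives a complete inner metric on $C^\circ$ with inner edges isometric to $[0,l(e)]$ and leaves (without their end) isometric to $[0,\infty)$. Its genus is its first Betti number. $\mathbf{TP}^1=\mathbf R\cup\{\pm\infty\}$ is the curve consisting of one edge, with inner part isometric to $\mathbf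 R$. A piecewise $\mathbf Z$-linear map $\varphi:C\to D$ is a continuous map such that for each edge $e$ there is an integer $\omega(e)\geq 0$ (the weight) with $\mathrm{dist}(\varphi(x),\varphi(y))=\omega(e)\,\mathrm{dist}(x,y)$ for all $x,y\in e\cap C^\circ$. After subdividing so that every edge maps to a vertex or an edge, $\varphi$ is a tropical morphism if for every vertex $x$ of $C$ the sum of $\omega(e)$ over edges $e\ni x$ with $\varphi(e)=e'$ is the same for all edges $e'\ni\varphi(x)$ of $D$; its degree is the sum of $\omega(e)$ over all edges $e$ with $\varphi(e)=e'$, which does not depend on $e'$. Fix $r$ distinct points $\mathcal P\subset\mathbf R$. A tropical cover of genus $g$, type $(\lambda,\mu)$, simply branched at $\mathcal P$ is a degree $d$ tropical morphism $\varphi:C\to\mathbf{TP}^1$ with $C$ of genus $g$, $\varphi^{-1}(\mathbf R)=C^\circ$, such that the weights of the leaves mapping to $-\infty$ (resp. $+\infty$) at their ends form $\lambda$ (resp. $\mu$), and such that each point of $\mathcal P$ is the image of an inner vertex of $C$. (Then $C$ is three-valent, $\varphi$ is non-constant on every edge, and there is exactly one inner vertex over each point of $\mathcal P$ and no others.) An isomorphism of tropical covers is an isometry of the sources (bijective piecewise $\mathbf Z$-linear with piecewise $\mathbf Z$-linear inverse) commuting with the maps to $\mathbf{TP}^1$. Zigzag covers. Edges are even or odd according to their weight. A symmetric cycle (resp. symmetric fork) is a pair of inner edges sharing both endpoints (resp. a pair of leaves sharing their inner vertex) having equal weights and the same image under $\varphi$; its weight is the weight of one of its edges. A string in $C$ is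 a connected subgraph $S$ such that $S\cap C^\circ$ is a closed one-dimensional submanifold of $C^\circ$, i.e. $S$ is a simple loop or a simple path joining two ends. A tropical cover is a zigzag cover if there is a subset $S\subset C$, containing no edge of a symmetric cycle or of a symmetric fork of odd weight, such that $S$ is a string of odd edges or a single inner vertex, and each connected component of $C\setminus S$ is a tail of one of these forms: (i) a chain of even edges, starting at a vertex of $S$, in which consecutive even edges are joined by a symmetric cycle of odd weight (any number of cycles, including zero), the last even edge ending in a symmetric fork of odd weight; (ii) such a chain (any number of symmetric cycles of odd weight, including zero) whose last even edge is a leaf of weight twice an odd number; (iii) a single leaf of even weight, without cycles or forks. The zigzag number $Z_g(\lambda,\mu)$ is the number of isomorphism classes of zigzag covers of genus $g$, type $(\lambda,\mu)$, simply branched at $\mathcal P$; it does not depend on the choice of $\mathcal P$. *)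

(* Defs.v *)
From HB Require Import structures.
From mathcomp Require Import all_boot all_order all_algebra.
From mathcomp Require Import all_classical all_reals all_analysis.
From mathcomp Require Import zify.

Set Implicit Arguments.
Unset Strict Implicit.
Unset Printing Implicit Defensive.

Import Order.TTheory GRing.Theory Num.Theory.

(** Partitions are weakly decreasing lists of positive integers; the pieces of
    a decomposition and the arguments of [max_sign_changes] are multisets of
    parts, i.e. lists that matter only up to [perm_eq]. *)

Definition partition_of (d : nat) (lam : seq nat) : Prop :=
  [/\ sorted geq lam, 0 \notin lam & sumn lam = d].

Definition dbl (s : seq nat) : seq nat := [seq 2 * x | x <- s].

Record parity_decomposition (lam : seq nat) := ParityDecomposition {
  part_2e : seq nat;
  part_2o : seq nat;
  part_oo : seq nat;
  part_0 : seq nat;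
  part_2e_even : {in part_2e, forall x, ~~ odd x};
  part_2o_odd : {in part_2o, forall x, odd x};
  part_oo_odd : {in part_oo, forall x, odd x};
  part_0_odd : {in part_0, forall x, odd x};
  part_0_uniq : uniq part_0;
  parity_decompositionE :
    perm_eq lam (dbl part_2e ++ dbl part_2o ++ (part_oo ++ part_oo) ++ part_0)
}.

Definition part_tail (lam : seq nat) (D : parity_decomposition lam) : seq nat :=
  part_2e D ++ part_2o D ++ part_oo D.

Lemma parity_decomposition_exists (lam : seq nat) :
  inhabited (parity_decomposition lam).
Proof.
elim: lam => [|x s [[e o oo z He Ho Hoo Hz Uz E]]].
  by constructor; exists [::] [::] [::] [::].
have cons_in (p : pred nat) (y : nat) (t : seq nat) :
    p y -> {in t, forall i, p i} -> {in y :: t, forall i, p i}.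
  by move=> py pt i; rewrite inE => /predU1P[->//|/pt].
have [ox|ex] := boolP (odd x).
  have [xz|xz] := boolP (x \in z).
    constructor; exists e o (x :: oo) (rem x z) => //.
    - exact: (cons_in odd).
    - by move=> i /mem_rem /Hz.
    - exact: rem_uniq.
    apply/permP => p; move/permP/(_ p): E; rewrite /= !count_cat /= => ->.
    by move/permP: (perm_to_rem xz) => /(_ p) /= ->; rewrite !count_cat /=; lia.
  constructor; exists e o oo (x :: z) => //; first exact: (cons_in odd).
    by rewrite /= xz.
  by apply/permP => p; move/permP/(_ p): E; rewrite /= !count_cat /= => ->; lia.
have x2 : x = 2 * x./2 by rewrite mul2n even_halfK.
have [oh|eh] := boolP (odd x./2).
  constructor; exists e (x./2 :: o) oo z => //; first exact: (cons_in odd).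
  apply/permP => p; move/permP/(_ p): E; rewrite /= !count_cat /= -x2 => ->.
  by rewrite !count_cat; lia.
constructor; exists (x./2 :: e) o oo z => //.
  exact: (cons_in (predC odd)).
apply/permP => p; move/permP/(_ p): E; rewrite /= !count_cat /= -x2 => ->.
by lia.
Qed.

(** Consecutive entries of opposite signs. In the intended use no entry
    vanishes: the first one is odd and all steps are even. *)
Definition sign_changes (s : seq int) : nat :=
  count (fun p : int * int => (p.1 * p.2 < 0)%R) (zip s (behead s)).

(** [B(k, alpha, beta)]: an admissible sequence is the list of partial sums of
    some ordering of the steps [+a] ([a] in [alpha]) and [-b] ([b] in [beta]). *)
Definition max_sign_changes (k : nat) (alpha beta : seq nat) : nat :=
  \max_(s <- permutations ([seq Posz a | a <- alpha] ++ [seq (- Posz b)%R | b <- beta]))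
     sign_changes (Posz k :: scanl +%R (Posz k) s).

(** [bd e false] and [bd e true] are the two endpoints of [e]; the ordering is
    only bookkeeping. A pair [(e, b)] is a half-edge, so a loop contributes two
    half-edges at its vertex. Vertices and edges are numbered so that graphs
    form a small type; numberings are forgotten by passing to isomorphism
    classes. *)

Record multigraph := Multigraph {
  nvert : nat;
  nedge : nat;
  bd : 'I_nedge -> bool -> 'I_nvert
}.

Definition vert (G : multigraph) : finType := 'I_(nvert G).
Definition edge (G : multigraph) : finType := 'I_(nedge G).

Section Graph.
Variable G : multigraph.
Implicit Types (u v w : vert G) (e f : edge G) (A : pred (edge G)).

Definition incident e v : bool := [exists b, bd e b == v].

Definition joins e u v : bool :=
  [exists b, (bd e b == u) && (bd e (~~ b) == v)].

Definition valence_in A v : nat :=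
  #|[pred h : edge G * bool | (h.1 \in A) && (bd h.1 h.2 == v)]|.

Definition valence v : nat := valence_in predT v.

Definition adj A : rel (vert G) := [rel u v | [exists e in A, joins e u v]].

Definition connected_graph : Prop := forall u v, connect (adj predT) u v.

Definition is_end v : bool := valence v == 1.

Definition leaf e : bool := [exists b, is_end (bd e b)].

(** First Betti number of a nonempty connected graph (the subtraction does not
    truncate). *)
Definition genus : nat := #|edge G| + 1 - #|vert G|.

End Graph.

(** [TP^1] is [\bar R]. The metric graph is given by the lengths of its inner
    edges ([len] carries no information on leaves, which have infinite length).
    On each edge a piecewise Z-linear map is affine with slope [wt] in absolute
    value, so it is determined by the values [phi] at the vertices (the ends
    included) and the weights. *)

Record pl_map (R : realType) := PLMap {
  source :> multigraph;
  len : edge source -> R;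
  phi : vert source -> \bar R;
  wt : edge source -> nat
}.

Section Covers.
Variable R : realType.
Implicit Types C : pl_map R.

Definition is_tropical_curve C : Prop :=
  [/\ connected_graph C,
      forall v : vert C, valence v <> 2 &
      forall e : edge C, ~~ leaf e -> (0 < len e)%R].

(** On an inner edge the slope is the weight. A leaf ends at [-oo] or [+oo]
    (see [preimage_of_R]), hence has positive slope. *)
Definition is_pl_map C : Prop :=
  (forall e : edge C, ~~ leaf e ->
     `|fine (phi (bd e true)) - fine (phi (bd e false))| = (wt e)%:R * len e)%R
  /\ (forall e : edge C, leaf e -> 0 < wt e).

(** The preimage of [R] is the curve minus its ends. *)
Definition preimage_of_R C : Prop :=
  forall v : vert C, (phi v \is a fin_num) = ~~ is_end v.

(** The total weight of the half-edges at [v] on which [phi] increases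
    (resp. decreases) away from [v]: after subdivision, these are the edges
    over the edge of [TP^1] to the right (resp. left) of [phi v]. *)
Definition weight_right C (v : vert C) : nat :=
  \sum_(h : edge C * bool |
      (bd h.1 h.2 == v) && (phi v < phi (bd h.1 (~~ h.2)))%E) wt h.1.

Definition weight_left C (v : vert C) : nat :=
  \sum_(h : edge C * bool |
      (bd h.1 h.2 == v) && (phi (bd h.1 (~~ h.2)) < phi v)%E) wt h.1.

(** There is nothing to check at the ends (their image has only one adjacent
    edge) nor at the 2-valent vertices created by subdivision. *)
Definition is_tropical_morphism C : Prop :=
  forall v : vert C, ~~ is_end v -> weight_left v = weight_right v.

Definition leaf_weights C (p : \bar R) : seq nat :=
  [seq wt e | e <- enum (edge C) & [exists b, phi (bd e b) == p]].

(** The degree, computed over the leftmost edge of the subdivided [TP^1]. *)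
Definition degree C : nat := \sum_(w <- leaf_weights C -oo%E) w.

(** Tropical covers of genus [g], type [(lam, mu)], simply branched at the
    points listed in [P]. *)
Definition is_tropical_cover (g : nat) (lam mu : seq nat) (P : seq R) C : Prop :=
  [/\ is_tropical_curve C /\ genus C = g,
      is_pl_map C /\ preimage_of_R C,
      is_tropical_morphism C /\ degree C = sumn lam,
      perm_eq (leaf_weights C -oo%E) lam /\ perm_eq (leaf_weights C +oo%E) mu &
      {in P, forall p, exists v : vert C, ~~ is_end v /\ phi v = p%:E}].

(** Isometries commuting with the maps to [TP^1]; [s e] records whether the
    two half-edges of [e] are swapped in the bookkeeping. *)
Definition isomorphic C C' : Prop :=
  exists (f : vert C -> vert C') (h : edge C -> edge C') (s : edge C -> bool),
    [/\ bijective f /\ bijective h,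
        forall e b, bd (h e) (s e (+) b) = f (bd e b),
        forall e, ~~ leaf e -> len (h e) = len e,
        forall v, phi (f v) = phi v &
        forall e, wt (h e) = wt e].

Section Zigzag.
Variable C : pl_map R.
Implicit Types (u v w : vert C) (e f a b : edge C).
Implicit Types (SV : {set vert C}) (SE K : {set edge C}).

Definition edge_image e : set (\bar R) :=
  [set x | Order.min (phi (bd e false)) (phi (bd e true)) <= x
           <= Order.max (phi (bd e false)) (phi (bd e true))]%E%classic.

Definition symmetric_cycle a b u w : Prop :=
  [/\ a != b, ~~ leaf a && ~~ leaf b, joins a u w && joins b u w,
      wt a = wt b & edge_image a = edge_image b].

Definition symmetric_fork a b u : Prop :=
  [/\ a != b, leaf a && leaf b, [&& ~~ is_end u, incident a u & incident b u],
      wt a = wt b & edge_image a = edge_image b].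

(** A subgraph is given by its vertices and edges. Near a vertex it is a star
    with one branch for each of its half-edges there, so the submanifold
    condition says that there are two of them at each inner vertex. *)
Definition is_string SV SE : Prop :=
  [/\ SE != finset.set0,
      forall e (b : bool), e \in SE -> bd e b \in SV,
      {in SV &, forall u v, connect (adj [pred e | e \in SE]) u v} &
      {in SV, forall v,
         valence_in [pred e | e \in SE] v = if is_end v then 1 else 2}].

(** [chain v K]: the edges [K] form a chain of even edges starting at [v], in
    which consecutive ones are joined by symmetric cycles of odd weight, and
    which ends in a symmetric fork of odd weight or in a leaf of weight twice
    an odd number. *)
Inductive chain : vert C -> {set edge C} -> Prop :=
| chain_fork v u e a b :
    ~~ odd (wt e) -> joins e v u ->
    symmetric_fork a b u -> odd (wt a) ->
    chain v [set e; a; b]%SET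
| chain_leaf v u e m :
    joins e v u -> is_end u -> odd m -> wt e = 2 * m ->
    chain v [set e]%SET
| chain_cycle v u w e a b K :
    ~~ odd (wt e) -> joins e v u ->
    symmetric_cycle a b u w -> odd (wt a) ->
    chain w K -> [disjoint [set e; a; b]%SET & K] ->
    chain v ([set e; a; b] :|: K)%SET.

Definition is_tail v K : Prop :=
  chain v K \/
  exists e, [/\ leaf e, incident e v, ~~ odd (wt e) & K = [set e]%SET].

(** For a nonempty closed subgraph [S] of a connected graph, each connected
    component of the complement contains an (open) edge; [component SV SE e]
    is the set of edges of the component containing [e]. *)
Definition adj_outside SV SE : rel (edge C) :=
  [rel e f | [&& e \notin SE, f \notin SE &
     [exists v, [&& v \notin SV, incident e v & incident f v]]]].

Definition component SV SE e : {set edge C} :=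
  finset (connect (adj_outside SV SE) e).

Definition is_zigzag : Prop :=
  exists SV SE,
    [/\ is_string SV SE /\ {in SE, forall e, odd (wt e)}
          \/ (exists2 v, ~~ is_end v & SV = [set v]%SET) /\ SE = finset.set0,
        forall e f, e \in SE -> odd (wt e) ->
          ~ (exists u w, symmetric_cycle e f u w) /\
          ~ (exists u, symmetric_fork e f u) &
        forall e, e \notin SE ->
          exists2 v, v \in SV & is_tail v (component SV SE e)].

End Zigzag.

Definition zigzag_classes (g : nat) (lam mu : seq nat) (P : seq R) :
    set (set (pl_map R)) :=
  [set [set C' | isomorphic C C'] | C in
     [set C | is_tropical_cover g lam mu P C /\ is_zigzag C]]%classic.

(** The number of isomorphism classes, as an element of [N] and [+oo]. *)
Definition zigzag_number (g : nat) (lam mu : seq nat) (P : seq R) : \bar R :=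
  counting (zigzag_classes g lam mu P).

End Covers.

(* Main.v *)
(* The covers are built from a string of odd edges, a path or a loop, to which the
   parts of [lam] and [mu] are attached as tails; the surplus genus becomes a chain
   of symmetric cycles on one tail. The weights along the string are the partial sums
   entering [B], and any order of the inner vertices over [P] compatible with the
   directions of the edges gives a cover. Putting the minima of the string below and
   its maxima above all other string vertices, and the left (right) forks below
   (above) everything, one may permute each of these four sets freely: these are the
   four factorials.
   The number of edges of weight [w] between the fibres over [p] and [q] is an
   isomorphism invariant, and a string edge is the only edge with its weight and end
   points; so two isomorphic covers with the same data which agree on one string edge
   agree everywhere. Such an edge starts at a vertex which is not a bend of the string,
   as its position is fixed, or at a distinguished end. When all vertices are bends,
   isomorphisms may turn the string around, or rotate it to another fork. The loss is
   made up by a second family, where two neighbouring tails are exchanged so that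
   exactly one string edge has both ends in the lower half, and, for loops, by
   interleaving the left forks with the minima. This suffices by a binomial estimate,
   except for two left forks against two right tails, where strings joining two ends
   over [-oo] supply the missing covers. *)
From HB Require Import structures.
Require Import Defs.
From mathcomp Require Import all_boot all_order all_algebra.
From mathcomp Require Import all_classical all_reals all_analysis.
From mathcomp Require Import fingroup perm finmap zify.

Set Implicit Arguments.
Unset Strict Implicit.
Unset Printing Implicit Defensive.

Import Order.TTheory GRing.Theory Num.Theory.
(** * Families of covers *)

(** Parity drives the proof. Odd edges off the string come in pairs with equal weight and equal end
    points, so an edge count 1 at an odd weight singles out a string edge. The hard case is a loop
    all of whose vertices are bends. Let it have [p] left and [p] right tails, and let [l] of the
    left ones be forks. Allowing a left fork anywhere below its own string vertex gives at least
    (l+p)!/2^l orders of the lower half instead of l! p!. An isomorphism sends the string vertex of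
    a chosen left fork to that of a left fork, in one of two directions, so at most 2l orders are
    identified. In the second family nothing is identified, but two order conditions leave only a
    quarter of the orders. Together the families reach C(p+l,l) (l+2) / (4 l 2^l) times the claimed
    bound. This factor is at least 1 for p > 1 unless l = p = 2, where it is 3/4; the missing
    quarter is exactly what the open strings give. For an open string the only possible
    identification is the reversal, and each of the two families contributes one half. *)

Lemma le_counting (R : realType) (T : finType) (U : choiceType) (A : set U)
    (f : T -> U) (N : nat) :
  (forall t, A (f t)) -> injective f -> N <= #|T| ->
  (N%:R%:E <= @counting U R A)%E.
Proof.
move=> fA finj NT; rewrite /counting.
(* [counting] is [+oo] on infinite sets, so finiteness of the set of classes need not be known. *)
case: ifPn => [/asboolP finA|_]; last exact: leey.
rewrite lee_fin ler_nat (leq_trans NT)//.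
have sub : ([fset f t | t in T] `<=` fset_set A)%fset.
  by apply/fsubsetP => _ /imfsetP[t _ ->]; rewrite in_fset_set//; exact: mem_set.
apply: leq_trans (fsubset_leq_card sub).
by rewrite card_imfset//= -cardE.
Qed.

Section EdgeCount.
Variable R : realType.
Implicit Types C : pl_map R.

(* The numbers [edge_count p q w] are isomorphism invariants; they are the only
   ones used to tell covers apart. *)
Definition has_ends C (p q : \bar R) (e : edge C) : bool :=
  [exists b, (phi (bd e b) == p) && (phi (bd e (~~ b)) == q)].

Definition edge_count C (p q : \bar R) (w : nat) : nat :=
  #|[pred e : edge C | (wt e == w) && has_ends p q e]|.

Lemma isomorphic_edge_count C C' :
  isomorphic C C' -> edge_count C = edge_count C'.
Proof.
move=> [f [h [s [[bf bh] bdh _ phif wth]]]].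
apply/funext => p; apply/funext => q; apply/funext => w.
rewrite /edge_count.
rewrite -(on_card_preimset (onW_bij _ bh)).
apply: eq_card => e; rewrite !inE wth; congr (_ && _).
apply/existsP/existsP => -[b /andP[/eqP<- /eqP<-]].
  exists (s e (+) b); rewrite bdh phif eqxx/=.
  by rewrite -addbN bdh phif eqxx.
exists (s e (+) b); rewrite -!phif -!bdh ?addbN !addbA !addbb /=.
by rewrite !eqxx.
Qed.

Lemma isomorphic_refl C : isomorphic C C.
Proof.
exists id, id, (fun=> false); split => //.
by split; exists id.
Qed.
End EdgeCount.

Section Families.
Variables (R : realType) (g : nat) (lam mu : seq nat) (P : seq R).

Definition zigzag_cover (C : pl_map R) : Prop :=
  is_tropical_cover g lam mu P C /\ is_zigzag C.

(** Injectivity is asked of the edge counts, which is stronger than having pairwise non-isomorphic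
    members; [Q] is the property by which families are kept apart when they are joined. *)
Definition at_least (Q : pl_map R -> Prop) (N : nat) : Prop :=
  exists (T : finType) (F : T -> pl_map R),
    [/\ N <= #|T|, forall t, zigzag_cover (F t) /\ Q (F t) &
        injective (fun t => edge_count (F t))].

Lemma at_least_zigzag Q N :
  at_least Q N -> (N%:R%:E <= zigzag_number g lam mu P)%E.
Proof.
move=> [T [F [NT FT Finj]]].
apply: (@le_counting R T _ _ (fun t => [set C' | isomorphic (F t) C']%classic)) => //.
  by move=> t; exists (F t) => //; exact: (FT t).1.
move=> t t' E; apply: Finj; apply: isomorphic_edge_count.
have : [set C' | isomorphic (F t') C']%classic (F t') by exact: isomorphic_refl.
by rewrite -E.
Qed.

Lemma at_least_le Q N M : N <= M -> at_least Q M -> at_least Q N.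
Proof.
by move=> NM [T [F [MT FT Finj]]]; exists T, F; split=> //; exact: leq_trans MT.
Qed.

Lemma at_leastW (Q Q' : pl_map R -> Prop) N :
  (forall C, Q C -> Q' C) -> at_least Q N -> at_least Q' N.
Proof.
move=> QQ' [T [F [MT FT Finj]]]; exists T, F; split=> // t.
by have [? /QQ'] := FT t.
Qed.

Lemma at_leastD (Q1 Q2 : pl_map R -> Prop) N1 N2 :
  (forall C C', Q1 C -> Q2 C' -> edge_count C <> edge_count C') ->
  at_least Q1 N1 -> at_least Q2 N2 ->
  at_least (fun C => Q1 C \/ Q2 C) (N1 + N2).
Proof.
move=> dis [T1 [F1 [NT1 FT1 inj1]]] [T2 [F2 [NT2 FT2 inj2]]].
exists (T1 + T2)%type, (fun t => match t with inl t => F1 t | inr t => F2 t end).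
split.
- by rewrite card_sum leq_add.
- by case=> t; [have [] := FT1 t | have [] := FT2 t]; split=> //; [left|right].
- case=> t [] t' /= E.
  + by rewrite (inj1 _ _ E).
  + by case: (dis _ _ (FT1 t).2 (FT2 t').2 E).
  + by case: (dis _ _ (FT1 t').2 (FT2 t).2 (esym E)).
  + by rewrite (inj2 _ _ E).
Qed.

(** For families with repetitions: [rep] depends on the edge count only, so it keeps one index per
    fibre and loses at most the factor [K]. *)
Lemma at_least_fibers (Q : pl_map R -> Prop) (T : finType) (F : T -> pl_map R)
    (K : nat) :
  (forall t, zigzag_cover (F t) /\ Q (F t)) ->
  (forall t, #|[pred t' | `[< edge_count (F t') = edge_count (F t) >]]| <= K) ->
  exists2 M, #|T| <= K * M & at_least Q M.
Proof.
move=> FT fib.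
pose same t := [pred t' | `[< edge_count (F t') = edge_count (F t) >]].
pose rep t := odflt t [pick t' in same t].
have repE t : edge_count (F (rep t)) = edge_count (F t).
  by rewrite /rep; case: pickP => //= t' /asboolP.
have rep_eq t t' : edge_count (F t) = edge_count (F t') -> rep t = rep t'.
  move=> E; rewrite /rep.
  have -> : [pick x in same t'] = [pick x in same t].
    by apply: eq_pick => x; rewrite !inE E.
  case: pickP => //= /(_ t); rewrite inE => /asboolP; by case.
pose S := [set rep t | t in T].
exists #|S|.
  rewrite -[#|T|]sum1_card (partition_big rep [in S])/=; last first.
    by move=> t _; apply: imset_f.
  rewrite (mulnC K) -sum_nat_const; apply: leq_sum => _ /imsetP[t _ ->].
  rewrite sum1_card; apply: leq_trans (fib t); apply: subset_leq_card.
  apply/fintype.subsetP => x; rewrite !inE /= => /eqP xt; apply/asboolP.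
  by rewrite -repE xt repE.
exists {x | x \in S}, (fun x => F (val x)); split=> //.
  by rewrite card_sig.
move=> [x xS] [y yS] /= E; apply/val_inj => /=.
have idS z : z \in S -> rep z = z.
  by move=> /imsetP[u _ ->]; apply: rep_eq; exact: repE.
by rewrite -(idS _ xS) -(idS _ yS); exact: rep_eq.
Qed.

End Families.

(** * Strings with tails *)

(* Tail [i] is attached to the string at [VS i] and stops at [VT i], where a leaf
   ends or a fork with ends [VF i b] starts; [VC t b] are the two vertices of the
   [t]-th symmetric cycle, [VX b] the ends of a string that is not a loop. *)
Inductive rvert :=
  VS of nat | VC of nat & bool | VT of nat | VX of bool | VF of nat & bool.
(* [ES j] is the string edge arriving at [VS j] (for an open string, the last one
   arrives at [VX true]), [EC t] the even edge below the [t]-th cycle, [EO t b] the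
   edges of that cycle, [ET i] the last even edge of tail [i], [EF i b] its fork. *)
Inductive redge :=
  ES of nat | EC of nat | EO of nat & bool | ET of nat | EF of nat & bool.

Definition rvert_code (v : rvert) : nat * nat * bool :=
  match v with
  | VS i => (0, i, false) | VC t b => (1, t, b) | VT i => (2, i, false)
  | VX b => (3, 0, b) | VF i b => (4, i, b)
  end.
Definition rvert_decode (x : nat * nat * bool) : rvert :=
  match x with
  | (0, i, _) => VS i | (1, t, b) => VC t b | (2, i, _) => VT i
  | (3, _, b) => VX b | (_, i, b) => VF i b
  end.
Lemma rvert_codeK : cancel rvert_code rvert_decode. Proof. by case. Qed.
HB.instance Definition _ := Equality.copy rvert (can_type rvert_codeK).

Definition redge_code (v : redge) : nat * nat * bool :=
  match v with
  | ES i => (0, i, false) | EC t => (1, t, false) | EO t b => (2, t, b)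
  | ET i => (3, i, false) | EF i b => (4, i, b)
  end.
Definition redge_decode (x : nat * nat * bool) : redge :=
  match x with
  | (0, i, _) => ES i | (1, t, _) => EC t | (2, t, b) => EO t b
  | (3, i, _) => ET i | (_, i, b) => EF i b
  end.
Lemma redge_codeK : cancel redge_code redge_decode. Proof. by case. Qed.
HB.instance Definition _ := Equality.copy redge (can_type redge_codeK).

Definition bpairs (U : Type) (f : nat -> bool -> U) (s : seq nat) : seq U :=
  [seq f y b | y <- s, b <- [:: false; true]].
Arguments bpairs : simpl never.

(* A tail over [+oo] or [-oo] whose even edges have weight [2 * it_half]. *)
Definition item : Type := bool * nat * bool.
Definition it_right (x : item) : bool := x.1.1.
Definition it_half (x : item) : nat := x.1.2.
Definition it_fork (x : item) : bool := x.2.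
Definition it_step (x : item) : int :=
  if it_right x then (- Posz (2 * it_half x))%R else Posz (2 * it_half x).
Definition item0 : item := (false, 1, false).

(* All [ncyc] symmetric cycles sit on the tail [cyci]; [base] is the signed weight of
   [ES 0], positive if [phi] increases along the string. *)
Record zdata := ZData {
  looped : bool; items : seq item; base : int; ncyc : nat; cyci : nat }.

Lemma odd_absz_step (a : int) (k : nat) : odd `|(a + Posz (2 * k))%R| = odd `|a|.
Proof.
have [m] : exists m : nat, (`|(a + Posz (2 * k))%R| = `|a| + 2 * m \/
    `|(a + Posz (2 * k))%R| + 2 * m = `|a|) \/
    `|(a + Posz (2 * k))%R| + `|a| = 2 * m.
  case: (leP 0%R a) => h; first by exists k; lia.
  case: (leP 0%R (a + Posz (2 * k))%R) => h'; exists k; lia.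
rewrite !mul2n => -[[->|<-]|]; rewrite ?oddD ?odd_double ?addbF//.
by move=> /(congr1 odd); rewrite oddD odd_double; case: odd; case: odd.
Qed.

Lemma odd_it_step (a : int) (x : item) : odd `|(a + it_step x)%R| = odd `|a|.
Proof.
rewrite /it_step; case: ifP => _; last exact: odd_absz_step.
by rewrite -[in RHS](subrK (Posz (2 * it_half x)) a) odd_absz_step.
Qed.

Section Zdata.
Variable D : zdata.
Local Notation its := (items D).
Local Notation lp := (looped D).
Local Notation c := (ncyc D).
Local Notation i0 := (cyci D).

Definition ntail : nat := size its.
Local Notation n := ntail.
Definition right i : bool := it_right (nth item0 its i).
Definition hw i : nat := it_half (nth item0 its i).
Definition fk i : bool := it_fork (nth item0 its i).
(* The signed weight of [ES j]: an entry of the sequences defining [B]. *)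
Definition W (j : nat) : int := (base D + \sum_(x <- take j its) it_step x)%R.

Lemma WS i : i < n -> W i.+1 = (W i + it_step (nth item0 its i))%R.
Proof.
move=> ilt; rewrite /W (take_nth item0)// -cats1 big_cat big_seq1/=.
by rewrite addrA.
Qed.

Lemma W0 : W 0 = base D.
Proof. by rewrite /W take0 big_nil addr0. Qed.

Lemma odd_W j : odd `|base D| -> odd `|W j|.
Proof.
move=> ob; rewrite /W; elim: {j}(take j its) (base D) ob => [|x s IH] b ob.
  by rewrite big_nil addr0.
by rewrite big_cons addrA IH// odd_it_step.
Qed.

(* The index of the string edge leaving [VS i]. *)
Definition sout i : nat := if lp && (i.+1 == n) then 0 else i.+1.

Definition rbd (e : redge) (b : bool) : rvert :=
  match e, b with
  | ES j, true => if j == n then VX true else VS j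
  | ES j, false => if j is j'.+1 then VS j' else if lp then VS n.-1 else VX false
  | EC t, true => VC t false
  | EC t, false => if t is t'.+1 then VC t' true else VS i0
  | EO t _, b => VC t b
  | ET i, true => VT i
  | ET i, false => if (i == i0) && (0 < c) then VC c.-1 true else VS i
  | EF i _, false => VT i
  | EF i a, true => VF i a
  end.

Definition rwt (e : redge) : nat :=
  match e with
  | ES j => `|W j| | EC _ => 2 * hw i0 | EO _ _ => hw i0
  | ET i => 2 * hw i | EF i _ => hw i
  end.

Definition rdir (e : redge) : bool :=
  match e with
  | ES j => (0 < W j)%R | EC _ | EO _ _ => right i0 | ET i | EF i _ => right i
  end.

Definition in_vs (v : rvert) : bool :=
  match v with
  | VS i => i < n | VC t _ => t < c | VT i => i < n | VX _ => ~~ lp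
  | VF i _ => (i < n) && fk i
  end.

Definition in_es (e : redge) : bool :=
  match e with
  | ES j => j < n + ~~ lp | EC t => t < c | EO t _ => t < c | ET i => i < n
  | EF i _ => (i < n) && fk i
  end.

Definition inner (v : rvert) : bool :=
  match v with VS _ => true | VC _ _ => true | VT i => fk i | _ => false end.

Definition rend (v : rvert) : bool :=
  match v with VT i => right i | VF i _ => right i | VX b => b && (0 < W n)%R
  | _ => false end.

Definition forks : seq nat := [seq i <- iota 0 n | fk i].

Definition vs : seq rvert :=
  map VS (iota 0 n) ++ bpairs VC (iota 0 c) ++
  map VT (iota 0 n) ++ (if lp then [::] else [:: VX false; VX true]) ++
  bpairs VF forks.

Definition es : seq redge :=
  map ES (iota 0 (n + ~~ lp)) ++ map EC (iota 0 c) ++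
  bpairs EO (iota 0 c) ++
  map ET (iota 0 n) ++ bpairs EF forks.

Let VSinj : injective VS. Proof. by move=> ? ? []. Qed.
Let VTinj : injective VT. Proof. by move=> ? ? []. Qed.
Let ESinj : injective ES. Proof. by move=> ? ? []. Qed.
Let ECinj : injective EC. Proof. by move=> ? ? []. Qed.
Let ETinj : injective ET. Proof. by move=> ? ? []. Qed.

Lemma mem_forks i : (i \in forks) = (i < n) && fk i.
Proof. by rewrite mem_filter mem_iota andbC. Qed.

Let notmap (T : Type) (U : eqType) (f : T -> U) (x : U) (s : seq T) :
  (forall y, x <> f y) -> (x \in map f s) = false.
Proof. 
elim: s => //= y s IH H; rewrite inE IH// orbF; apply/eqP; exact: H.
Qed.

Let notpair (U : eqType) (f : nat -> bool -> U) (x : U) s :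
  (forall y b, x <> f y b) -> (x \in bpairs f s) = false.
Proof. by move=> H; apply/allpairsP => -[[y b] [_ _ /= /H]]. Qed.

Let inpair (U : eqType) (f : nat -> bool -> U) i b s :
  (forall i b j d, f i b = f j d -> i = j /\ b = d) ->
  (f i b \in bpairs f s) = (i \in s).
Proof.
move=> H; apply/allpairsP/idP => [[[y d] [ys _ /H[-> _]]]//|is_].
by exists (i, b); split=> //=; case: (b).
Qed.

Lemma mem_vs v : (v \in vs) = in_vs v.
Proof.
rewrite /vs !mem_cat; case: v => [i|t b|i|b|i b] /=;
  rewrite ?(mem_map VSinj) ?(mem_map VTinj) ?inpair ?mem_forks ?mem_iota ?add0n;
  rewrite ?notmap ?notpair ?orbF/=;
  try (by []); try (by move=> ? ? ? ? []); try (by case: lp; rewrite ?orbF).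
by case: lp; case: b.
Qed.

Lemma mem_es e : (e \in es) = in_es e.
Proof.
rewrite /es !mem_cat; case: e => [i|t|t b|i|i b] /=;
  rewrite ?(mem_map ESinj) ?(mem_map ECinj) ?(mem_map ETinj) ?inpair;
  rewrite ?mem_forks ?mem_iota ?add0n;
  rewrite ?notmap ?notpair ?orbF//=;
  by move=> ? ? ? ? [].
Qed.

Lemma sout_es i : i < n -> ES (sout i) \in es.
Proof.
by rewrite mem_es /sout /=; case: lp => /=; first (case: eqP => /=); lia.
Qed.

Lemma ES_es i : i < n -> ES i \in es.
Proof. by move=> ilt; rewrite mem_es /= ltn_addr. Qed.

Let uniq_pairs (U : eqType) (f : nat -> bool -> U) s :
  (forall i b j d, f i b = f j d -> i = j /\ b = d) -> uniq s ->
  uniq (bpairs f s).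
Proof.
move=> H us; apply: allpairs_uniq => // -[x a] [y b] _ _ /= /H[-> ->//].
Qed.

Let uniq_disj (U : eqType) (s t : seq U) :
  uniq s -> uniq t -> {in t, forall x, x \notin s} -> uniq (s ++ t).
Proof.
move=> us ut st; rewrite cat_uniq us ut andbT; apply/hasPn => x /st //.
Qed.

Let in_ends x : x \in (if lp then [::] else [:: VX false; VX true]) ->
  exists b, x = VX b.
Proof.
case: lp => //; rewrite !inE => /orP[]/eqP->; by [exists false|exists true].
Qed.

Lemma uniq_vs : uniq vs.
Proof.
rewrite /vs; repeat apply: uniq_disj.
- by rewrite map_inj_uniq ?iota_uniq.
- by apply: uniq_pairs; rewrite ?iota_uniq// => ? ? ? ? [].
- by rewrite map_inj_uniq ?iota_uniq.
- by case: lp.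
- by apply: uniq_pairs; rewrite ?filter_uniq ?iota_uniq// => ? ? ? ? [].
- by move=> x /allpairsP[[y b] [_ _ ->]]; case: lp; rewrite ?inE.
- by move=> x; rewrite mem_cat => /orP[/in_ends[b ->]|/allpairsP[[y b] [_ _ ->]]];
    rewrite notmap.
- by move=> x; rewrite !mem_cat => /orP[/mapP[i _ ->]|
    /orP[/in_ends[b ->]|/allpairsP[[y b] [_ _ ->]]]]; rewrite notpair.
- by move=> x; rewrite !mem_cat =>
    /orP[/allpairsP[[y b] [_ _ ->]]|/orP[/mapP[i _ ->]|
    /orP[/in_ends[b ->]|/allpairsP[[y b] [_ _ ->]]]]]; rewrite notmap.
Qed.

Lemma uniq_es : uniq es.
Proof.
rewrite /es; repeat apply: uniq_disj.
- by rewrite map_inj_uniq ?iota_uniq.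
- by rewrite map_inj_uniq ?iota_uniq.
- by apply: uniq_pairs; rewrite ?iota_uniq// => ? ? ? ? [].
- by rewrite map_inj_uniq ?iota_uniq.
- by apply: uniq_pairs; rewrite ?filter_uniq ?iota_uniq// => ? ? ? ? [].
- by move=> x /allpairsP[[y b] [_ _ ->]] /=; rewrite notmap.
- by move=> x; rewrite mem_cat => /orP[/mapP[i _ ->]|/allpairsP[[y b] [_ _ ->]]];
    rewrite notpair.
- by move=> x; rewrite !mem_cat => /orP[/allpairsP[[y b] [_ _ ->]]|
   /orP[/mapP[i _ ->]|/allpairsP[[y b] [_ _ ->]]]]; rewrite notmap.
- by move=> x; rewrite !mem_cat => /orP[/mapP[i _ ->]|/orP[/allpairsP[[y b] [_ _ ->]]|
   /orP[/mapP[i _ ->]|/allpairsP[[y b] [_ _ ->]]]]]; rewrite notmap.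
Qed.

(** [wf_loop] and [wf_open] exclude the degenerate strings: a loop with two vertices, whose edges
    share both end points, and a path with one vertex and equal weights over [-oo], whose ends could
    form a symmetric fork. The edges of the cycles have weight [hw i0], which must be odd in a
    zigzag cover. *)
Record wf_data : Prop := WfData {
  wf_n : 0 < n;
  wf_i0 : i0 < n;
  wf_hw : forall i, i < n -> 0 < hw i;
  wf_fk : forall i, i < n -> fk i -> odd (hw i);
  wf_cyc : 0 < c -> odd (hw i0);
  wf_base : odd `|base D|;
  wf_loop : lp -> 2 < n /\ W n = base D;
  wf_open : ~~ lp -> (0 < base D)%R /\ ~ (n = 1 /\ W n = (- base D)%R)
}.

(** [tl1 i] is the edge of tail [i] at the string; [nxt t] is the even edge leaving the [t]-th cycle
    away from the string. *)
Definition tl1 i : redge := if (i == i0) && (0 < c) then EC 0 else ET i.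
Definition nxt t : redge := if t.+1 < c then EC t.+1 else ET i0.

Definition halves (v : rvert) : seq (redge * bool) :=
  match v with
  | VS i => [:: (ES i, true); (ES (sout i), false); (tl1 i, false)]
  | VC t false => [:: (EC t, true); (EO t false, false); (EO t true, false)]
  | VC t true => [:: (EO t false, true); (EO t true, true); (nxt t, false)]
  | VT i => (ET i, true) ::
      (if fk i then [:: (EF i false, false); (EF i true, false)] else [::])
  | VX b => [:: (ES (if b then n else 0), b)]
  | VF i b => [:: (EF i b, true)]
  end.

Hypothesis wfD : wf_data.

Lemma rbd_vs e b : e \in es -> rbd e b \in vs.
Proof.
have n0 := wf_n wfD; have i0n := wf_i0 wfD.
rewrite mem_es mem_vs; case: e b => [j|t|t d|i|i d] [] //=.
- by case: (eqVneq j n) => [->|jn] /=; case: lp => /=; rewrite ?addn0 ?addn1; lia.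
- by case: j => [|j] /=; case E: lp => /=; rewrite ?E//=; lia.
- by case: t => [|t]//=; lia.
- by case: ifP => //= /andP[_]; lia.
- by case/andP.
Qed.

(** Together with [uniq_halves] this makes [halves v] an enumeration of the half-edges at [v], so
    valences and balancing become sums of at most three terms. *)
Lemma mem_halves v h :
  v \in vs -> (h \in halves v) = (h.1 \in es) && (rbd h.1 h.2 == v).
Proof.
have n0 := wf_n wfD; have i0n := wf_i0 wfD; have wl := wf_loop wfD.
rewrite mem_vs mem_es => vV; apply/idP/andP => [|[]].
- move: vV; case: v => [i|t [] |i|b|i b] /=; rewrite !inE.
  + move=> ilt /or3P[]/eqP-> /=.
    * by rewrite ifF; [split=> //; lia|lia].
    * rewrite /sout; move: wl; case: lp => /= wl; last by split=> //; lia.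
      case: (eqVneq i.+1 n) => [<-//|ne]; split => //=; lia.
    * rewrite /tl1; case: ifP => [/andP[/eqP-> c0]|/= E]; first by split.
      by rewrite E.
  + move=> tc /or3P[]/eqP-> //=.
    by rewrite /nxt; case: ifP => //= tc'; rewrite eqxx (leq_ltn_trans _ tc)//=; split=> //;
      apply/eqP; congr (VC _ _); lia.
  + by move=> tc /or3P[]/eqP-> //=.
  + move=> ilt /orP[/eqP->//|]; case: ifP => // fi; rewrite !inE.
    by case/orP=> /eqP-> /=; rewrite ilt fi.
  + move=> nlp /eqP->/=; case: b => /=; rewrite ?eqxx ?nlp ?(negPf nlp); split=> //; lia.
  + by move=> H /eqP->.
- move: vV; case: h => e d; case: v => [i|t q |i|b|i b]; case: e => [j|s|s p|j|j p] /=;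
    case: d => //=; rewrite ?inE.
  + by move=> ilt jlt; case: ifP => _ /eqP // [->]; rewrite eqxx.
  + rewrite /sout; case: j => [|j]; case: lp => //= ilt jlt /eqP // [<-].
    * by rewrite prednK// !eqxx/= orbT.
    * by rewrite ifF ?eqxx ?orbT//; lia.
    * by rewrite eqxx orbT.
  + by case: s => [|s] ilt sc /eqP // [<-]; rewrite /tl1 eqxx sc /= ?eqxx ?orbT.
  + move=> ilt jlt; case: ifP => E /eqP // [<-]; by rewrite /tl1 E /= ?eqxx ?orbT.
  + by move=> ilt jlt; case: ifP => _ /eqP.
  + by case: j => [|j] ? ?; case: lp => /eqP.
  + by move=> _ _ /eqP[-> <-]; rewrite inE eqxx.
  + case: s => [|s] sc sc' /eqP // [<- <-]; by rewrite !inE /nxt sc' /= ?eqxx ?orbT.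
  + by move=> _ _ /eqP[-> <-]; rewrite !inE; case: p; rewrite eqxx ?orbT.
  + by move=> _ _ /eqP[-> <-]; rewrite !inE; case: p; rewrite eqxx ?orbT.
  + move=> tc jlt; case: ifP => E /eqP // [<- <-]; move: E => /andP[/eqP-> c0].
    by rewrite !inE /nxt prednK// ltnn /= ?eqxx ?orbT.
  + by move=> ? ?; case: ifP => _ /eqP.
  + by case: j => [|j] ? ?; case: lp => /eqP.
  + by case: s => [|s] ? ? /eqP.
  + by move=> _ _ /eqP[->]; rewrite eqxx.
  + by move=> ? ?; case: ifP => _ /eqP.
  + by move=> _ /andP[_ fj] /eqP[<-]; rewrite fj !inE; case: p; rewrite eqxx ?orbT.
  + by move=> ? ?; case: ifP => [/eqP->|_] /eqP // [<-]; rewrite eqxx.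
  + by case: j => [|j] ? ?; case: lp => /eqP // [<-]; rewrite eqxx.
  + by case: s => [|s] ? ? /eqP.
  + by move=> ? ?; case: ifP => _ /eqP.
  + by move=> ? ?; case: ifP => _ /eqP.
  + by case: j => [|j] ? ?; case: lp => /eqP.
  + by case: s => [|s] ? ? /eqP.
  + by move=> ? ?; case: ifP => _ /eqP.
  + by move=> ? ? /eqP[-> ->]; rewrite eqxx.
Qed.

Lemma uniq_halves v : v \in vs -> uniq (halves v).
Proof.
rewrite mem_vs; case: v => [i|t [] |i|b|i b] //= _.
- rewrite /tl1 !inE; case: ifP => _; rewrite !xpair_eqE ?andbF /= ?andbT;
  by apply/eqP.
- rewrite /nxt !inE !xpair_eqE ?andbF /= ?andbT ?orbF; by apply/eqP => -[].
- rewrite !inE xpair_eqE /= ?andbT; by apply/eqP => -[].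
- case: ifP => // _; rewrite !inE !xpair_eqE ?andbF /= inE !xpair_eqE /= ?andbT;
  by apply/eqP => -[].
Qed.

Lemma size_halves v : v \in vs -> size (halves v) = if inner v then 3 else 1.
Proof.
by rewrite mem_vs; case: v => [i|t [] |i|b|i b] //=; case: ifP.
Qed.

End Zdata.

(** * The cover given by an order of the vertices *)

Section Cover.
Variables (R : realType) (P : seq R) (D : zdata) (key : rvert -> nat).
Local Notation n := (ntail D).
Local Notation lp := (looped D).
Local Notation c := (ncyc D).
Local Notation i0 := (cyci D).
Local Notation vs := (vs D).
Local Notation es := (es D).
Local Notation rbd := (rbd D).

(* [key] orders the inner vertices; the [m]-th one is sent to the [m]-th point of [P]. *)
Definition inner_vs : seq rvert := [seq v <- vs | inner D v].

Definition rank v : nat := count (fun u => inner D u && (key u < key v)) vs.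
Definition posn v : R := nth 0%R (sort <=%R P) (rank v).
Definition rphi v : \bar R :=
  if inner D v then (posn v)%:E else if rend D v then +oo%E else -oo%E.

(** The number of vertices is written as a successor so that [inord] applies; [size_vs_gt0] shows
    that this changes nothing. *)
Definition cov_graph : multigraph :=
  @Multigraph (size vs).-1.+1 (size es)
    (fun e b => inord (index (rbd (nth (ES 0) es e) b) vs)).

Definition rv (v : vert cov_graph) : rvert := nth (VS 0) vs v.
Definition re (e : edge cov_graph) : redge := nth (ES 0) es e.
Definition vi (v : rvert) : vert cov_graph := inord (index v vs).

(** Positions and weights are prescribed, and the length of an inner edge is whatever makes its
    slope equal to its weight. This is why any order compatible with the directions is
    admissible. *)
Definition cov : pl_map R :=
  @PLMap R cov_graph
   (fun e => (`|fine (rphi (rv (bd e true))) - fine (rphi (rv (bd e false)))|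
              / (rwt D (re e))%:R)%R)
   (fun v => rphi (rv v)) (fun e => rwt D (re e)).

Record valid_key : Prop := ValidKey {
  key_inj : {in [pred v | (v \in vs) && inner D v] &, injective key};
  key_dir : forall e, e \in es -> inner D (rbd e false) -> inner D (rbd e true) ->
    if rdir D e then key (rbd e false) < key (rbd e true)
    else key (rbd e true) < key (rbd e false)
}.

Hypothesis wfD : wf_data D.
Hypothesis vkey : valid_key.
Hypothesis sizeP : size P = size inner_vs.
Hypothesis uniqP : uniq P.

Let VS0 : VS 0 \in vs. Proof. by rewrite mem_vs /= (wf_n wfD). Qed.
Lemma size_vs_gt0 : (size vs).-1.+1 = size vs.
Proof. by case: vs VS0. Qed.

Let vlt (v : vert cov_graph) : v < size vs.
Proof. by have := ltn_ord v; rewrite [X in _ < X]size_vs_gt0. Qed.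

Lemma rv_vs v : rv v \in vs.
Proof. by apply: mem_nth; exact: vlt. Qed.
Lemma re_es e : re e \in es.
Proof. by apply: mem_nth. Qed.
Lemma viK v : v \in vs -> rv (vi v) = v.
Proof.
by move=> vV; rewrite /rv /vi inordK ?nth_index// size_vs_gt0 index_mem.
Qed.
Lemma rvK v : vi (rv v) = v.
Proof.
by rewrite /vi /rv index_uniq ?uniq_vs ?vlt//; exact: inord_val.
Qed.
Lemma rv_inj : injective rv. Proof. exact: can_inj rvK. Qed.
Lemma re_inj : injective re.
Proof.
by move=> x y /eqP; rewrite nth_uniq ?uniq_es// => /eqP/val_inj.
Qed.
Lemma re_onto e : e \in es -> exists i, re i = e.
Proof.
by rewrite -index_mem => ei; exists (Ordinal ei); rewrite /re/= nth_index -?index_mem.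
Qed.
Lemma bdE e b : bd e b = vi (rbd (re e) b) :> vert cov_graph. Proof. by []. Qed.
Lemma rv_bd (e : edge cov_graph) b : rv (bd e b) = rbd (re e) b.
Proof. by rewrite bdE viK// rbd_vs ?re_es. Qed.
Lemma bd_eq (e : edge cov_graph) b v : (bd e b == v) = (rbd (re e) b == rv v).
Proof. by rewrite -rv_bd (inj_eq rv_inj). Qed.

Lemma rank_le u v : key u <= key v -> rank u <= rank v.
Proof.
by move=> uv; apply: sub_count => w /andP[-> /=]; move/leq_trans; apply.
Qed.

Lemma rank_lt u v : u \in vs -> inner D u -> key u < key v -> rank u < rank v.
Proof.
move=> uV iu uv; rewrite /rank.
(* [u] itself is below [v] but not below [u], which makes the inequality strict. *)
rewrite -!size_filter -(@size_rcons _ _ u).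
apply: uniq_leq_size; first by rewrite rcons_uniq mem_filter ltnn andbF filter_uniq ?uniq_vs.
move=> w; rewrite mem_rcons inE !mem_filter => /predU1P[->|].
  by rewrite iu uv uV.
by move=> /andP[/andP[-> /= wu] ->]; rewrite andbT (ltn_trans wu).
Qed.

Lemma rank_ltE u v : u \in vs -> inner D u -> (rank u < rank v) = (key u < key v).
Proof.
move=> uV iu; apply/idP/idP; last exact: rank_lt.
by apply: contraLR; rewrite -!leqNgt; exact: rank_le.
Qed.

Lemma rank_inj : {in [pred v | (v \in vs) && inner D v] &, injective rank}.
Proof.
move=> u v uI vI E; apply: (key_inj vkey) => //; move: uI vI.
rewrite !inE => /andP[uV iu] /andP[vV iv].
by case: (ltngtP (key u) (key v)) => // /rank_lt h;
  [have := h uV iu | have := h vV iv]; rewrite E ltnn.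
Qed.

Lemma rank_max v : v \in vs -> inner D v -> rank v < size P.
Proof.
move=> vV iv; rewrite sizeP /inner_vs size_filter /rank.
rewrite -!size_filter -(@size_rcons _ _ v).
apply: uniq_leq_size; first by rewrite rcons_uniq mem_filter ltnn andbF filter_uniq ?uniq_vs.
move=> w; rewrite mem_rcons inE !mem_filter => /predU1P[->|].
  by rewrite iv.
by move=> /andP[/andP[-> _] ->].
Qed.

Lemma posn_inj u v : u \in vs -> v \in vs -> inner D u -> inner D v ->
  posn u = posn v -> u = v.
Proof.
move=> uV vV iu iv /eqP; rewrite nth_uniq ?sort_uniq ?size_sort ?rank_max//.
by move=> /eqP /rank_inj; apply; rewrite inE ?uV ?vV.
Qed.

Lemma posn_lt u v : u \in vs -> v \in vs -> inner D u -> inner D v ->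
  (posn u < posn v)%R = (key u < key v).
Proof.
have h (x y : rvert) : x \in vs -> y \in vs -> inner D x -> inner D y ->
    key x < key y -> (posn x < posn y)%R.
  move=> xV yV ix iy xy.
  apply: (@sorted_ltn_nth _ <%R%O); first exact: lt_trans.
  - by rewrite lt_sorted_uniq_le sort_uniq uniqP sort_le_sorted.
  - by rewrite inE size_sort rank_max.
  - by rewrite inE size_sort rank_max.
  - exact: rank_lt.
move=> uV vV iu iv; apply/idP/idP; last exact: h.
apply: contraLR; rewrite -leqNgt -leNgt leq_eqVlt => /orP[/eqP E|/h/ltW]; last exact.
by rewrite (key_inj vkey (x:=v) (y:=u))// inE ?uV ?vV.
Qed.

Lemma rphi_lt u v : u \in vs -> v \in vs -> inner D u -> inner D v ->
  (rphi u < rphi v)%E = (key u < key v).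
Proof. by move=> *; rewrite /rphi !ifT// lte_fin posn_lt. Qed.

Lemma rphi_inj u v : u \in vs -> v \in vs -> inner D u ->
  rphi u = rphi v -> u = v.
Proof.
move=> uV vV iu; rewrite /rphi iu; case: ifP => [iv [/posn_inj]|_]; first exact.
by case: ifP.
Qed.

(** Between inner vertices this is the condition on keys. At an end the value is infinite, with the
    sign that the direction of the edge demands, and no edge joins two ends. *)
Lemma rphi_dir e : e \in es ->
  if rdir D e then (rphi (rbd e false) < rphi (rbd e true))%E
  else (rphi (rbd e true) < rphi (rbd e false))%E.
Proof.
move=> eE; have := key_dir vkey eE.
have V0 := rbd_vs wfD false eE; have V1 := rbd_vs wfD true eE.
case i0E : (inner D (rbd e false)); case i1E : (inner D (rbd e true)).
- by move/(_ isT isT); case: ifP => _; rewrite -rphi_lt.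
- move=> _; rewrite [rphi (rbd _ true)]/rphi [rphi (rbd _ false)]/rphi i0E i1E.
  have -> : rend D (rbd e true) = rdir D e.
    move: eE i0E i1E; rewrite mem_es; case: (e) => [j|t|t d|i|i d] //=.
    by case: eqP => // ->.
  by case: (rdir D e); rewrite /= ?ltry ?ltNyr.
- move=> _; rewrite [rphi (rbd _ true)]/rphi [rphi (rbd _ false)]/rphi i0E i1E.
  have -> : rend D (rbd e false) = ~~ rdir D e.
    move: eE i0E i1E; rewrite mem_es; case: (e) => [j|t|t d|i|i d] //=.
    + case: j => //=; have := wf_open wfD.
      by case: lp => //= -[]// b0 _ _ _ _; rewrite W0 b0.
    + by case: t.
    + by case: ifP.
  by case: (rdir D e); rewrite /= ?ltry ?ltNyr.
- move: eE i0E i1E; rewrite mem_es; case: (e) => [j|t|t d|i|i d] //=.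
  + by case: j => [|j] //= _ _; rewrite ifF//; have := wf_n wfD; lia.
  + by case: ifP.
  + by move=> /andP[_ ->].
Qed.

(** Valences, the weights on both sides and the valence within the string all come from this
    transfer, for different [F]. *)
Lemma half_sum (F : redge -> bool -> nat) (v : vert cov_graph) :
  \sum_(h : edge cov_graph * bool | bd h.1 h.2 == v) F (re h.1) h.2 =
  \sum_(h <- halves D (rv v)) F h.1 h.2.
Proof.
have -> : \sum_(h <- halves D (rv v)) F h.1 h.2 =
   \sum_(h <- [seq h <- [seq (e, b) | e <- es, b <- index_enum bool] |
      rbd h.1 h.2 == rv v]) F h.1 h.2.
  apply: perm_big; apply: uniq_perm.
  - exact: uniq_halves (rv_vs v).
  - by rewrite filter_uniq// allpairs_uniq ?uniq_es ?index_enum_uniq// => -[? ?] [].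
  - move=> h; rewrite mem_halves ?rv_vs// mem_filter andbC; congr (_ && _).
    apply/idP/allpairsP => [he|[[e b] [? _ ->]]//].
    by exists h; rewrite mem_index_enum; split=> //; case: h he.
rewrite big_filter [RHS]big_mkcond.
rewrite big_allpairs_dep /= (big_nth (ES 0)) big_mkord.
rewrite pair_big /= big_mkcond /=.
by apply: eq_bigr => h _; rewrite bd_eq.
Qed.

Lemma valenceE (v : vert cov_graph) : valence v = size (halves D (rv v)).
Proof.
rewrite -sum1_size -(half_sum (fun _ _ => 1)) sum1_card.
by apply: eq_card => h; rewrite !inE.
Qed.

Lemma is_endE (v : vert cov_graph) : is_end v = ~~ inner D (rv v).
Proof.
by rewrite /is_end valenceE size_halves ?rv_vs//; case: ifP.
Qed.

Lemma leafE (e : edge cov_graph) :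
  leaf e = ~~ (inner D (rbd (re e) false) && inner D (rbd (re e) true)).
Proof.
rewrite negb_and -!rv_bd -!is_endE; apply/existsP/orP => [[[] ->]|[]]; auto.
- by exists false.
- by exists true.
Qed.

Lemma cov_preimage : preimage_of_R cov.
Proof.
move=> v; rewrite is_endE negbK /= /rphi.
by case: ifP => // _; case: ifP.
Qed.

Lemma rwt_gt0 e : e \in es -> 0 < rwt D e.
Proof.
have n0 := wf_n wfD; have i0n := wf_i0 wfD; have h := wf_hw wfD.
rewrite mem_es; case: e => [j|t|t d|i|i d] /=.
- by move=> _; have := odd_W j (wf_base wfD); case: `|_|.
- by move=> _; rewrite muln_gt0 h.
- by move=> _; rewrite h.
- by move=> ?; rewrite muln_gt0 h.
- by move=> /andP[? _]; rewrite h.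
Qed.

Lemma rphi_neq e : e \in es -> rphi (rbd e false) != rphi (rbd e true).
Proof.
by move=> /rphi_dir; case: ifP => _ /lt_eqF E; [|rewrite eq_sym]; rewrite E.
Qed.

Lemma cov_pl : is_pl_map cov.
Proof.
split=> e; last by move=> _ /=; rewrite rwt_gt0 ?re_es.
move=> le /=; rewrite mulrC divfK// pnatr_eq0 -lt0n rwt_gt0 ?re_es//.
Qed.

Lemma cov_len (e : edge cov) : ~~ leaf e -> (0 < len e)%R.
Proof.
rewrite leafE negbK => /andP[ia ib] /=.
rewrite divr_gt0 ?ltr0n ?rwt_gt0 ?re_es// normr_gt0 subr_eq0.
have := rphi_neq (re_es e); rewrite !rv_bd /rphi ia ib /=.
by rewrite eq_sym => H; apply: contraNneq H => ->.
Qed.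

Let conn (u v : rvert) := connect (adj predT) (vi u) (vi v).
Let conn_sym : connect_sym (adj (G := cov_graph) predT).
Proof.
apply: sym_connect_sym => u v; apply/existsP/existsP => -[e /= /existsP[b /andP[h h']]];
  exists e; apply/existsP; exists (~~ b); by rewrite negbK h h'.
Qed.
Let conn_edge e : e \in es -> conn (rbd e false) (rbd e true).
Proof.
move=> /re_onto[i <-]; apply: connect1; apply/existsP; exists i => /=.
by apply/existsP; exists false; rewrite /= -!bdE !eqxx.
Qed.
Let connC u v : conn u v -> conn v u.
Proof. by rewrite /conn conn_sym. Qed.
Let conn_trans u v w : conn u v -> conn v w -> conn u w.
Proof. exact: connect_trans. Qed.

Lemma cov_connected : connected_graph cov_graph.
Proof.
have n0 := wf_n wfD; have i0n := wf_i0 wfD.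
have cS j : j < n -> conn (VS 0) (VS j).
  elim: j => [|j IH] jn; first exact: connect0.
  apply: conn_trans (IH (ltnW jn)) _.
  have := @conn_edge (ES j.+1); rewrite mem_es /= ifF; last by lia.
  by apply; lia.
have cC t : t < c -> conn (VS 0) (VC t false) /\ conn (VS 0) (VC t true).
  elim: t => [|t IH] tc.
    have h : conn (VS 0) (VC 0 false).
      apply: conn_trans (cS _ i0n) _.
      by have := @conn_edge (EC 0); rewrite mem_es /=; apply.
    split=> //; apply: conn_trans h _.
    by have := @conn_edge (EO 0 true); rewrite mem_es /=; apply.
  have h : conn (VS 0) (VC t.+1 false).
    apply: conn_trans (IH (ltnW tc)).2 _.
    by have := @conn_edge (EC t.+1); rewrite mem_es /=; apply.
  split=> //; apply: conn_trans h _.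
  by have := @conn_edge (EO t.+1 true); rewrite mem_es /=; apply.
have cT i : i < n -> conn (VS 0) (VT i).
  move=> ilt; have := @conn_edge (ET i); rewrite mem_es /= => /(_ ilt).
  apply: conn_trans; case: ifP => [/andP[_ c0]|_]; last exact: cS.
  by apply: (cC _ _).2; rewrite prednK.
have c0 v : v \in vs -> conn (VS 0) v.
  rewrite mem_vs; case: v => [i|t b|i|b|i b] /=.
  - exact: cS.
  - by move=> /cC[]; case: b.
  - exact: cT.
  - move=> nlp; case: b.
      have := @conn_edge (ES n); rewrite mem_es /= nlp eqxx addn1 => /(_ (leqnn _)).
      by apply: conn_trans; case: (n) n0 cS => //= m _; apply.
    apply: connC; have := @conn_edge (ES 0); rewrite mem_es /= (negPf nlp).
    by rewrite ifF//; [apply; lia|lia].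
  - move=> /andP[ilt fi]; have := @conn_edge (EF i b); rewrite mem_es /= ilt fi.
    by move=> /(_ isT); apply: conn_trans; exact: cT.
move=> u v; rewrite -(rvK u) -(rvK v).
by apply: conn_trans (c0 _ (rv_vs v)); apply: connC; exact: c0 (rv_vs u).
Qed.

Lemma cov_curve : is_tropical_curve cov.
Proof.
split; [exact: cov_connected| |exact: cov_len].
by move=> v; rewrite valenceE size_halves ?rv_vs//; case: ifP.
Qed.

Lemma half_dir e b : e \in es ->
  (rphi (rbd e b) < rphi (rbd e (~~ b)))%E = (rdir D e (+) b).
Proof.
move=> /rphi_dir; case: b => /=; case: (rdir D e) => //= h;
  by apply/negbTE; rewrite -leNgt ltW.
Qed.

Lemma half_dirC e b : e \in es ->
  (rphi (rbd e (~~ b)) < rphi (rbd e b))%E = ~~ (rdir D e (+) b).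
Proof. by move=> eE; rewrite -{2}(negbK b) half_dir// addbN. Qed.

Lemma weight_rightE (v : vert cov) :
  weight_right v = \sum_(h <- halves D (rv v) | rdir D h.1 (+) h.2) rwt D h.1.
Proof.
rewrite [RHS]big_mkcond -(half_sum (fun e b => if rdir D e (+) b then rwt D e else 0)).
rewrite /weight_right big_mkcondr; apply: eq_bigr => h /eqP <- /=.
by rewrite !rv_bd half_dir ?re_es.
Qed.

Lemma weight_leftE (v : vert cov) :
  weight_left v = \sum_(h <- halves D (rv v) | ~~ (rdir D h.1 (+) h.2)) rwt D h.1.
Proof.
rewrite [RHS]big_mkcond -(half_sum (fun e b => if ~~ (rdir D e (+) b) then rwt D e else 0)).
rewrite /weight_left big_mkcondr; apply: eq_bigr => h /eqP <- /=.
by rewrite !rv_bd half_dirC ?re_es.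
Qed.

(** At a string vertex, balancing is the recursion [WS] for signed weights, the signs deciding on
    which side the absolute values stand. On a tail an even edge of weight 2h faces two edges of
    weight h. *)
Lemma cov_morphism : is_tropical_morphism cov.
Proof.
move=> v; rewrite is_endE negbK weight_leftE weight_rightE; have := rv_vs v.
rewrite mem_vs; case: (rv v) => [i|t [] |i|b|i b] //=; rewrite ?big_cons ?big_nil /=.
- move=> ilt _.
  have rt : rdir D (tl1 D i) = right D i.
    by rewrite /tl1; case: ifP => //= /andP[/eqP->].
  have wt1 : rwt D (tl1 D i) = 2 * hw D i.
    by rewrite /tl1; case: ifP => //= /andP[/eqP->].
  rewrite rt wt1.
  (* At the last vertex of a loop the outgoing edge is [ES 0], whose weight agrees by the closing
     condition. *)
  have -> : W D (sout D i) = W D i.+1.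
    rewrite /sout; case: ifP => // /andP[l /eqP->].
    by have [_ ->] := wf_loop wfD l; rewrite W0.
  have nz j : `|W D j| != 0 by have := odd_W j (wf_base wfD); case: `|_|.
  have := WS ilt; have := nz i; have := nz i.+1; move: (W D i) (W D i.+1) => x y.
  rewrite /= /it_step -/(right D i) -/(hw D i).
  by have [hx|hx] := boolP (0 < x)%R; have [hy|hy] := boolP (0 < y)%R;
    case: right => /=; lia.
- move=> tc _.
  have -> : rdir D (nxt D t) = right D i0 by rewrite /nxt; case: ifP.
  have -> : rwt D (nxt D t) = 2 * hw D i0 by rewrite /nxt; case: ifP.
  by case: right => /=; lia.
- by move=> tc _; case: right => /=; lia.
- move=> ilt ->; rewrite !big_cons !big_nil /=.
  by case: right => /=; lia.
Qed.
End Cover.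

(** * Genus, weights at the ends and branch points *)

Lemma size_bpairs (U : Type) (f : nat -> bool -> U) s :
  size (bpairs f s) = 2 * size s.
Proof. by rewrite size_allpairs mulnC. Qed.

Lemma count_bpairs (U : Type) (f : nat -> bool -> U) (a : pred U) s :
  count a (bpairs f s) = count (fun i => a (f i false)) s + count (fun i => a (f i true)) s.
Proof.
by rewrite /bpairs; elim: s => //= x s ->; lia.
Qed.

Definition tail_ends (side : bool) (s : seq item) : seq nat :=
  flatten [seq if it_fork x then [:: it_half x; it_half x] else [:: 2 * it_half x]
          | x <- s & it_right x == side].

(** An open string starts over [-oo], since [wf_open] makes [base] positive; the sign of its last
    weight tells where it stops. *)
Definition string_ends (D : zdata) (side : bool) : seq nat :=
  if looped D then [::] else
  (if side then [::] else [:: `|base D|]) ++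
  (if (0 < W D (ntail D))%R == side then [:: `|W D (ntail D)|] else [::]).

Lemma tail_ends_perm side s t :
  perm_eq s t -> perm_eq (tail_ends side s) (tail_ends side t).
Proof.
by move=> st; apply: perm_flatten; apply: perm_map; apply: perm_filter.
Qed.

Lemma count_tail_ends (a : pred nat) side s :
  count a (tail_ends side s) =
  count (fun x => [&& ~~ it_fork x, it_right x == side & a (2 * it_half x)]) s +
  2 * count (fun x => [&& it_fork x, it_right x == side & a (it_half x)]) s.
Proof.
elim: s => //= x s; rewrite /tail_ends /=; case: (it_right x == side) => /=;
  case: (it_fork x) => /=; rewrite ?count_cat => ->//=; lia.
Qed.

Lemma size_inner_vs (D : zdata) :
  size (inner_vs D) = ntail D + 2 * ncyc D + size (forks D).
Proof.
rewrite /inner_vs size_filter /vs !count_cat !count_map !count_bpairs.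
rewrite (eq_count (a2 := predT))// count_predT size_iota.
rewrite [count _ (iota 0 (ncyc D))](eq_count (a2 := predT))// count_predT size_iota.
rewrite -size_filter -/(forks D).
rewrite [count _ (forks D)](eq_count (a2 := pred0))// count_pred0.
by case: (looped D) => /=; lia.
Qed.

Section CoverType.
Variables (R : realType) (P : seq R) (D : zdata) (key : rvert -> nat).
Local Notation n := (ntail D).
Local Notation lp := (looped D).
Local Notation c := (ncyc D).
Local Notation i0 := (cyci D).
Local Notation vs := (vs D).
Local Notation es := (es D).
Local Notation rbd := (rbd D).
Local Notation cov := (cov P D key).
Local Notation rphi := (rphi P D key).
Hypothesis wfD : wf_data D.
Hypothesis vkey : valid_key D key.
Hypothesis sizeP : size P = size (inner_vs D).
Hypothesis uniqP : uniq P.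

Lemma size_forks : size (forks D) = count it_fork (items D).
Proof.
by rewrite size_filter -[in RHS](mkseq_nth item0 (items D)) count_map.
Qed.

Lemma cov_genus : genus cov = c + lp.
Proof.
rewrite /genus !card_ord /= (size_vs_gt0 wfD) /vs /es.
rewrite !size_cat !size_map !size_bpairs !size_iota.
by have := wf_n wfD; case: lp => /=; lia.
Qed.

Lemma rphi_inf v (side : bool) :
  (rphi v == if side then +oo%E else -oo%E) = ~~ inner D v && (rend D v == side).
Proof.
rewrite /rphi; case: ifP => _ /=; first by case: side.
by case: rend; case: side.
Qed.

Lemma leaf_weightsE (p : \bar R) :
  leaf_weights cov p =
  [seq rwt D e | e <- es & [exists b, rphi (rbd e b) == p]].
Proof.
rewrite /leaf_weights; set F := (fun e : edge cov => [exists b, _]).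
have -> : es = [seq re e | e <- enum (edge cov)].
  by rewrite /re [LHS](_ : _ = [seq nth (ES 0) es i | i <- [seq val i | i <- enum (edge cov)]]);
    [rewrite -map_comp|rewrite val_enum_ord map_nth_iota0 ?take_size].
rewrite filter_map -map_comp; congr map.
apply: eq_filter => e /=; apply: eq_existsb => b.
by rewrite -(rv_bd wfD).
Qed.

Lemma cov_leaf_weights side :
  perm_eq (leaf_weights cov (if side then +oo%E else -oo%E))
          (string_ends D side ++ tail_ends side (items D)).
Proof.
have n0 := wf_n wfD.
rewrite leaf_weightsE.
have -> : [seq e <- es | [exists b, rphi (rbd e b) == (if side then +oo%E else -oo%E)]] =
  [seq e <- es | [exists b, ~~ inner D (rbd e b) && (rend D (rbd e b) == side)]].
  by apply: eq_filter => e; apply: eq_existsb => b; rewrite rphi_inf.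
have exb (Q : pred bool) : [exists b, Q b] = Q false || Q true.
  by apply/existsP/orP => [[[] ->]|[]]; auto; [exists false|exists true].
rewrite (eq_filter (fun e => exb _)).
apply/seq.permP => a.
rewrite count_map count_filter /es !count_cat count_tail_ends.
have -> : count (predI (preim (rwt D) a) (fun e =>
    (~~ inner D (rbd e false) && (rend D (rbd e false) == side))
    || (~~ inner D (rbd e true) && (rend D (rbd e true) == side))))
   [seq ES i | i <- iota 0 (n + ~~ lp)] = count a (string_ends D side).
  rewrite count_map /string_ends; case E : lp => /=.
    rewrite addn0; apply/eqP; rewrite -leqn0 leqNgt -has_count; apply/hasPn => j.
    rewrite mem_iota /= add0n => jn; rewrite [j == n]ltn_eqF//=.
    by case: j jn => [|j] jn /=; rewrite ?E ?andbF.
  have -> : n + 1 = 1 + ((n - 1) + 1) by lia.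
  rewrite !iotaD !count_cat /= !add0n !addn0 E /=.
  have -> : 1 + (n - 1) = n by lia.
  rewrite eqxx ifF /=; last by lia.
  rewrite [count _ (iota 1 _)](_ : _ = 0); last first.
    apply/eqP; rewrite -leqn0 leqNgt -has_count; apply/hasPn => j.
    rewrite mem_iota /= => jn; rewrite [j == n]ltn_eqF//=; last by lia.
    by case: j jn => [|j] jn //=; rewrite ?andbF.
  rewrite W0 /= orbF add0n.
  by case: side => /=; case: (0 < W D n)%R => /=; rewrite ?andbT ?andbF ?addn0.
congr (_ + _).
rewrite !count_map !count_bpairs.
have zero (Q : pred nat) s : (forall j, j \in s -> ~~ Q j) -> count Q s = 0.
  by move=> H; apply/eqP; rewrite -leqn0 leqNgt -has_count; apply/hasPn.
do 2 (rewrite (zero _ (iota 0 c)); last by case=> [|j] _ /=; rewrite ?andbF).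
rewrite !add0n; congr (_ + _).
  rewrite -[in RHS](mkseq_nth item0 (items D)) count_map.
  apply: eq_in_count => i; rewrite mem_iota /= => ilt.
  rewrite -/(hw D i) -/(right D i) -/(fk D i).
  case: ifP => _ /=; by case: fk; case: (right D i == side); rewrite /= ?andbF ?andbT.
rewrite mul2n -addnn -[in RHS](mkseq_nth item0 (items D)) !count_map /forks !count_filter.
congr (_ + _); apply: eq_in_count => i; rewrite mem_iota /= => ilt;
rewrite -/(hw D i) -/(right D i) -/(fk D i);
by case: fk; case: (right D i == side); rewrite /= ?andbF ?andbT.
Qed.

(** The ranks of the inner vertices are distinct and less than [size P], which is the number of
    these vertices, so every position is taken. *)
Lemma cov_points p : p \in P -> exists v : vert cov, ~~ is_end v /\ phi v = (p%:E)%E.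
Proof.
move=> pP; pose s := [seq rank D key v | v <- inner_vs D].
have sE v : v \in inner_vs D = (inner D v) && (v \in vs) by rewrite mem_filter.
have us : uniq s.
  rewrite map_inj_in_uniq ?filter_uniq ?uniq_vs// => x y.
  rewrite !sE => /andP[ix xV] /andP[iy yV].
  by apply: (rank_inj vkey); rewrite inE ?xV ?yV.
have ss : {subset s <= iota 0 (size P)}.
  move=> y /mapP[x]; rewrite sE => /andP[ix xV] ->.
  by rewrite mem_iota /= add0n (rank_max key sizeP xV ix).
have sz : size (iota 0 (size P)) <= size s by rewrite size_iota size_map sizeP.
have [_ eqs] := uniq_min_size us ss sz.
pose k := index p (sort <=%R P).
have kP : k < size P by rewrite -(size_sort <=%R) index_mem mem_sort.
have : k \in s by rewrite eqs mem_iota /= add0n.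
move=> /mapP[x]; rewrite sE => /andP[ix xV] kE.
exists (vi D x); split.
  by rewrite (is_endE wfD) (viK wfD xV) ix.
rewrite /= (viK wfD xV) /rphi ix /posn -kE nth_index ?mem_sort//.
Qed.

Lemma cov_tropical g lam mu :
  g = c + lp ->
  perm_eq (string_ends D false ++ tail_ends false (items D)) lam ->
  perm_eq (string_ends D true ++ tail_ends true (items D)) mu ->
  is_tropical_cover g lam mu P cov.
Proof.
move=> gE pl pm.
have lwl : perm_eq (leaf_weights cov -oo%E) lam.
  exact: perm_trans (cov_leaf_weights false) pl.
split.
- by split; [exact: cov_curve vkey sizeP uniqP|rewrite cov_genus].
- by split; [exact: cov_pl|exact: cov_preimage].
- split; first exact: cov_morphism vkey sizeP uniqP.
  by rewrite /degree (perm_big _ lwl) /= sumnE.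
- by split=> //; exact: perm_trans (cov_leaf_weights true) pm.
- exact: cov_points.
Qed.
End CoverType.

(** * Zigzag structure *)

Section CoverZigzag.
Variables (R : realType) (P : seq R) (D : zdata) (key : rvert -> nat).
Local Notation n := (ntail D).
Local Notation lp := (looped D).
Local Notation c := (ncyc D).
Local Notation i0 := (cyci D).
Local Notation vs := (vs D).
Local Notation es := (es D).
Local Notation rbd := (rbd D).
Local Notation cov := (cov P D key).
Local Notation rphi := (rphi P D key).
Hypothesis wfD : wf_data D.

Definition strv (v : rvert) : bool :=
  match v with VS _ | VX _ => true | _ => false end.
Definition stre (e : redge) : bool := if e is ES _ then true else false.
Definition tail_of (e : redge) : nat :=
  match e with ES _ => 0 | EC _ | EO _ _ => i0 | ET i | EF i _ => i end.
Definition tail_ofv (v : rvert) : nat :=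
  match v with VC _ _ => i0 | VT i | VF i _ => i | _ => 0 end.

Let SV : {set vert cov} := [set v | strv (rv v)].
Let SE : {set edge cov} := [set e | stre (re e)].

Lemma incidentE (e : edge cov) (v : vert cov) :
  incident e v = (rbd (re e) false == rv v) || (rbd (re e) true == rv v).
Proof.
rewrite -!(bd_eq wfD); apply/existsP/orP => [[[] ->]|[]]; auto.
- by exists false.
- by exists true.
Qed.

Lemma joinsP (e : edge cov) (u v : vert cov) :
  joins e u v ->
  (rbd (re e) false = rv u /\ rbd (re e) true = rv v) \/
  (rbd (re e) true = rv u /\ rbd (re e) false = rv v).
Proof.
by move=> /existsP[[]] /andP[]; rewrite !(bd_eq wfD) => /eqP-> /eqP->; auto.
Qed.

Lemma string_valence (v : vert cov) : v \in SV ->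
  valence_in [pred e | e \in SE] v = if is_end v then 1 else 2.
Proof.
rewrite inE => sv; rewrite (is_endE wfD).
have -> : valence_in [pred e | e \in SE] v =
    \sum_(h <- halves D (rv v)) (stre h.1 : nat).
  rewrite -(half_sum wfD (fun e b => stre e : nat)) /valence_in -sum1_card.
  rewrite big_mkcond [RHS]big_mkcond; apply: eq_bigr => h _.
  by rewrite !inE andbC; case: (_ == _); case: (stre _).
case: (rv v) sv => //= [i|b] _; rewrite !big_cons big_nil//.
by rewrite /= /tl1; case: ifP.
Qed.

Let conn (u v : rvert) :=
  connect (adj [pred e | e \in SE]) (vi D u : vert cov) (vi D v).
Let conn_sym : connect_sym (adj (G := cov) [pred e | e \in SE]).
Proof.
apply: sym_connect_sym => u v.
apply/existsP/existsP => -[e /andP[eS /existsP[b /andP[h h']]]];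
  exists e; apply/andP; split => //; apply/existsP; exists (~~ b); by rewrite negbK h h'.
Qed.
Let conn_edge j : j < n + ~~ lp -> conn (rbd (ES j) false) (rbd (ES j) true).
Proof.
move=> jn; have /re_onto[i iE] : ES j \in es by rewrite mem_es.
apply: connect1; apply/existsP; exists i; rewrite !inE iE /=.
by apply/existsP; exists false; rewrite !bdE iE !eqxx.
Qed.

Lemma string_connected :
  {in SV &, forall u v, connect (adj [pred e | e \in SE]) u v}.
Proof.
have n0 := wf_n wfD.
have cS j : j < n -> conn (VS 0) (VS j).
  elim: j => [|j IH] jn; first exact: connect0.
  apply: connect_trans (IH (ltnW jn)) _.
  by have := @conn_edge j.+1; rewrite /= ifF; [apply; lia|lia].
have c0 v : v \in vs -> strv v -> conn (VS 0) v.
  rewrite mem_vs; case: v => [i|t b|i|b|i b] //=; first by move=> /cS.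
  move=> nlp _; case: b.
    have := @conn_edge n; rewrite /= nlp eqxx addn1 => /(_ (leqnn _)).
    by apply: connect_trans; case: (n) n0 cS => //= m _; apply.
  rewrite /conn conn_sym; have := @conn_edge 0; rewrite /= (negPf nlp).
  by rewrite ifF//; [apply; lia|lia].
move=> u v; rewrite !inE => su sv; rewrite -(rvK wfD u) -(rvK wfD v).
apply: connect_trans (c0 _ (rv_vs wfD v) sv).
by rewrite conn_sym; exact: c0 (rv_vs wfD u) su.
Qed.

Lemma string_is_string : is_string SV SE.
Proof.
split; [|move=> e b|exact: string_connected|exact: string_valence].
- have /re_onto[i iE] : ES 0 \in es by rewrite mem_es /= ltn_addr// (wf_n wfD).
  by apply/set0Pn; exists i; rewrite inE iE.
- rewrite !inE (rv_bd wfD); case: (re e) => //= j _.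
  by case: b; [case: ifP|case: j => //; case: lp].
Qed.

Lemma string_odd : {in SE, forall e : edge cov, odd (wt e)}.
Proof.
by move=> e; rewrite inE /=; case: (re e) => //= j _; apply: odd_W (wf_base wfD).
Qed.

Let ix (v : rvert) : nat := if v is VS i then i else 0.

(** Two string edges share both end points only on a loop with two vertices, which [wf_loop]
    excludes. Off the string, [EC] and [ET] are even, [EO] joins cycle vertices and [EF] is a
    leaf. *)
Lemma string_no_cycle (e f : edge cov) u w :
  e \in SE -> ~ symmetric_cycle e f u w.
Proof.
rewrite inE => eS [/eqP ef /andP[le lf] /andP[/joinsP je /joinsP jf] we _].
have oe : odd (wt e) by apply: string_odd; rewrite inE.
have jj : (rbd (re e) false = rbd (re f) false /\ rbd (re e) true = rbd (re f) true) \/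
    (rbd (re e) false = rbd (re f) true /\ rbd (re e) true = rbd (re f) false).
  by case: je => -[-> ->]; case: jf => -[-> ->]; auto.
move: le lf {je jf} we oe jj; rewrite !(leafE wfD) !negbK /=.
have := re_es e; have := re_es f; rewrite !mem_es.
have {}ef : re e <> re f by move=> /re_inj.
have n0 := wf_n wfD; have wl := wf_loop wfD.
move: eS ef; case: (re e) => // j _ ef; case: (re f) ef => [k|t|t d|i|i d] /= ef kn jn.
- have {}ef : j <> k by move=> jk; apply: ef; rewrite jk.
  have [lpE|lpE] := boolP lp.
    have [n2 _] := wl lpE; rewrite lpE addn0 in jn kn *.
    rewrite [j == n]ltn_eqF// [k == n]ltn_eqF// => _ _ _ _.
    by case: j k ef jn kn => [|j] [|k] ef jn kn [] [] /(congr1 ix) H1 /(congr1 ix) H2;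
      move: H1 H2; rewrite /=; lia.
  rewrite (negPf lpE) in jn kn *.
  case: j k ef jn kn => [|j] [|k] ef jn kn //=.
  by case: eqP => // _ _; case: eqP => // _ _ _ _ [] [] /(congr1 ix) H1 /(congr1 ix) H2;
      move: H1 H2; rewrite /=; lia.
- by move=> _ _ ->; rewrite oddM.
- by move=> _ _ _ _ [] []; case: (j) => [|?]; case: lp.
- by move=> _ _ ->; rewrite oddM.
- by rewrite andbF.
Qed.

Hypothesis vkey : valid_key D key.
Hypothesis sizeP : size P = size (inner_vs D).
Hypothesis uniqP : uniq P.

(** Two string leaves meet only on a path with a single vertex. Equal weights and [wf_open] then
    make the last weight positive, so the two ends lie over different infinities and the images
    differ. *)
Lemma string_no_fork (e f : edge cov) u :
  e \in SE -> ~ symmetric_fork e f u.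
Proof.
rewrite inE => eS [/eqP ef /andP[le lf] /and3P[nu ie jf] we im].
have oe : odd (wt e) by apply: string_odd; rewrite inE.
have {}ef : re e <> re f by move=> /re_inj.
move: nu ie jf le lf; rewrite (is_endE wfD) negbK !incidentE !(leafE wfD).
have := re_es e; have := re_es f; rewrite !mem_es.
have n0 := wf_n wfD; have wl := wf_loop wfD; have wo := wf_open wfD.
case eE : (re e) eS => [j|//|//|//|//] _; case fE : (re f) => [k|t|t d|i|i d] /= kn jn iu.
- have [lpE|lpE] := boolP lp.
    rewrite lpE addn0 in jn kn *.
    rewrite [j == n]ltn_eqF// [k == n]ltn_eqF//.
    by case: j {eE} jn.
  have [b0 nn] := wo lpE.
  rewrite (negPf lpE) in jn kn *; move=> inj ink lj lk.
  have u0 : (VX false == rv u) || ((if 0 == n then VX true else VS 0) == rv u) ->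
      rv u = VS 0.
    rewrite ltn_eqF//= => /orP[] /eqP E; last by rewrite -E.
    by move: iu; rewrite -E.
  have un : ((if n is j'.+1 then VS j' else VX false) == rv u) ||
      ((if n == n then VX true else VS n) == rv u) -> rv u = VS n.-1.
    rewrite eqxx => /orP[] /eqP E; last by move: iu; rewrite -E.
    by rewrite -E; case: (n) n0.
  have {}lj : (j == 0) || (j == n).
    by case: (j) lj => [|j'] //=; case: (_ == n).
  have {}lk : (k == 0) || (k == n).
    by case: (k) lk => [|j'] //=; case: (_ == n).
  have jk : j <> k by move=> jk; apply: ef; rewrite eE fE jk.
  have n1 : n = 1.
    suff : VS 0 = VS n.-1 by move: n0; clear=> n0 []; lia.
    case/orP: lj => /eqP jE; case/orP: lk => /eqP kE; move: jk inj ink; rewrite jE kE //.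
    + by move=> _ H H'; rewrite -(u0 H) -(un H').
    + by move=> _ H' H; rewrite -(u0 H) -(un H').
  have W1 : `|W D 0| = `|W D 1|.
    move: we; rewrite /= eE fE /=; move: lj lk jk; rewrite n1.
    by move=> /orP[] /eqP-> /orP[] /eqP->.
  have {}nn : (W D n <> - base D)%R by move=> ?; apply: nn.
  have W1b : W D n = base D by move: W1 nn b0; rewrite n1 W0; clear; lia.
  have Wn0 : (0 < W D n)%R by rewrite W1b.
  have ph (x : edge cov) : re x = ES 0 -> edge_image x -oo%E.
    move=> xE; rewrite /edge_image /= !(rv_bd wfD) xE /= (negPf lpE) {1}/rphi/=.
    by rewrite minNye lexx leNye.
  have ph' (x : edge cov) : re x = ES n -> ~ edge_image x -oo%E.
    move=> xE; rewrite /edge_image /= !(rv_bd wfD) xE /= eqxx n1 /= /rphi /=.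
    by rewrite Wn0 miney leeNy_eq => /andP[].
  by case/orP: lj => /eqP jE; case/orP: lk => /eqP kE; rewrite ?jE ?kE in eE fE jk => //;
    [apply: (ph' _ fE); rewrite -im; exact: ph|apply: (ph' _ eE); rewrite im; exact: ph].
- by move: we oe; rewrite /= eE fE /= => ->; rewrite oddM.
- by move=> _ _ _.
- by move: we oe; rewrite /= eE fE /= => ->; rewrite oddM.
- move=> H /orP[] /eqP E; move: iu H; rewrite -E //= => _.
  by case: (j == n); case: (j) => [|?]; case: lp => /orP[] /eqP.
Qed.

(* The components of the complement of the string are the tails. *)
Lemma adj_outside_tail (e f : edge cov) :
  adj_outside SV SE e f -> tail_of (re e) = tail_of (re f).
Proof.
rewrite /adj_outside /= !inE => /and3P[se sf /existsP[v /and3P[sv ie jf]]].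
have h (x : edge cov) : ~~ stre (re x) -> incident x v ->
    tail_of (re x) = tail_ofv (rv v).
  rewrite incidentE; move: sv; rewrite inE.
  case: (re x) => [j|t|t d|i|i d] //= sv _ /orP[] /eqP E; move: sv; rewrite -E//.
  - by case: t {E} => [|t].
  - by case: ifP => // /andP[/eqP->].
by rewrite (h e)// (h f).
Qed.

Lemma adj_outside_share (e f : edge cov) b d :
  ~~ stre (re e) -> ~~ stre (re f) -> rbd (re e) b = rbd (re f) d ->
  ~~ strv (rbd (re e) b) -> connect (adj_outside SV SE) e f.
Proof.
move=> se sf E sv; apply: connect1; rewrite /adj_outside /= !inE se sf /=.
apply/existsP; exists (bd e b); rewrite !inE (rv_bd wfD) sv !incidentE (rv_bd wfD) E.
by rewrite -{1 2}E; case: (b); case: (d); rewrite !eqxx ?orbT.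
Qed.

(** Joining every edge of a tail to its last even edge shows that the tail lies in one component;
    the induction is on the number of cycles still ahead. *)
Lemma connect_terminal (e f : edge cov) :
  ~~ stre (re e) -> re f = ET (tail_of (re e)) ->
  connect (adj_outside SV SE) e f.
Proof.
have cyc m : forall t, t < c -> c - t <= m -> forall x y : edge cov,
    (re x = EC t \/ exists b, re x = EO t b) -> re y = ET i0 ->
    connect (adj_outside SV SE) x y.
  elim: m => [|m IH] t tc tm x y; first by lia.
  have odd_case (z : edge cov) b : re z = EO t b -> re y = ET i0 ->
      connect (adj_outside SV SE) z y.
    move=> zE yE; have [tc'|tc'] := ltnP t.+1 c.
      have /re_onto[w wE] : EC t.+1 \in es by rewrite mem_es.
      apply: connect_trans (IH t.+1 _ _ w y _ yE) => //; [|lia|by left].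
      by apply: (@adj_outside_share _ _ true false); rewrite ?zE ?wE.
    apply: (@adj_outside_share _ _ true false); rewrite ?zE ?yE//=.
    by rewrite eqxx (leq_ltn_trans _ tc)//=; congr VC; lia.
  move=> [xE yE|[b xE]]; last exact: odd_case xE.
  have /re_onto[w wE] : EO t true \in es by rewrite mem_es.
  apply: connect_trans (odd_case _ _ wE yE).
  by apply: (@adj_outside_share _ _ true false); rewrite ?xE ?wE.
have := re_es e; rewrite mem_es.
case eE : (re e) => [j|t|t d|i|i d] //= H _ fE.
- by apply: (cyc _ t H (leqnn _)) => //; left.
- by apply: (cyc _ t H (leqnn _)) => //; right; exists d.
- by rewrite (@re_inj _ e f) ?connect0// eE fE.
- by apply: (@adj_outside_share _ _ false true); rewrite ?eE ?fE.
Qed.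

Let adj_outside_sym : connect_sym (adj_outside SV SE).
Proof.
apply: sym_connect_sym => x y; rewrite /adj_outside /=.
apply/and3P/and3P => -[sx sy /existsP[v /and3P[a b d]]]; split=> //;
 by apply/existsP; exists v; rewrite a b d.
Qed.

Lemma componentE (e : edge cov) : e \notin SE ->
  component SV SE e = [set f | ~~ stre (re f) & tail_of (re f) == tail_of (re e)].
Proof.
rewrite inE => se; apply/setP => f; rewrite !inE; apply/idP/andP => [|[sf /eqP tf]].
- move=> /connectP[p pP ->]; elim: p e se pP => [|x p IH] e se /=.
    by rewrite se eqxx.
  move=> /andP[ex]; have := adj_outside_tail ex; move: ex; rewrite /adj_outside /= !inE.
  by move=> /and3P[_ sx _] ->; exact: IH.
- have tn : tail_of (re e) < n.
    have := re_es e; rewrite mem_es; have := wf_i0 wfD.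
    by case: (re e) se => //= i ? _ _ /andP[].
  have /re_onto[w wE] : ET (tail_of (re e)) \in es by rewrite mem_es.
  apply: connect_trans (connect_terminal se wE) _.
  by rewrite adj_outside_sym; apply: connect_terminal; rewrite ?tf.
Qed.

Let joins_vi (e : edge cov) : joins e (vi D (rbd (re e) false)) (vi D (rbd (re e) true)).
Proof. by apply/existsP; exists false; rewrite !bdE !eqxx. Qed.

Let incident_vi (e : edge cov) b : incident e (vi D (rbd (re e) b)).
Proof. by apply/existsP; exists b; rewrite bdE. Qed.

Let edge_image_eq (e f : edge cov) :
  (forall b, rphi (rbd (re e) b) = rphi (rbd (re f) b)) -> edge_image e = edge_image f.
Proof.
by move=> H; rewrite /edge_image /= !(rv_bd wfD) !H.
Qed.

Let terminal i : {set edge cov} :=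
  [set f | ~~ stre (re f) & (re f == ET i) || (re f == EF i false) || (re f == EF i true)].

Let terminal_fork i (e a b : edge cov) : re e = ET i -> re a = EF i false ->
  re b = EF i true -> terminal i = [set e; a; b].
Proof.
move=> eE aE bE; apply/setP => f; rewrite !inE -!(inj_eq (@re_inj D)) eE aE bE.
by case: (re f).
Qed.

Lemma chain_terminal i : i < n -> fk D i || odd (hw D i) ->
  chain (C := cov) (vi D (rbd (ET i) false)) (terminal i).
Proof.
move=> ilt H; have /re_onto[e eE] : ET i \in es by rewrite mem_es.
have Vi : VT i \in vs by rewrite mem_vs.
have [fi|fi] := boolP (fk D i).
  have /re_onto[a aE] : EF i false \in es by rewrite mem_es /= ilt.
  have /re_onto[b bE] : EF i true \in es by rewrite mem_es /= ilt.
  rewrite (terminal_fork eE aE bE).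
  apply: (@chain_fork R cov _ (vi D (VT i)) e a b).
  - by rewrite /= eE /= oddM.
  - by have := joins_vi e; rewrite eE.
  - split.
    + by apply/eqP => /(congr1 (@re D)); rewrite aE bE.
    + by rewrite !(leafE wfD) aE bE /= !andbF.
    + rewrite (is_endE wfD) (viK wfD Vi) /= fi /=.
      by have := incident_vi a false; have := incident_vi b false; rewrite aE bE /= => -> ->.
    + by rewrite /= aE bE.
    + by apply: edge_image_eq; rewrite aE bE; case.
  - by rewrite /= aE /=; exact: (wf_fk wfD).
have -> : terminal i = [set e].
  apply/setP => f; rewrite !inE -!(inj_eq (@re_inj D)) eE.
  have := re_es f; rewrite mem_es; case: (re f) => [j|t|t d|j|j d] //=; rewrite ?orbF//.
  by move=> /andP[_ fj]; rewrite ?orbF; apply/negP => /orP[] /eqP[] jE; move: fi; rewrite -jE fj.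
apply: (@chain_leaf R cov _ (vi D (VT i)) e (hw D i)).
- by have := joins_vi e; rewrite eE.
- by rewrite (is_endE wfD) (viK wfD Vi).
- by move: H; rewrite (negPf fi).
- by rewrite /= eE.
Qed.

Let stage (e : redge) := match e with EC t | EO t _ => t | _ => c end.
Let stages t : {set edge cov} :=
  [set f | [&& ~~ stre (re f), tail_of (re f) == i0 & t <= stage (re f)]].

(** [chain] is built from its far end: [stages t] is the part of the tail from the [t]-th cycle on,
    and [t = c] leaves the last even edge with its possible fork. *)
Lemma chain_stages m t : c - t <= m -> t <= c -> 0 < c ->
  chain (C := cov) (vi D (if t is t'.+1 then VC t' true else VS i0)) (stages t).
Proof.
elim: m t => [|m IH] t tm tc c0.
  have -> : t = c by lia.
  have -> : stages c = terminal i0.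
    apply/setP => f; rewrite !inE; have := re_es f; rewrite mem_es.
    case: (re f) => [j|s|s d|j|j d] //=; rewrite ?eqxx ?leqnn ?andbT ?orbF//.
    - by move=> sc; rewrite leqNgt sc; apply/esym/eqP.
    - by move=> sc; rewrite leqNgt sc; apply/esym/eqP.
    - by move=> _; apply/eqP/eqP => [->|[]].
    - by move=> _; apply/eqP/orP => [->|[]/eqP[]//]; case: d; rewrite eqxx; auto.
  have := @chain_terminal i0 (wf_i0 wfD); rewrite (wf_cyc wfD c0) orbT => /(_ isT).
  by rewrite /= eqxx c0 /=; case: (c) c0.
have [tE|tne] := eqVneq t c; first by apply: IH; lia.
have tc' : t < c by lia.
have /re_onto[e eE] : EC t \in es by rewrite mem_es.
have /re_onto[a aE] : EO t false \in es by rewrite mem_es.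
have /re_onto[b bE] : EO t true \in es by rewrite mem_es.
have Vf : VC t false \in vs by rewrite mem_vs.
have Vt : VC t true \in vs by rewrite mem_vs.
have -> : stages t = [set e; a; b] :|: stages t.+1.
  apply/setP => f; rewrite !inE -!(inj_eq (@re_inj D)) eE aE bE.
  have := re_es f; rewrite mem_es.
  case: (re f) => [j|s|s d|j|j d] //= H; rewrite ?orbF.
  - by rewrite eqxx /= leq_eqVlt; congr (_ || _); apply/eqP/eqP => [->//|[]].
  - rewrite eqxx /= leq_eqVlt; congr (_ || _); apply/eqP/orP => [->|[]/eqP[]//].
    by case: d {H}; rewrite eqxx; auto.
  - by rewrite tc' ltnW.
  - by rewrite tc' ltnW.
apply: (@chain_cycle R cov _ (vi D (VC t false)) (vi D (VC t true)) e a b).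
- by rewrite /= eE /= oddM.
- by have := joins_vi e; rewrite eE.
- split.
  + by apply/eqP => /(congr1 (@re D)); rewrite aE bE.
  + by rewrite !(leafE wfD) aE bE.
  + by have := joins_vi a; have := joins_vi b; rewrite aE bE /= => -> ->.
  + by rewrite /= aE bE.
  + by apply: edge_image_eq; rewrite aE bE; case.
- by rewrite /= aE /= (wf_cyc wfD c0).
- by apply: (IH t.+1) => //; lia.
- rewrite fintype.disjoint_subset; apply/fintype.subsetP => f.
  rewrite !inE -!(inj_eq (@re_inj D)) eE aE bE.
  by move=> /orP[/orP[]|] /eqP-> /=; rewrite eqxx ltnn.
Qed.

Theorem cov_zigzag : is_zigzag cov.
Proof.
exists SV, SE; split.
- by left; split; [exact: string_is_string|exact: string_odd].
- move=> e f eS _; split=> [[u [w]]|[u]]; first exact: string_no_cycle.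
  exact: string_no_fork.
- move=> e eS; have tn : tail_of (re e) < n.
    have := re_es e; rewrite mem_es; have := wf_i0 wfD; move: eS; rewrite inE.
    by case: (re e) => //= i ? _ _ /andP[].
  have VSi i : i < n -> VS i \in vs by rewrite mem_vs.
  rewrite componentE//; set i := tail_of (re e) in tn *.
  exists (vi D (VS i)); first by rewrite inE (viK wfD (VSi _ tn)).
  have [/andP[/eqP ii c0]|ni] := boolP ((i == i0) && (0 < c)).
    left; have := @chain_stages c 0 (leq_subr _ _) (leq0n _) c0.
    rewrite ii; congr chain; apply/setP => f; rewrite !inE leq0n andbT//.
  have -> : [set f : edge cov | ~~ stre (re f) & tail_of (re f) == i] = terminal i.
    apply/setP => f; rewrite !inE; have := re_es f; rewrite mem_es.
    case: (re f) => [j|s|s d|j|j d] //=; rewrite ?orbF//.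
    - move=> sc; apply/eqP => ii; move: ni; rewrite -ii eqxx; lia.
    - move=> sc; apply/eqP => ii; move: ni; rewrite -ii eqxx; lia.
    - by move=> _; apply/eqP/eqP => [->//|[]].
    - by move=> _; apply/eqP/orP => [->|[]/eqP[]//]; case: d; rewrite eqxx; auto.
  have bdE : rbd (ET i) false = VS i by rewrite /= (negPf ni).
  have [H|H] := boolP (fk D i || odd (hw D i)).
    by left; have := chain_terminal tn H; rewrite bdE.
  (* What remains is a single leaf whose weight is divisible by four. *)
  right; have /re_onto[a aE] : ET i \in es by rewrite mem_es.
  move: H; rewrite negb_or => /andP[nf no]; exists a; split.
  + by rewrite (leafE wfD) aE /= (negPf nf) andbF.
  + by have := incident_vi a false; rewrite aE bdE.
  + by rewrite /= aE /= oddM.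
  + apply/setP => f; rewrite !inE -!(inj_eq (@re_inj D)) aE.
    have := re_es f; rewrite mem_es; case: (re f) => [j|t|t d|j|j d] //=; rewrite ?orbF//.
    by move=> /andP[_ fj]; rewrite ?orbF; apply/negP => /orP[] /eqP[] jE; move: nf; rewrite -jE fj.
Qed.
End CoverZigzag.

(** * Covers determined by one string edge *)

Section EdgeMatch.
Variables (R : realType) (P : seq R) (D : zdata) (key : rvert -> nat).
Local Notation n := (ntail D).
Local Notation lp := (looped D).
Local Notation vs := (vs D).
Local Notation es := (es D).
Local Notation rbd := (rbd D).
Local Notation cov := (cov P D key).
Local Notation rphi := (rphi P D key).
Hypothesis wfD : wf_data D.

Definition raw_ends (p q : \bar R) (e : redge) : bool :=
  [exists b, (rphi (rbd e b) == p) && (rphi (rbd e (~~ b)) == q)].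

Lemma edge_countE p q w :
  edge_count cov p q w = count (fun e => (rwt D e == w) && raw_ends p q e) es.
Proof.
rewrite /edge_count -size_filter cardE.
rewrite -(size_map (@re D)); apply: perm_size; apply: uniq_perm.
- by rewrite map_inj_uniq ?enum_uniq//; exact: re_inj.
- by rewrite filter_uniq ?uniq_es.
move=> e; rewrite mem_filter; apply/mapP/andP => [[i]|[H eE]].
  rewrite mem_enum inE => /andP[/= wi /existsP[b]] Hb ->; split; last exact: re_es.
  by rewrite wi; apply/existsP; exists b; rewrite -!(rv_bd wfD).
have [i iE] := re_onto eE; exists i => //; rewrite mem_enum inE /= iE.
move: H => /andP[-> /existsP[b Hb]]; apply/existsP; exists b.
by rewrite /= !(rv_bd wfD) iE.
Qed.

Hypothesis vkey : valid_key D key.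
Hypothesis sizeP : size P = size (inner_vs D).
Hypothesis uniqP : uniq P.

Lemma odd_neq_double k m : odd k -> k <> 2 * m.
Proof. by move=> ok E; move: ok; rewrite E oddM. Qed.

Lemma string_half i e b : i < n -> odd (rwt D e) -> e \in es ->
  rbd e b = VS i -> (e = ES i /\ b = true) \/ (e = ES (sout D i) /\ b = false).
Proof.
move=> ilt oe eE be; have Vi : VS i \in vs by rewrite mem_vs.
have := mem_halves wfD (e, b) Vi; rewrite eE be eqxx /= !inE.
move=> /or3P[]/eqP[E1 E2]; auto.
by move: oe; rewrite E1 /tl1; case: ifP => _ /=; rewrite oddM.
Qed.

Lemma string_edge_in j : ES j \in es -> exists i b, i < n /\ rbd (ES j) b = VS i.
Proof.
have n0 := wf_n wfD; rewrite mem_es /= => jn.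
have [jn'|jn'] := ltnP j n; first by exists j, true; rewrite /= ltn_eqF.
exists n.-1, false; split; first by lia.
have -> : j = n by case: lp jn => /=; lia.
by rewrite /=; case: (n) n0.
Qed.

(** The excluded degenerate strings are those where two consecutive string edges of equal weight
    could also have their far ends over the same point, and so could be exchanged. *)
Lemma string_ends_neq i : i < n -> rwt D (ES i) = rwt D (ES (sout D i)) ->
  rphi (rbd (ES i) false) <> rphi (rbd (ES (sout D i)) true).
Proof.
move=> ilt wE rE; have V1 := rbd_vs wfD false (ES_es ilt).
have V2 := rbd_vs wfD true (sout_es ilt).
have n0 := wf_n wfD; have wl := wf_loop wfD; have wo := wf_open wfD.
rewrite /= in V1 V2 rE.
have inj u v : u \in vs -> v \in vs -> inner D u -> rphi u = rphi v -> u = v.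
  exact: (rphi_inj vkey sizeP uniqP).
have [lpE|lpE] := boolP lp.
  have [n2 _] := wl lpE; move: rE V1 V2; rewrite /sout lpE /=; case: (eqVneq i.+1 n) => [iE|iE].
    rewrite [0 == n]ltn_eqF//; case: i ilt {wE} iE => [|i] ilt iE; first by lia.
    by move=> E V1' V2'; case: (inj _ _ V1' V2' isT E); lia.
  rewrite (negPf iE).
  case: i ilt {wE} iE => [|i] ilt iE;
  by move=> E V1' V2'; case: (inj _ _ V1' V2' isT E); lia.
have [b0 nn] := wo lpE; move: rE V1 V2; rewrite /sout (negPf lpE) /=.
case: i ilt wE => [|i] ilt wE.
  case: (eqVneq 1 n) => [n1|n1].
    rewrite /rphi /= -n1; case: ifP => // Wn _ _ _.
    apply: nn; split=> //; move: wE b0 Wn.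
    by rewrite /= /sout (negPf lpE) /= W0 -n1; clear; lia.
  by move=> E V1' V2'; case: (inj _ _ V2' V1' isT (esym E)).
by move=> E V1' V2'; have := inj _ _ V1' V2' isT E; case: ifP => // _ []; lia.
Qed.

(** Positions separate inner vertices, so an edge with the same end values meets [ES j] at a string
    vertex. By parity it is one of the two string edges there, and [string_ends_neq] tells these
    apart. *)
Lemma string_edge_uniq j e :
  ES j \in es -> e \in es -> rwt D e = rwt D (ES j) ->
  (exists s : bool, forall b, rphi (rbd e b) = rphi (rbd (ES j) (s (+) b))) ->
  e = ES j.
Proof.
move=> jE eE we [s sE]; have oj : odd (rwt D (ES j)) := odd_W j (wf_base wfD).
have oe : odd (rwt D e) by rewrite we.
have [i [b [ilt bE]]] := string_edge_in jE.
have Vi : VS i \in vs by rewrite mem_vs.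
have ebE : rbd e (s (+) b) = VS i.
  apply/esym/(rphi_inj vkey sizeP uniqP) => //; first exact: rbd_vs.
  by rewrite sE addbA addbb addFb bE.
have ee := string_half ilt oe eE ebE; have jj := string_half ilt oj jE bE.
have {}sE d : rphi (rbd e d) = rphi (rbd (ES j) (s (+) d)) by exact: sE.
case: ee jj => [] [eI sb] [] [jj' bb]; rewrite ?eI ?jj'//; exfalso.
- apply: (string_ends_neq ilt); first by rewrite -eI -jj'.
  rewrite -{1}eI -jj' (sE false); congr (rphi (rbd _ _)).
  by move: sb; rewrite bb; case: s {sE ebE}.
- apply: (string_ends_neq ilt); first by rewrite -eI -jj'.
  rewrite -eI -{1}jj' (sE true); congr (rphi (rbd _ _)).
  by move: sb; rewrite bb; case: s {sE ebE}.
Qed.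
End EdgeMatch.

Section EdgeMatch1.
Variables (R : realType) (P : seq R) (D : zdata) (key : rvert -> nat).
Local Notation n := (ntail D).
Local Notation vs := (vs D).
Local Notation es := (es D).
Local Notation rbd := (rbd D).
Local Notation cov := (cov P D key).
Local Notation rphi := (rphi P D key).
Hypothesis wfD : wf_data D.
Hypothesis vkey : valid_key D key.
Hypothesis sizeP : size P = size (inner_vs D).
Hypothesis uniqP : uniq P.

Lemma raw_endsP p q e :
  reflect (exists s : bool, forall b, rphi (rbd e b) = if s (+) b then q else p)
          (raw_ends P D key p q e).
Proof.
apply: (iffP existsP) => [[b /andP[/eqP hp /eqP hq]]|[s H]].
  by exists b => d; case: b hp hq => hp hq; case: d.
by exists s; rewrite !H addbb addbN addbb !eqxx.
Qed.

Lemma edge_count_string j : ES j \in es ->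
  edge_count cov (rphi (rbd (ES j) false)) (rphi (rbd (ES j) true)) (rwt D (ES j)) = 1.
Proof.
move=> jE; rewrite edge_countE// -[RHS](_ : count_mem (ES j) es = 1); last first.
  by rewrite count_uniq_mem ?uniq_es// jE.
apply: eq_in_count => e eE /=; apply/andP/eqP => [[/eqP we /raw_endsP[s sE]]|->].
  apply: (string_edge_uniq wfD vkey sizeP uniqP) => //; exists s => b.
  by rewrite sE; case: (s (+) b).
by rewrite eqxx; split=> //; apply/raw_endsP; exists false => -[].
Qed.

Lemma edge_count_gt0 e s : e \in es ->
  0 < edge_count cov (rphi (rbd e s)) (rphi (rbd e (~~ s))) (rwt D e).
Proof.
move=> eE; rewrite edge_countE// -has_count; apply/hasP; exists e => //.
by rewrite eqxx; apply/existsP; exists s; rewrite !eqxx.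
Qed.

Lemma edge_count_gt0_ex p q w : 0 < edge_count cov p q w ->
  exists2 e, e \in es & rwt D e = w /\
    exists s : bool, forall b, rphi (rbd e b) = if s (+) b then q else p.
Proof.
rewrite edge_countE// -has_count => /hasP[e eE /andP[/eqP we /raw_endsP h]].
by exists e.
Qed.

Lemma count_gt1 (T : eqType) (a : pred T) (s : seq T) x y :
  x \in s -> y \in s -> x != y -> a x -> a y -> 1 < count a s.
Proof.
move=> xs ys xy ax ay; rewrite -size_filter.
have us : uniq [:: x; y] by rewrite /= inE xy.
apply: (uniq_leq_size us) => z; rewrite !inE mem_filter => /orP[]/eqP->.
  by rewrite ax.
by rewrite ay.
Qed.

(** An odd edge off the string belongs to a cycle or a fork, and its twin, with the same weight and
    the same end values, would be counted as well. *)
Lemma edge_count1_string p q w : odd w -> edge_count cov p q w = 1 ->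
  exists2 j, ES j \in es & rwt D (ES j) = w /\
    exists s : bool, forall b, rphi (rbd (ES j) b) = if s (+) b then q else p.
Proof.
move=> ow E1; have [e eE [we [s sE]]] : exists2 e, e \in es & rwt D e = w /\
    exists s : bool, forall b, rphi (rbd e b) = if s (+) b then q else p.
  by apply: edge_count_gt0_ex; rewrite E1.
have two (f : redge) : f \in es -> f != e -> rwt D f = rwt D e ->
    (forall b, rphi (rbd f b) = rphi (rbd e b)) -> False.
  move=> fE fe wf fr; have := count_gt1 (a :=
    fun e => (rwt D e == w) && raw_ends P D key p q e) fE eE fe.
  rewrite -edge_countE// E1 wf we eqxx /=.
  suff rE (x : redge) : (forall b, rphi (rbd x b) = rphi (rbd e b)) -> raw_ends P D key p q x.
    by rewrite !rE// => /(_ isT isT).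
  by move=> xe; apply/raw_endsP; exists s => b; rewrite xe.
case: e eE we sE two => [j|t|t d|i|i d] eE we sE two.
- by exists j => //; split=> //; exists s.
- by move: ow; rewrite -we /= oddM.
- case: (two (EO t (~~ d))) => //.
  + by rewrite mem_es; move: eE; rewrite mem_es.
  + by apply/eqP => -[]; case: (d).
- by move: ow; rewrite -we /= oddM.
- case: (two (EF i (~~ d))) => //.
  + by rewrite mem_es; move: eE; rewrite mem_es.
  + by apply/eqP => -[]; case: (d).
  + by case.
Qed.
End EdgeMatch1.

Section EdgeMatch2.
Variables (R : realType) (P : seq R) (D D' : zdata) (key key' : rvert -> nat).
Hypotheses (wfD : wf_data D) (wfD' : wf_data D').
Hypotheses (vkey : valid_key D key) (sizeP : size P = size (inner_vs D)).
Hypothesis uniqP : uniq P.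
Hypothesis same : edge_count (cov P D key) = edge_count (cov P D' key').

Lemma string_edge_match j : ES j \in es D ->
  exists2 k, ES k \in es D' & rwt D' (ES k) = rwt D (ES j) /\
    exists s : bool, forall b,
      rphi P D' key' (rbd D' (ES k) b) = rphi P D key (rbd D (ES j) (s (+) b)).
Proof.
move=> jE; have := edge_count_string wfD vkey sizeP uniqP jE; rewrite same.
move=> /(edge_count1_string wfD')[]; first exact: odd_W j (wf_base wfD).
move=> k kE [wE [s sE]]; exists k => //; split=> //; exists s => b.
by rewrite sE; case: (s (+) b).
Qed.

Lemma edge_match e : e \in es D ->
  exists2 f, f \in es D' & rwt D' f = rwt D e /\
    exists s : bool, forall b,
      rphi P D' key' (rbd D' f b) = rphi P D key (rbd D e (s (+) b)).
Proof.
move=> eE; have := edge_count_gt0 P key wfD false eE; rewrite same.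
move=> /(edge_count_gt0_ex wfD')[f fE [wE [s sE]]]; exists f => //; split=> //.
by exists s => b; rewrite sE; case: (s (+) b).
Qed.
End EdgeMatch2.

(** * Propagation of an agreement along the string and the tails *)

Section Determination.
Variables (R : realType) (P : seq R) (D : zdata) (key key' : rvert -> nat).
Local Notation n := (ntail D).
Local Notation lp := (looped D).
Local Notation c := (ncyc D).
Local Notation i0 := (cyci D).
Local Notation vs := (vs D).
Local Notation es := (es D).
Local Notation rbd := (rbd D).
Local Notation x := (rphi P D key).
Local Notation y := (rphi P D key').
Hypothesis wfD : wf_data D.
Hypotheses (vkey : valid_key D key) (vkey' : valid_key D key').
Hypothesis sizeP : size P = size (inner_vs D).
Hypothesis uniqP : uniq P.
Hypothesis same : edge_count (cov P D key) = edge_count (cov P D key').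

Definition agree (e : redge) : Prop := forall b, x (rbd e b) = y (rbd e b).

Let y_inj u v : u \in vs -> v \in vs -> inner D u -> y u = y v -> u = v.
Proof. exact: (rphi_inj vkey' sizeP uniqP). Qed.

(** In the other cover the edge leaving [VS i] corresponds to one of the two string edges at [VS i].
    If it were the arriving one, the weights would be equal and the far ends would coincide; each
    alternative in the hypothesis forbids this. *)
Lemma agree_next i : i < n -> x (VS i) = y (VS i) ->
  agree (ES i) \/
    x (rbd (ES (sout D i)) true) <> y (rbd (ES i) false) ->
  agree (ES (sout D i)).
Proof.
move=> ilt xy H; have kE := sout_es ilt; have iE := ES_es ilt.
have Vi : VS i \in vs by rewrite mem_vs.
have dE : rbd (ES (sout D i)) false = VS i.
  have := mem_halves wfD (ES (sout D i), false) Vi.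
  by rewrite /= !inE eqxx orbT => /esym/andP[_ /eqP].
have [m mE [wm [s sE]]] := string_edge_match wfD wfD vkey sizeP uniqP same kE.
have mi : rbd (ES m) s = VS i.
  apply/esym/y_inj => //; first exact: rbd_vs.
  by rewrite sE addbb dE.
have [[[mi'] st]|[[mk] sf]] := string_half (e := ES m) wfD ilt (odd_W m (wf_base wfD)) mE mi.
  rewrite mi' in wm sE; rewrite st in sE.
  case: H => [H|]; last by rewrite sE.
  case: (string_ends_neq wfD vkey sizeP uniqP ilt); first by rewrite wm.
  by rewrite H sE.
by move=> b; rewrite -(addFb b) -sf -sE mk sf.
Qed.

Lemma agree_prev i : i < n -> x (VS i) = y (VS i) ->
  agree (ES (sout D i)) -> agree (ES i).
Proof.
move=> ilt xy H; have kE := sout_es ilt; have iE := ES_es ilt.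
have Vi : VS i \in vs by rewrite mem_vs.
have dE : rbd (ES i) true = VS i by rewrite /= ltn_eqF.
have [m mE [wm [s sE]]] := string_edge_match wfD wfD vkey sizeP uniqP same iE.
have mi : rbd (ES m) (~~ s) = VS i.
  apply/esym/y_inj => //; first exact: rbd_vs.
  by rewrite sE addbN addbb dE.
have [[[mi'] st]|[[mk] sf]] := string_half (e := ES m) wfD ilt (odd_W m (wf_base wfD)) mE mi.
  by rewrite mi' in sE; case: s st sE {mi} => // _ sE b; rewrite sE.
rewrite mk in wm sE; have {}sf : s = true by case: (s) sf.
rewrite sf in sE.
case: (string_ends_neq wfD vkey sizeP uniqP ilt); first by rewrite -wm.
by rewrite H sE.
Qed.

(** At a nonbend one string edge goes up and the other down, so they cannot be exchanged. *)
Lemma agree_nonbend i : i < n -> x (VS i) = y (VS i) ->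
  (0 < W D i)%R = (0 < W D (sout D i))%R -> agree (ES (sout D i)).
Proof.
move=> ilt xy H; apply: agree_next => //; right => E.
have Vi : VS i \in vs by rewrite mem_vs.
have dE : rbd (ES (sout D i)) false = VS i.
  have := mem_halves wfD (ES (sout D i), false) Vi.
  by rewrite /= !inE eqxx orbT => /esym/andP[_ /eqP].
have eE : rbd (ES i) true = VS i by rewrite /= ltn_eqF.
have := rphi_dir wfD vkey sizeP uniqP (sout_es ilt).
have := rphi_dir wfD vkey' sizeP uniqP (ES_es ilt).
rewrite /rdir H E dE eE -xy; case: ifP => _ /lt_trans h /h;
by rewrite ltxx.
Qed.

(** Going back to [ES 0] first and then forwards never crosses the cut of a loop. *)
Lemma string_agree j0 j : ES j0 \in es -> ES j \in es -> agree (ES j0) -> agree (ES j).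
Proof.
have n0 := wf_n wfD.
have soutE i : i.+1 < n + ~~ lp -> sout D i = i.+1.
  by rewrite /sout; case: lp => //=; case: eqP => //; lia.
have xyi i : i < n -> agree (ES i) -> x (VS i) = y (VS i).
  by move=> ilt /(_ true); rewrite /= ltn_eqF.
have xyo i : i.+1 < n + ~~ lp -> agree (ES i.+1) -> x (VS i) = y (VS i).
  by move=> ilt /(_ false).
rewrite !mem_es /= => j0n jn A0.
have {j0 j0n A0} A : agree (ES 0).
  elim: j0 j0n A0 => [//|j0 IH] j0n A0; apply: IH; first by lia.
  have jl : j0 < n by case: lp j0n => /=; lia.
  by apply: agree_prev; rewrite ?soutE//; exact: xyo.
elim: j jn => [//|j IH] jn; have {}IH := IH (ltnW jn).
have jl : j < n by case: lp jn => /=; lia.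
by have := agree_next jl (xyi _ jl IH); rewrite soutE//; apply; left.
Qed.

(** The counterpart of [e] is a half-edge at [u] of the same weight. It need not be unique: it
    suffices that all candidates lead to the same place, as the two edges of a cycle do. *)
Lemma tail_step e f s d u :
  e \in es -> rbd e s = u -> inner D u -> x u = y u ->
  (forall h, h \in halves D u -> rwt D h.1 = rwt D e ->
     y (rbd h.1 (~~ h.2)) = y (rbd f (~~ d))) ->
  x (rbd e (~~ s)) = y (rbd f (~~ d)).
Proof.
move=> eE su iu xy H; have uV : u \in vs by rewrite -su rbd_vs.
have [m mE [wm [q qE]]] := edge_match wfD wfD same eE.
have mu : rbd m (q (+) s) = u.
  apply/esym/y_inj => //; first exact: rbd_vs.
  by rewrite qE addbA addbb addFb su.
have := H (m, q (+) s); rewrite mem_halves// mE mu eqxx /= => /(_ isT wm) <-.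
by rewrite qE -addbN addbA addbb addFb.
Qed.

(** Tails are followed outwards. At each vertex parity separates the even edges from the odd ones,
    and the two odd edges of a cycle end at the same vertex. *)
Lemma agree_inner j0 : ES j0 \in es -> agree (ES j0) ->
  forall v, v \in vs -> inner D v -> x v = y v.
Proof.
move=> j0E A0; have n0 := wf_n wfD; have i0n := wf_i0 wfD.
have xyS i : i < n -> x (VS i) = y (VS i).
  move=> ilt; have := string_agree j0E (ES_es ilt) A0 true.
  by rewrite /= ltn_eqF.
have tl1E i : i < n -> tl1 D i \in es.
  by rewrite mem_es /tl1; case: ifP => [/andP[_ c0]|_].
have far_tl1 i : i < n -> x (rbd (tl1 D i) true) = y (rbd (tl1 D i) true).
  move=> ilt; apply: (@tail_step _ (tl1 D i) false false (VS i)) => //; first exact: tl1E.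
  - by rewrite /tl1; case: ifP => [/andP[/eqP->]|/= ->].
  - exact: xyS.
  - have even1 : ~~ odd (rwt D (tl1 D i)) by rewrite /tl1; case: ifP => _ /=; rewrite oddM.
    move=> h; rewrite !inE => /or3P[]/eqP-> //= E; move: even1; rewrite -E.
    + by rewrite (odd_W i (wf_base wfD)).
    + by rewrite (odd_W _ (wf_base wfD)).
have xyC t : t < c -> x (VC t false) = y (VC t false) /\ x (VC t true) = y (VC t true).
  elim: t => [|t IH] tc.
    have xf : x (VC 0 false) = y (VC 0 false).
      by have := far_tl1 _ i0n; rewrite /tl1 eqxx tc.
    split=> //; apply: (@tail_step (EO 0 true) (EO 0 true) false false (VC 0 false)) => //.
      by rewrite mem_es.
    move=> h; rewrite !inE => /or3P[]/eqP-> //= /esym/(@odd_neq_double _ _ _)[].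
    exact: wf_cyc wfD tc.
  have tc' := ltnW tc; have [xf xt] := IH tc'.
  have xf' : x (VC t.+1 false) = y (VC t.+1 false).
    apply: (@tail_step (EC t.+1) (EC t.+1) false false (VC t true)) => //; first by rewrite mem_es.
    move=> h; rewrite !inE => /or3P[]/eqP-> //=.
    - by move/(@odd_neq_double _ _ (wf_cyc wfD (leq_ltn_trans (leq0n _) tc))).
    - by move/(@odd_neq_double _ _ (wf_cyc wfD (leq_ltn_trans (leq0n _) tc))).
    - by rewrite /nxt tc.
  split=> //; apply: (@tail_step (EO t.+1 true) (EO t.+1 true) false false (VC t.+1 false)) => //.
    by rewrite mem_es.
  move=> h; rewrite !inE => /or3P[]/eqP-> //= /esym/(@odd_neq_double _ _ _)[].
  exact: wf_cyc wfD (leq_ltn_trans (leq0n _) tc).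
move=> v; rewrite mem_vs; case: v => [i|t b|i|b|i b] //=.
- by move=> /xyS.
- by move=> /xyC[]; case: b.
move=> ilt fi; have [E|E] := boolP ((i == i0) && (0 < c)); last first.
  by have := far_tl1 _ ilt; rewrite /tl1 (negPf E).
have /andP[/eqP ii c0] := E.
have cc : c.-1 < c by lia.
apply: (@tail_step (ET i) (ET i) false false (VC c.-1 true)) => //.
- by rewrite mem_es.
- by rewrite /= E.
- by have [] := xyC _ cc.
- move=> h; rewrite !inE => /or3P[]/eqP-> //=.
  + by rewrite ii; move/(@odd_neq_double _ _ (wf_cyc wfD c0)).
  + by rewrite ii; move/(@odd_neq_double _ _ (wf_cyc wfD c0)).
  + by rewrite /nxt prednK// ltnn ii.
Qed.

Lemma agree_rank j0 : ES j0 \in es -> agree (ES j0) ->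
  forall v, v \in vs -> inner D v -> rank D key v = rank D key' v.
Proof.
move=> j0E A0 v vV iv; have := agree_inner j0E A0 vV iv; rewrite /rphi iv => -[].
by move/eqP; rewrite nth_uniq ?sort_uniq ?size_sort ?rank_max// => /eqP.
Qed.

(** String edges over [-oo] are [ES 0] and, if the last weight is negative, the last edge. The
    second alternative is the reversal of the string. *)
Lemma first_edge : ~~ lp ->
  agree (ES 0) \/ (W D n = (- base D)%R /\ x (VS 0) = y (VS n.-1)).
Proof.
move=> nlp; have n0 := wf_n wfD; have [b0 _] := wf_open wfD nlp.
have E0 : ES 0 \in es by rewrite mem_es /= nlp addn1.
have [m mE [wm [s sE]]] := string_edge_match wfD wfD vkey sizeP uniqP same E0.
have x0 : x (rbd (ES 0) false) = -oo%E by rewrite /= (negPf nlp) /rphi.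
have mE' := mE; rewrite mem_es /= nlp addn1 in mE'.
have ms : y (rbd (ES m) s) = -oo%E by rewrite sE addbb.
case: m mE wm sE mE' ms => [|m] mE wm sE mE' ms.
  left; case: s sE ms => sE ms; last by move=> b; rewrite sE.
  by move: ms; rewrite /= ltn_eqF// /rphi.
right; move: ms; have [mn|mn] := eqVneq m.+1 n; last first.
  by case: s sE => _; rewrite /= ?(negPf mn) /rphi.
case: s sE => sE; last by rewrite /= /rphi.
rewrite /= mn eqxx {1}/rphi /=; case: ifP => // Wn _.
split; last by have := sE false; rewrite /= ltn_eqF//= => <-; rewrite -mn.
by move: wm Wn b0; rewrite /= mn W0; clear; lia.
Qed.
End Determination.

(** * Orders by zones *)

Section Papp.
Variable m : nat.
Implicit Types s t : 'S_m.

(* A permutation of ['I_m] as a function on [nat]. *)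
Definition papp s (k : nat) : nat := if insub k is Some i then s i else k.

Lemma pappE s (i : 'I_m) : papp s i = s i.
Proof. by rewrite /papp valK. Qed.

Lemma papp_lt s k : k < m -> papp s k < m.
Proof. by move=> km; rewrite -[k]/(val (Ordinal km)) pappE. Qed.

Lemma papp_inj s k l : k < m -> l < m -> papp s k = papp s l -> k = l.
Proof.
move=> km lm; rewrite -[k]/(val (Ordinal km)) -[l]/(val (Ordinal lm)) !pappE.
by move=> /val_inj/perm_inj ->.
Qed.

(** The value of a permutation at [i] is the number of arguments with a smaller value. *)
Lemma papp_order s t :
  (forall k l, k < m -> l < m -> (papp s k < papp s l) = (papp t k < papp t l)) ->
  s = t.
Proof.
move=> H; have rk (u : {perm 'I_m}) (i : 'I_m) : #|[set j | u j < u i]| = u i.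
  rewrite [LHS](_ : _ = #|u @^-1: [set x : 'I_m | x < u i]|); last first.
    by apply: eq_card => j; rewrite !inE.
  rewrite on_card_preimset; last by apply: onW_bij; exists (u^-1)%g; [exact: permK|exact: permKV].
  rewrite cardsE -sum1_card -(big_ord_widen _ (fun=> 1)) ?sum1_card ?card_ord//.
  exact: ltnW (ltn_ord _).
apply/permP => i; apply/val_inj; rewrite /= -(rk s) -(rk t).
by apply: eq_card => j; rewrite !inE -!pappE H.
Qed.
End Papp.

Section ZoneKey.
Variables (D : zdata) (lo up : seq nat) (mid : nat -> nat) (M : nat).
Local Notation n := (ntail D).
Local Notation lp := (looped D).
Local Notation c := (ncyc D).
Local Notation i0 := (cyci D).
Local Notation vs := (vs D).
Local Notation es := (es D).
Local Notation rbd := (rbd D).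

Definition fork_side (side : bool) : seq nat :=
  [seq i <- iota 0 n | fk D i & right D i == side].
Local Notation fl := (fork_side false).
Local Notation fr := (fork_side true).

Definition zone_perms : finType :=
  ('S_(size fl) * 'S_(size lo) * 'S_(size up) * 'S_(size fr))%type.

Implicit Types th : zone_perms.
Definition perm_fl th := th.1.1.1.
Definition perm_lo th := th.1.1.2.
Definition perm_up th := th.1.2.
Definition perm_fr th := th.2.

(** From bottom to top: left forks, cycles on a left tail, [lo], the other string vertices, [up],
    cycles on a right tail, right forks. Cycles are numbered away from the string, hence downwards
    on a left tail, which explains [c - 1 - t]. *)
Definition zone_key th (v : rvert) : nat :=
  match v with
  | VT i => if right D i then 6 * M + papp (perm_fr th) (index i fr)
            else papp (perm_fl th) (index i fl)
  | VC t b => if right D i0 then 5 * M + (2 * t + b)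
              else M + (2 * (c - 1 - t) + ~~ b)
  | VS i => if i \in lo then 2 * M + papp (perm_lo th) (index i lo)
            else if i \in up then 4 * M + papp (perm_up th) (index i up)
            else 3 * M + mid i
  | _ => 0
  end.

Hypothesis wfD : wf_data D.
Hypotheses (lo_uniq : uniq lo) (up_uniq : uniq up).
Hypotheses (lo_n : {in lo, forall i, i < n}) (up_n : {in up, forall i, i < n}).
Hypothesis lo_up : {in lo, forall i, i \notin up}.
Hypotheses (nM : n <= M) (cM : 2 * c <= M).
Hypothesis midM : forall i, i < n -> mid i < M.
Hypothesis mid_inj : forall i j, i < n -> j < n -> mid i = mid j -> i = j.

Lemma mem_fork_side side i :
  (i \in fork_side side) = [&& i < n, fk D i & right D i == side].
Proof. by rewrite mem_filter mem_iota /= andbC. Qed.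

Lemma fork_side_uniq side : uniq (fork_side side).
Proof. by rewrite filter_uniq ?iota_uniq. Qed.

Let size_le (s : seq nat) : uniq s -> {in s, forall i, i < n} -> size s <= M.
Proof.
move=> us sn; apply: leq_trans nM; rewrite -(size_iota 0 n).
by apply: uniq_leq_size => // i /sn; rewrite mem_iota.
Qed.
Let lo_M : size lo <= M. Proof. exact: size_le. Qed.
Let up_M : size up <= M. Proof. exact: size_le. Qed.
Let fork_M side : size (fork_side side) <= M.
Proof. by apply: size_le; rewrite ?fork_side_uniq// => i; rewrite mem_fork_side => /andP[]. Qed.

Let in_lt (s : seq nat) i (p : {perm 'I_(size s)}) :
  i \in s -> papp p (index i s) < size s.
Proof. by move=> is_; rewrite papp_lt ?index_mem. Qed.

Let papp_index_inj (s : seq nat) i j (p : {perm 'I_(size s)}) :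
  i \in s -> j \in s -> papp p (index i s) = papp p (index j s) -> i = j.
Proof.
move=> is_ js /papp_inj E; rewrite -(nth_index 0 is_) -(nth_index 0 js).
by rewrite E ?index_mem.
Qed.

(* The zone of a vertex bounds its key between consecutive multiples of [M]. *)
Definition zone (v : rvert) : nat :=
  match v with
  | VT i => if right D i then 6 else 0
  | VC t b => if right D i0 then 5 else 1
  | VS i => if i \in lo then 2 else if i \in up then 4 else 3
  | _ => 0
  end.

Lemma zone_key_zone th v : v \in vs -> inner D v ->
  zone v * M <= zone_key th v < zone v * M + M.
Proof.
rewrite mem_vs; case: v => [i|t b|i|b|i b] //=.
- move=> ilt _; case: ifP => [ilo|_]; last (case: ifP => [iup|_]).
  + by have := in_lt (perm_lo th) ilo; lia.
  + by have := in_lt (perm_up th) iup; lia.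
  + by have := midM ilt; lia.
- by move=> tc _; case: ifP => _; case: b; lia.
- move=> ilt fi; case: ifP => ri.
  + have ifr : i \in fr by rewrite mem_fork_side ilt fi ri.
    by have := in_lt (perm_fr th) ifr; have := fork_M true; lia.
  + have ifl : i \in fl by rewrite mem_fork_side ilt fi ri.
    by have := in_lt (perm_fl th) ifl; have := fork_M false; lia.
Qed.

Lemma zone_key_zone_lt th th' u v : u \in vs -> inner D u -> v \in vs -> inner D v ->
  zone u < zone v -> zone_key th u < zone_key th' v.
Proof.
move=> uV iu vV iv uv; have := zone_key_zone th uV iu; have := zone_key_zone th' vV iv.
have : (zone u).+1 * M <= zone v * M by rewrite leq_mul2r uv orbT.
by rewrite mulSn; lia.
Qed.

Lemma zone_key_inj th : {in [pred v | (v \in vs) && inner D v] &, injective (zone_key th)}.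
Proof.
move=> u v; rewrite !inE => /andP[uV iu] /andP[vV iv] E.
have zE : zone u = zone v.
  case: (ltngtP (zone u) (zone v)) => // /zone_key_zone_lt h.
  - by have := h th th uV iu vV iv; rewrite E ltnn.
  - by have := h th th vV iv uV iu; rewrite E ltnn.
move: uV vV iu iv zE E; rewrite !mem_vs.
case: u => [i|t b|i|b|i b] //; case: v => [j|s d|j|d|j d] //=; 
  try by (do ?case: ifP).
- move=> ilt jlt _ _; case: ifP => [il|_]; last (case: ifP => [iu|_]);
   (case: ifP => [jl|_] //; last (case: ifP => [ju|_] //)) => _ /addnI.
  + by move=> /papp_index_inj -> //.
  + by move=> /papp_index_inj -> //.
  + by move=> /mid_inj -> //.
- move=> tc sc _ _ _; case: ifP => _ E.
  + have [-> ->] : t = s /\ b = d by case: b d E => [] [] /=; lia.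
    by [].
  + have [-> ->] : t = s /\ b = d by case: b d E => [] [] /=; lia.
    by [].
- move=> ilt jlt fi fj; case: ifP => ri; case: ifP => rj // _.
  + by move=> /addnI/papp_index_inj ->//; rewrite mem_fork_side ?ilt ?fi ?ri ?jlt ?fj ?rj.
  + by move=> /papp_index_inj ->//; rewrite mem_fork_side ?ilt ?fi ?ri ?jlt ?fj ?rj.
Qed.

(** All that is left to check for such an order: the zones already make the tails monotone. *)
Definition string_valid th : Prop := forall j i i',
  ES j \in es -> rbd (ES j) false = VS i -> rbd (ES j) true = VS i' ->
  if (0 < W D j)%R then zone_key th (VS i) < zone_key th (VS i')
  else zone_key th (VS i') < zone_key th (VS i).

Lemma zone_key_valid th : string_valid th -> valid_key D (zone_key th).
Proof.
move=> sv; split; first exact: zone_key_inj.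
have zS i : 2 <= zone (VS i) <= 4 by rewrite /=; case: ifP => //; case: ifP.
move=> e eE; have V0 := rbd_vs wfD false eE; have V1 := rbd_vs wfD true eE.
have := eE; rewrite mem_es; case eq_e : e => [j|t|t d|i|i d] // eV.
- move=> iv0 iv1; rewrite -eq_e.
  have [i0' E0] : exists i, rbd e false = VS i.
    by move: iv0; rewrite eq_e /=; case: (j) => [|k]; [case: lp => // _; exists n.-1|exists k].
  have [i1' E1] : exists i, rbd e true = VS i.
    by move: iv1; rewrite eq_e /=; case: ifP => // _ _; exists j.
  rewrite E0 E1; rewrite eq_e in eE E0 E1 *; exact: (sv j).
- move=> iv0 iv1; rewrite eq_e in V0 V1.
  case: t eV V0 V1 iv0 iv1 {eq_e eE} => [|t] tc V0 V1 _ _; last first.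
    by rewrite /=; case: (right D i0); rewrite /in_es in tc; lia.
  have := zS i0; rewrite /rdir -/(if right D i0 then zone_key th (VS i0) < zone_key th (VC 0 false)
    else zone_key th (VC 0 false) < zone_key th (VS i0)).
  case ri: (right D i0) => /andP[z2 z4]; apply: zone_key_zone_lt => //.
    by rewrite (leq_ltn_trans z4)//= ri.
  by rewrite (leq_trans _ z2)//= ri.
- by move=> _ _ /=; rewrite /in_es in eV; case: (right D i0); lia.
- move=> iv0 iv1; rewrite eq_e in V0 V1.
  have iT : inner D (VT i) := iv1; have iS : inner D (rbd (ET i) false) := iv0.
  have zr : zone (rbd (ET i) false) = zone (VS i) \/
      zone (rbd (ET i) false) = if right D i then 5 else 1.
    by rewrite [rbd _ _]/=; case: ifP => [/andP[/eqP-> _]|_]; [right|left].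
  have zT : zone (VT i) = if right D i then 6 else 0 by [].
  suff : if right D i then zone_key th (rbd (ET i) false) < zone_key th (VT i)
    else zone_key th (VT i) < zone_key th (rbd (ET i) false) by [].
  have := zS i; case ri: (right D i) zr zT => zr zT /andP[z2 z4];
    apply: zone_key_zone_lt => //; rewrite zT; case: zr => -> //.
  + exact: leq_ltn_trans z4 _.
  + exact: leq_trans _ z2.
Qed.

(* Vertices outside [lo] and [up] keep the same rank when [th] varies. *)
Lemma zone_key_mid_rank th th' i : i < n -> i \notin lo -> i \notin up ->
  rank D (zone_key th) (VS i) = rank D (zone_key th') (VS i).
Proof.
move=> ilt il iu; rewrite /rank; apply: eq_in_count => u uV.
have Vi : VS i \in vs by rewrite mem_vs.
case iu' : (inner D u); rewrite ?andFb// !andTb.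
have zi : zone (VS i) = 3 by rewrite /= (negPf il) (negPf iu).
case: (ltngtP (zone u) (zone (VS i))) => z.
- by rewrite !zone_key_zone_lt.
- have h1 := zone_key_zone_lt th th Vi isT uV iu' z.
  have h2 := zone_key_zone_lt th' th' Vi isT uV iu' z.
  by rewrite (ltnNge (zone_key th u)) (ltnW h1) (ltnNge (zone_key th' u)) (ltnW h2).
- move: z; rewrite zi; case: u uV iu' => [j|t b|j|b|j b] //=; rewrite ?(negPf il) ?(negPf iu);
  by do ?case: ifP.
Qed.

(** Ranks give back the comparison of keys, and within a zone that carries a permutation the keys
    are its values up to a constant. *)
Lemma zone_key_rank_inj th th' :
  (forall v, v \in vs -> inner D v -> rank D (zone_key th) v = rank D (zone_key th') v) ->
  th = th'.
Proof.
move=> H; have ord u v : u \in vs -> inner D u -> v \in vs -> inner D v ->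
    (zone_key th u < zone_key th v) = (zone_key th' u < zone_key th' v).
  move=> uV iu vV iv; rewrite -(rank_ltE (zone_key th) v uV iu).
  by rewrite -(rank_ltE (zone_key th') v uV iu) !H.
have main (s : seq nat) (f : nat -> rvert) (k : nat) (p q : {perm 'I_(size s)}) :
    (forall i, i \in s -> [/\ f i \in vs, inner D (f i),
        zone_key th (f i) = k + papp p (index i s) & zone_key th' (f i) = k + papp q (index i
          s)]) ->
    uniq s -> p = q.
  move=> fs us; apply: papp_order => a b am bm.
  have [Va ia ka ka'] := fs _ (mem_nth 0 am).
  have [Vb ib kb kb'] := fs _ (mem_nth 0 bm).
  have := ord _ _ Va ia Vb ib; rewrite ka kb ka' kb' !ltn_add2l.
  by rewrite !index_uniq.
have e1 : perm_fl th = perm_fl th'.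
  apply: (@main fl VT 0) (fork_side_uniq _) => i; rewrite mem_fork_side => /and3P[ilt fi /eqP ri].
  by rewrite mem_vs /= ilt fi ri !add0n.
have e2 : perm_lo th = perm_lo th'.
  apply: (@main lo VS (2 * M)) lo_uniq => i il.
  by rewrite mem_vs /= (lo_n il) il.
have e3 : perm_up th = perm_up th'.
  apply: (@main up VS (4 * M)) up_uniq => i iu.
  have il : i \notin lo by apply/negP => /lo_up; rewrite iu.
  by rewrite mem_vs /= (up_n iu) iu (negPf il).
have e4 : perm_fr th = perm_fr th'.
  apply: (@main fr VT (6 * M)) (fork_side_uniq _) => i;
    rewrite mem_fork_side => /and3P[ilt fi /eqP ri].
  by rewrite mem_vs /= ilt fi ri.
by move: th th' e1 e2 e3 e4 {H ord main} => [[[a b] d] e] [[[a' b'] d'] e'] /=;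
  rewrite /perm_fl /perm_lo /perm_up /perm_fr /= => -> -> -> ->.
Qed.

Lemma card_zone_perms :
  #|zone_perms| = (size fl)`! * (size lo)`! * (size up)`! * (size fr)`!.
Proof. by rewrite !card_prod !card_Sn. Qed.
End ZoneKey.

(** * Bends *)

Section Bends.
Variable D : zdata.
Local Notation n := (ntail D).
Local Notation lp := (looped D).
Hypothesis obase : odd `|base D|.

Definition maxb i : bool := (0 < W D i)%R && (W D i.+1 < 0)%R.
Definition minb i : bool := (W D i < 0)%R && (0 < W D i.+1)%R.
Definition bend i : bool := maxb i || minb i.
Definition maxs : seq nat := seq.filter maxb (iota 0 n).
Definition mins : seq nat := seq.filter minb (iota 0 n).

Lemma W_neq0 j : W D j != 0%R.
Proof. by apply/eqP => E; have := odd_W j obase; rewrite E. Qed.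

Lemma W_pos j : (0 < W D j)%R = ~~ (W D j < 0)%R.
Proof. by have := W_neq0 j; case: ltgtP. Qed.

Lemma bendE i : bend i = (W D i * W D i.+1 < 0)%R.
Proof.
rewrite /bend /maxb /minb !W_pos; have := W_neq0 i; have := W_neq0 i.+1.
case: (ltP (W D i) 0%R) => hi; case: (ltP (W D i.+1) 0%R) => hj /= *; apply/esym.
- by apply/negbTE; rewrite -leNgt; nia.
- by nia.
- by nia.
- by apply/negbTE; rewrite -leNgt; nia.
Qed.

Lemma nonbend_sign i : ~~ bend i -> (0 < W D i)%R = (0 < W D i.+1)%R.
Proof.
rewrite /bend /maxb /minb !W_pos.
by case: (W D i < 0)%R; case: (W D i.+1 < 0)%R.
Qed.

(** Maxima and minima alternate along the string; the first and the last sign decide which kind is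
    in excess. *)
Lemma max_min_bends m :
  count maxb (iota 0 m) + (0 < W D m)%R = count minb (iota 0 m) + (0 < W D 0)%R.
Proof.
elim: m => [|m IH]; first by [].
rewrite -addn1 iotaD !count_cat /= addn1 !addn0 add0n.
move: IH; rewrite /maxb /minb !W_pos.
by case: (W D m < 0)%R; case: (W D m.+1 < 0)%R => /=; lia.
Qed.

Lemma count_bend : count bend (iota 0 n) = size maxs + size mins.
Proof.
rewrite /maxs /mins !size_filter -count_predUI.
rewrite [count (predI _ _) _](eq_count (a2 := pred0)) ?count_pred0 ?addn0//.
move=> i /=; rewrite /maxb /minb; case: ltgtP; rewrite ?andbF//.
Qed.
End Bends.

Lemma sign_changes_bends (D : zdata) : odd `|base D| ->
  sign_changes (base D :: scanl +%R (base D) (map it_step (items D))) =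
  count (bend D) (iota 0 (ntail D)).
Proof.
case: D => lp s b c i0 /= ob; rewrite /ntail /=.
elim: s b ob => [//|x s IH] b ob.
have ob' : odd `|(b + it_step x)%R| by rewrite odd_it_step.
rewrite (_ : sign_changes _ = (b * (b + it_step x) < 0)%R +
  sign_changes ((b + it_step x)%R :: scanl +%R (b + it_step x)%R (map it_step s)))//.
have -> : iota 0 (size (x :: s)) = 0 :: [seq i.+1 | i <- iota 0 (size s)].
  by rewrite /= -(iotaDl 1 0).
rewrite /= count_map (IH _ ob'); congr (_ + _).
  rewrite bendE// W0 /=; congr (nat_of_bool _).
  by rewrite /W /= take0 big_seq1.
apply: eq_count => i; rewrite /= !bendE//.
by rewrite /W /= !big_cons !addrA.
Qed.

Lemma bigmax_seq_attained (T : eqType) (s : seq T) (F : T -> nat) x0 :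
  x0 \in s -> exists2 x, x \in s & \max_(i <- s) F i = F x.
Proof.
elim: s x0 => // y s IH x0 _; rewrite big_cons.
case: s IH => [|z s] IH.
  by exists y; rewrite ?inE// big_nil maxn0.
have [x xs ->] := IH z (mem_head _ _).
case: (leqP (F y) (F x)) => h; first by exists x; rewrite // inE xs orbT.
by exists y; rewrite ?mem_head.
Qed.

Lemma perm_map_lift (T U : eqType) (f : T -> U) (s : seq U) (t : seq T) :
  perm_eq s (map f t) -> exists2 t', perm_eq t' t & s = map f t'.
Proof.
case: t => [|t0 t].
  by move=> /perm_size /size0nil ->; exists [::].
move=> /(perm_iotaP (f t0)) [Is]; rewrite size_map => IsP ->.
exists [seq nth t0 (t0 :: t) i | i <- Is].
  by apply/(perm_iotaP t0); exists Is.
rewrite -map_comp; apply/eq_in_map => i; rewrite (perm_mem IsP) mem_iota /= add0n => ilt.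
by rewrite -[RHS](nth_map _ (f t0)).
Qed.

(** Neither the closing of the string nor the cycles enter [W], so one ordering of the tails serves
    every choice of [lp], [c] and [i0]. *)
Lemma max_sign_changes_attained (k : nat) (alpha beta : seq nat) (T : seq item) :
  odd k ->
  perm_eq (map it_step T) ([seq Posz a | a <- alpha] ++ [seq (- Posz b)%R | b <- beta]) ->
  exists2 s, perm_eq s T &
    forall lp c i0, count (bend (ZData lp s (Posz k) c i0)) (iota 0 (size s)) =
      max_sign_changes k alpha beta.
Proof.
move=> ok; set S := _ ++ _ => TS.
have SS : S \in permutations S by rewrite mem_permutations.
have [s sS E] := bigmax_seq_attained
  (fun s => sign_changes (Posz k :: scanl +%R (Posz k) s)) SS.
move: sS; rewrite mem_permutations => sS.
have sT : perm_eq s (map it_step T) by rewrite (perm_trans sS)// perm_sym.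
have [s' s'T sE] := perm_map_lift sT; exists s' => // lp c i0.
rewrite /max_sign_changes E sE.
by rewrite -(@sign_changes_bends (ZData lp s' (Posz k) c i0)).
Qed.

Lemma max_sign_changes_ge (k : nat) (alpha beta : seq nat) (T s : seq item) lp c i0 :
  odd k ->
  perm_eq (map it_step T) ([seq Posz a | a <- alpha] ++ [seq (- Posz b)%R | b <- beta]) ->
  perm_eq s T ->
  count (bend (ZData lp s (Posz k) c i0)) (iota 0 (size s)) <=
      max_sign_changes k alpha beta.
Proof.
move=> ok TS sT; rewrite -(@sign_changes_bends (ZData lp s (Posz k) c i0))//=.
apply: (@leq_bigmax_seq _ (permutations _) predT
  (fun s => sign_changes (Posz k :: scanl +%R (Posz k) s)) (map it_step s)) => //.
rewrite mem_permutations; apply: perm_trans TS; exact: perm_map.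
Qed.

Section ZoneOrder.
Variable D : zdata.
Local Notation n := (ntail D).
Local Notation lp := (looped D).
Local Notation c := (ncyc D).
Local Notation es := (es D).
Hypothesis wfD : wf_data D.

(* The nonbends of a monotone piece of the string are ordered by this height;
   the bends separate the pieces. *)
Fixpoint height (i : nat) : nat :=
  if i is j.+1 then (if (0 < W D j.+1)%R then (height j).+1 else (height j).-1) else n.
Definition zmid i : nat := height i * n + i.
Definition zM : nat := 2 * n * n + 2 * n + 2 * c.

(** The start at [n] keeps the height positive below [n], so the predecessor in [height] does not
    truncate there. *)
Lemma height_bound i : n <= height i + i /\ height i <= n + i.
Proof.
by elim: i => [|i [IH1 IH2]] /=; [lia | case: ifP => _; lia].
Qed.

Lemma zmid_lt i : i < n -> zmid i < zM.
Proof.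
move=> ilt; rewrite /zmid /zM; have [_ h] := height_bound i.
have : height i * n <= (n + n) * n by rewrite leq_mul2r; lia.
by lia.
Qed.

Lemma zmid_inj i j : i < n -> j < n -> zmid i = zmid j -> i = j.
Proof.
move=> ilt jlt /(congr1 (fun m => m %% n)).
by rewrite /zmid !modnMDl !modn_small.
Qed.

Lemma zmid_lt_height i j : i < n -> height i < height j -> zmid i < zmid j.
Proof.
move=> ilt hij; rewrite /zmid.
have : (height i).+1 * n <= height j * n by rewrite leq_mul2r hij orbT.
by rewrite mulSn; lia.
Qed.

Lemma mem_maxs i : (i \in maxs D) = (i < n) && maxb D i.
Proof. by rewrite mem_filter mem_iota andbC. Qed.
Lemma mem_mins i : (i \in mins D) = (i < n) && minb D i.
Proof. by rewrite mem_filter mem_iota andbC. Qed.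
Lemma maxs_uniq : uniq (maxs D). Proof. by rewrite filter_uniq ?iota_uniq. Qed.
Lemma mins_uniq : uniq (mins D). Proof. by rewrite filter_uniq ?iota_uniq. Qed.
Lemma maxs_n : {in maxs D, forall i, i < n}.
Proof. by move=> i; rewrite mem_maxs => /andP[]. Qed.
Lemma mins_n : {in mins D, forall i, i < n}.
Proof. by move=> i; rewrite mem_mins => /andP[]. Qed.
Lemma mins_maxs : {in mins D, forall i, i \notin maxs D}.
Proof.
move=> i; rewrite mem_mins mem_maxs /minb /maxb => /andP[-> /andP[h _]] /=.
by rewrite ltNge ltW.
Qed.
Lemma zM_n : n <= zM. Proof. by rewrite /zM; lia. Qed.
Lemma zM_c : 2 * c <= zM. Proof. by rewrite /zM; lia. Qed.

Notation zkey := (zone_key (D := D) (lo := mins D) (up := maxs D) zmid zM).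

(** Heights need not close up around a loop. When the loop is cut at a bend, the closing edge never
    joins two nonbends, and edges between different zones are settled by the zones. *)
Lemma zkey_valid th : (lp -> bend D 0) -> valid_key D (zkey th).
Proof.
move=> b0; have n0 := wf_n wfD.
apply: (zone_key_valid wfD mins_uniq maxs_uniq mins_n maxs_n zM_n zM_c zmid_lt zmid_inj).
move=> j i i' jE iE i'E.
have V0 := rbd_vs wfD false jE; have V1 := rbd_vs wfD true jE.
rewrite iE in V0; rewrite i'E in V1.
have zl : zone D (mins D) (maxs D) (VS i) < zone D (mins D) (maxs D) (VS i') ->
    zkey th (VS i) < zkey th (VS i').
  exact: (zone_key_zone_lt mins_uniq maxs_uniq mins_n maxs_n zM_n zM_c zmid_lt).
have zl' : zone D (mins D) (maxs D) (VS i') < zone D (mins D) (maxs D) (VS i) ->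
    zkey th (VS i') < zkey th (VS i).
  exact: (zone_key_zone_lt mins_uniq maxs_uniq mins_n maxs_n zM_n zM_c zmid_lt).
move: V0 V1; rewrite !mem_vs /= => ilt i'lt.
have i'j : i' = j by move: i'E => /=; case: ifP => // _ [].
have WiE : W D i.+1 = W D j.
  move: iE => /=; case: (j) => [|k]; last by case=> ->.
  case lpE : lp => // -[<-]; rewrite prednK//.
  by have [_ ->] := wf_loop wfD lpE; rewrite W0.
have ob := wf_base wfD.
have both : i \notin mins D -> i \notin maxs D -> i' \notin mins D -> i' \notin maxs D ->
    i' = i.+1.
  rewrite !mem_mins !mem_maxs ilt i'lt /= => _ _ m1 m2.
  move: iE i'j => /=; case: (j) => [|k]; last by case=> -> ->.
  case lpE : lp => // _ i'0; have := b0 lpE; rewrite i'0 in m1 m2.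
  by rewrite /bend (negPf m1) (negPf m2).
move: zl zl' both; rewrite /= !mem_mins !mem_maxs ilt i'lt /= i'j.
rewrite /minb /maxb WiE !(W_pos ob).
case: (W D i < 0)%R; case Wj: (W D j < 0)%R => /=; case: (W D j.+1 < 0)%R => //= zl zl' both;
  try (by apply: zl); try (by apply: zl'); rewrite ltn_add2l;
  have jE' : j = i.+1 by apply: both.
- apply: zmid_lt_height; first by rewrite -i'j.
  rewrite jE' /= -jE' (W_pos ob) Wj /=.
  by have [h _] := height_bound i; lia.
- apply: zmid_lt_height; first by [].
  by rewrite jE' /= -jE' (W_pos ob) Wj.
Qed.
End ZoneOrder.

(** * Families of covers of prescribed type *)

Record fits (R : realType) (g : nat) (lam mu : seq nat) (P : seq R) (D : zdata) : Prop :=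
  Fits {
  fit_wf : wf_data D;
  fit_g : g = ncyc D + looped D;
  fit_lam : perm_eq (string_ends D false ++ tail_ends false (items D)) lam;
  fit_mu : perm_eq (string_ends D true ++ tail_ends true (items D)) mu;
  fit_P : size P = size (inner_vs D);
  fit_uniq : uniq P }.

Section FitFamilies.
Variables (R : realType) (g : nat) (lam mu : seq nat) (P : seq R) (D : zdata).
Local Notation n := (ntail D).
Local Notation lp := (looped D).
Local Notation es := (es D).
Hypothesis fitD : fits g lam mu P D.

Let wfD := fit_wf fitD.
Let sizeP := fit_P fitD.
Let uniqP := fit_uniq fitD.

Lemma fits_cover key : valid_key D key -> zigzag_cover g lam mu P (cov P D key).
Proof.
move=> vk; split; last exact: cov_zigzag.
by apply: cov_tropical => //; case: fitD.
Qed.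

Lemma eq_rank_rphi key key' v : rank D key v = rank D key' v ->
  rphi P D key v = rphi P D key' v.
Proof. by move=> E; rewrite /rphi /posn E. Qed.

(** Members with equal edge counts share the place of one string edge; by [agree_rank] they then
    have equal ranks everywhere. *)
Definition anchored (T : Type) (key : T -> rvert -> nat) : Prop := forall t t',
  edge_count (cov P D (key t)) = edge_count (cov P D (key t')) ->
  exists2 j, ES j \in es & agree P D (key t) (key t') (ES j).

Lemma family_at_least (T : finType) (key : T -> rvert -> nat) (Q : pl_map R -> Prop) :
  (forall t, valid_key D (key t)) -> (forall t, Q (cov P D (key t))) ->
  anchored key ->
  (forall t t', (forall v, v \in vs D -> inner D v ->
      rank D (key t) v = rank D (key t') v) -> t = t') ->
  at_least g lam mu P Q #|T|.
Proof.
move=> vk Qk anc inj; exists T, (fun t => cov P D (key t)); split=> //.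
  by move=> t; split; [exact: fits_cover|exact: Qk].
move=> t t' E; apply: inj => v vV iv; have [j jE A] := anc _ _ E.
exact: (agree_rank wfD (vk t) (vk t') sizeP uniqP E jE A).
Qed.

Lemma sign_sout i : W D (sout D i) = W D i.+1.
Proof.
rewrite /sout; case: ifP => // /andP[l /eqP iE].
by have [_ E] := wf_loop wfD l; rewrite W0 iE E.
Qed.

Lemma anchored_nonbend (T : Type) (key : T -> rvert -> nat) i :
  (forall t, valid_key D (key t)) -> i < n -> ~~ bend D i ->
  (forall t t', rank D (key t) (VS i) = rank D (key t') (VS i)) ->
  anchored key.
Proof.
move=> vk ilt nb rk t t' E; exists (sout D i); first exact: sout_es.
apply: (agree_nonbend wfD (vk t) (vk t') sizeP uniqP E ilt).
  exact: eq_rank_rphi.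
by rewrite sign_sout (nonbend_sign (wf_base wfD)).
Qed.

(** By [first_edge] a path admits at most its reversal, which the hypothesis rules out. *)
Lemma anchored_open (T : Type) (key : T -> rvert -> nat) :
  (forall t, valid_key D (key t)) -> ~~ lp ->
  (forall t t', W D n = (- base D)%R ->
    rphi P D (key t) (VS 0) <> rphi P D (key t') (VS n.-1)) ->
  anchored key.
Proof.
move=> vk nlp H t t' E.
have [A|[A1 A2]] := first_edge wfD (vk t) sizeP uniqP E nlp.
  by exists 0 => //; rewrite mem_es /= nlp addn1.
by have := H t t' A1.
Qed.

Notation zkey := (zone_key (D := D) (lo := mins D) (up := maxs D) (zmid D) (zM D)).

Lemma zkey_rank_inj (th th' : zone_perms D (mins D) (maxs D)) :
  (forall v, v \in vs D -> inner D v -> rank D (zkey th) v = rank D (zkey th') v) ->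
  th = th'.
Proof.
apply: zone_key_rank_inj; [exact: mins_uniq|exact: maxs_uniq|exact: mins_n|exact: maxs_n|].
exact: mins_maxs.
Qed.

Lemma zone_at_least (Q : pl_map R -> Prop) :
  (lp -> bend D 0) -> (forall th, Q (cov P D (zkey th))) -> anchored zkey ->
  at_least g lam mu P Q ((size (fork_side D false))`! * (size (mins D))`! *
     (size (maxs D))`! * (size (fork_side D true))`!).
Proof.
move=> b0 Qk anc; rewrite -card_zone_perms; apply: family_at_least anc _ => //.
  by move=> th; exact: zkey_valid.
exact: zkey_rank_inj.
Qed.

(** The nonbend keeps its place under all permutations, so the agreement can start there. *)
Lemma zone_nonbend (Q : pl_map R -> Prop) i :
  (lp -> bend D 0) -> (forall th, Q (cov P D (zkey th))) -> i < n -> ~~ bend D i ->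
  at_least g lam mu P Q ((size (fork_side D false))`! * (size (mins D))`! *
     (size (maxs D))`! * (size (fork_side D true))`!).
Proof.
move=> b0 Qk ilt nb; apply: zone_at_least => //.
apply: (@anchored_nonbend _ _ i) => //; first by move=> th; exact: zkey_valid.
move: nb; rewrite /bend negb_or => /andP[nmax nmin].
move=> t t'; apply: zone_key_mid_rank => //; rewrite ?mem_maxs ?mem_mins ?ilt //.
- exact: mins_uniq.
- exact: maxs_uniq.
- exact: mins_n.
- exact: maxs_n.
- exact: zM_n.
- exact: zM_c.
- exact: zmid_lt.
Qed.
End FitFamilies.

Definition its_ok (s : seq item) : bool :=
  all (fun x => (0 < it_half x) && (it_fork x ==> odd (it_half x))) s.

Definition tail_items (side : bool) (leaves forks : seq nat) : seq item :=
  [seq (side, a, false) | a <- leaves] ++ [seq (side, a, true) | a <- forks].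

Lemma tail_ends_cat side s t :
  tail_ends side (s ++ t) = tail_ends side s ++ tail_ends side t.
Proof. by rewrite /tail_ends filter_cat map_cat flatten_cat. Qed.

Lemma tail_ends_items side side' s t :
  perm_eq (tail_ends side (tail_items side' s t))
    (if side' == side then dbl s ++ t ++ t else [::]).
Proof.
rewrite /tail_items tail_ends_cat.
have -> : tail_ends side [seq (side', a, false) | a <- s] =
    if side' == side then dbl s else [::].
  by elim: s => [|x s]; rewrite /tail_ends /= /it_right /it_fork /=;
    case: ifP => //= _ ->.
have H : perm_eq (tail_ends side [seq (side', a, true) | a <- t])
    (if side' == side then t ++ t else [::]).
  apply/seq.permP => a; elim: t => [|x t]; rewrite /tail_ends /= /it_right /it_fork /=.
    by case: ifP.
  by case: ifP => //= _ ->; rewrite !count_cat /it_half /=; lia.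
by case: ifP H => // _ H; rewrite perm_cat2l.
Qed.

Lemma size_tail_ends s :
  size (tail_ends false s) + size (tail_ends true s) = size s + count it_fork s.
Proof.
elim: s => [//|x s IH]; rewrite -cat1s !tail_ends_cat !size_cat.
suff : size (tail_ends false [:: x]) + size (tail_ends true [:: x]) = 1 + it_fork x.
  by rewrite /=; lia.
by case: x => [[[] a] []].
Qed.

Lemma size_string_ends D :
  size (string_ends D false) + size (string_ends D true) = if looped D then 0 else 2.
Proof.
by rewrite /string_ends; case: (looped D) => //=; case: (0 < _)%R.
Qed.

Lemma size_fork_side D side :
  size (fork_side D side) = count (fun x => it_fork x && (it_right x == side)) (items D).
Proof.
by rewrite size_filter -[in RHS](mkseq_nth item0 (items D)) count_map.
Qed.

(** The number of inner vertices need not be checked separately: the numbers of ends of the tails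
    and of the string, together with the genus, determine it. *)
Lemma mk_fits (R : realType) (g : nat) (lam mu : seq nat) (P : seq R) (D : zdata) :
  its_ok (items D) -> cyci D < ntail D ->
  (0 < ncyc D -> odd (hw D (cyci D))) -> odd `|base D| ->
  (looped D -> 2 < ntail D /\ W D (ntail D) = base D) ->
  (~~ looped D -> (0 < base D)%R /\ ~ (ntail D = 1 /\ W D (ntail D) = (- base D)%R)) ->
  g = ncyc D + looped D ->
  perm_eq (string_ends D false ++ tail_ends false (items D)) lam ->
  perm_eq (string_ends D true ++ tail_ends true (items D)) mu ->
  uniq P -> size P = size lam + size mu + 2 * g - 2 ->
  fits g lam mu P D.
Proof.
move=> /allP ok i0n oc ob wl wo gE pl pm uP sP.
have okn i : i < ntail D -> 0 < hw D i /\ (fk D i -> odd (hw D i)).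
  move=> ilt; have /ok/andP[h0 /implyP h1] : nth item0 (items D) i \in items D by exact: mem_nth.
  by split.
have wfD : wf_data D.
  split=> //; first by exact: leq_ltn_trans i0n.
  - by move=> i /okn[].
  - by move=> i /okn[].
split=> //; rewrite sP -(perm_size pl) -(perm_size pm) !size_cat size_inner_vs//.
have := size_string_ends D; have := size_tail_ends (items D).
rewrite size_forks /ntail gE; case: (looped D) => /=; lia.
Qed.

Lemma sum_step_perm s t : perm_eq s t ->
  (\sum_(x <- s) it_step x = \sum_(x <- t) it_step x)%R.
Proof. by move=> st; apply: perm_big. Qed.

Lemma sum_step_items side s t :
  (\sum_(x <- tail_items side s t) it_step x)%R =
  (if side then - Posz (2 * (sumn s + sumn t)) else Posz (2 * (sumn s + sumn t)))%R.
Proof.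
rewrite /tail_items big_cat !big_map /it_step /it_right /it_half /=.
have H (r : seq nat) : (\sum_(j <- r) (if side then - Posz (2 * j) else Posz (2 * j)))%R =
   (if side then - Posz (2 * sumn r) else Posz (2 * sumn r))%R.
  elim: r => [|x r IH]; first by rewrite big_nil; case: side.
  by rewrite big_cons IH /=; case: side {IH}; lia.
by rewrite !H; case: side {H}; lia.
Qed.

Lemma W_total D : W D (ntail D) = (base D + \sum_(x <- items D) it_step x)%R.
Proof. by rewrite /W /ntail take_size. Qed.

(** * Part (a) *)

Definition all_items (l f l' f' : seq nat) : seq item :=
  tail_items false l f ++ tail_items true l' f'.

Section AllItems.
Variables (l f l' f' : seq nat) (s : seq item).
Hypothesis sP : perm_eq s (all_items l f l' f').

Lemma all_items_ends side :
  perm_eq (tail_ends side s) (if side then dbl l' ++ f' ++ f' else dbl l ++ f ++ f).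
Proof.
apply: perm_trans (tail_ends_perm side sP) _.
rewrite /all_items tail_ends_cat.
have h1 := tail_ends_items side false l f; have h2 := tail_ends_items side true l' f'.
apply: perm_trans (perm_cat h1 h2) _.
by case: side {h1 h2} => //=; rewrite cats0.
Qed.

Lemma all_items_steps t t' : perm_eq t (l ++ f) -> perm_eq t' (l' ++ f') ->
  perm_eq (map it_step s) ([seq Posz a | a <- dbl t] ++ [seq (- Posz b)%R | b <- dbl t']).
Proof.
move=> tE t'E; apply: perm_trans (perm_map _ sP) _.
have st (side : bool) (u v : seq nat) : map it_step (tail_items side u v) =
    [seq if side then (- Posz a)%R else Posz a | a <- dbl (u ++ v)].
  by rewrite /tail_items /dbl !map_cat -!map_comp.
rewrite /all_items map_cat !st.
by apply: perm_cat; rewrite perm_sym; apply: perm_map; exact: perm_map.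
Qed.

Lemma all_items_sum :
  (\sum_(x <- s) it_step x = Posz (2 * (sumn l + sumn f)) - Posz (2 * (sumn l' + sumn f')))%R.
Proof. by rewrite (sum_step_perm sP) big_cat /= !sum_step_items. Qed.

Lemma all_items_ok :
  0 \notin l ++ f ++ l' ++ f' -> {in f ++ f', forall x, odd x} -> its_ok s.
Proof.
rewrite !mem_cat !negb_or => /and4P[l0 f0 l'0 f'0] fo.
rewrite /its_ok (perm_all _ sP) /all_items !all_cat !all_map.
have pos (t : seq nat) : 0 \notin t -> {in t, forall x, 0 < x}.
  by move=> t0 x xt; rewrite lt0n; apply: contraNneq t0 => <-.
apply/andP; split; apply/andP; split; apply/allP => x xs;
  rewrite /= /it_half /it_fork /=; rewrite ?(pos _ _ _ xs)//;
  by apply: fo; rewrite mem_cat xs ?orbT.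
Qed.

Lemma all_items_size : size s = size l + size f + (size l' + size f').
Proof. by rewrite (perm_size sP) !size_cat !size_map. Qed.

Lemma all_items_forks lp b c i0 side :
  size (fork_side (ZData lp s b c i0) side) = if side then size f' else size f.
Proof.
rewrite size_fork_side /= (seq.permP sP) /all_items /tail_items !count_cat !count_map.
have h (a : pred nat) (t : seq nat) x : (forall y, a y = x) -> count a t = if x then size t else 0.
  by move=> H; rewrite (eq_count H); case: (x); rewrite ?count_predT ?count_pred0.
rewrite (h _ l false)// (h _ f (~~ side)); last by case: side.
rewrite (h _ l' false)// (h _ f' side); last by case: side.
by case: side => /=; rewrite ?addn0.
Qed.

(** Supplies a tail that can carry the cycles, since its half weight is odd. *)
Lemma all_items_fork_index side :
  (if side then f' else f) != [::] -> exists2 i, i < size s &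
    it_fork (nth item0 s i) /\ it_right (nth item0 s i) = side.
Proof.
move=> fne; have [x xf] : exists x, x \in if side then f' else f.
  by move: fne; case: (if side then _ else _) => // a t _; exists a; rewrite mem_head.
pose y : item := (side, x, true).
have ys : y \in s.
  rewrite (perm_mem sP) /all_items /tail_items !mem_cat /y.
  case: side xf {y fne} => xf.
    by rewrite (map_f (fun a => (true, a, true)) xf) !orbT.
  by rewrite (map_f (fun a => (false, a, true)) xf) !orbT.
by exists (index y s); rewrite ?index_mem ?nth_index.
Qed.
End AllItems.

Lemma its_ok_nth s i : its_ok s -> i < size s ->
  0 < it_half (nth item0 s i) /\ (it_fork (nth item0 s i) -> odd (it_half (nth item0 s i))).
Proof.
move=> /allP ok ilt; have /ok/andP[h0 /implyP h1] : nth item0 s i \in s by exact: mem_nth.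
by split.
Qed.

Lemma sumn_dbl s : sumn (dbl s) = 2 * sumn s.
Proof. by elim: s => //= x s ->; lia. Qed.

Section Decomposition.
Variables (lam : seq nat) (D : parity_decomposition lam).
Definition part_leaf : seq nat := part_2e D ++ part_2o D.

Lemma part_tailE : part_tail D = part_leaf ++ part_oo D.
Proof. by rewrite /part_tail /part_leaf catA. Qed.

Lemma decomposition_perm :
  perm_eq lam (dbl part_leaf ++ (part_oo D ++ part_oo D) ++ part_0 D).
Proof.
by have := parity_decompositionE D; rewrite /part_leaf /dbl map_cat catA.
Qed.

Lemma part_pos : 0 \notin lam -> 0 \notin part_leaf ++ part_oo D.
Proof.
move=> lam0; have := lam0; rewrite (perm_mem decomposition_perm) !mem_cat !negb_or.
move=> /and3P[h1 /andP[h2 _] _]; rewrite h2 andbT -negb_or -mem_cat.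
by apply: contraNN h1 => h; apply/mapP; exists 0.
Qed.

Lemma part_0_pos : 0 \notin lam -> 0 \notin part_0 D.
Proof.
move=> lam0; have := lam0; rewrite (perm_mem decomposition_perm) !mem_cat !negb_or.
by move=> /and3P[].
Qed.

Lemma decomposition_sum :
  sumn lam = 2 * (sumn part_leaf + sumn (part_oo D)) + sumn (part_0 D).
Proof.
have := perm_sumn decomposition_perm; move: part_leaf => t ->.
by rewrite !sumn_cat sumn_dbl; lia.
Qed.
End Decomposition.

Lemma max_min_sizes (D : zdata) (B : nat) :
  ~~ looped D -> odd `|base D| -> (0 < base D)%R ->
  count (bend D) (iota 0 (ntail D)) = B ->
  size (maxs D) = uphalf B /\ size (mins D) = B./2.
Proof.
move=> nlp ob b0; rewrite count_bend => H.
have := max_min_bends ob (ntail D); rewrite W0 b0 /maxs /mins !size_filter.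
move: H; rewrite /maxs /mins !size_filter.
have := uphalf_half B; have := odd_double_half B.
by case: (0 < W D (ntail D))%R; case: (odd B); lia.
Qed.

Section CaseA.
Variables (R : realType) (g d : nat) (lam mu : seq nat).
Variables (Dl : parity_decomposition lam) (Dm : parity_decomposition mu) (P : seq R).
Hypotheses (lamP : partition_of d lam) (muP : partition_of d mu).
Hypotheses (uP : uniq P) (sP : size P = size lam + size mu + 2 * g - 2).
Hypothesis size0 : size (part_0 Dl ++ part_0 Dm) <= 2.
Hypothesis oo_ne : part_oo Dl ++ part_oo Dm <> [::].

Let lam0 : 0 \notin lam. Proof. by case: lamP. Qed.
Let mu0 : 0 \notin mu. Proof. by case: muP. Qed.

Lemma oddness_all :
  {in part_oo Dl ++ part_oo Dm, forall x, odd x}.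
Proof. by move=> x; rewrite mem_cat => /orP[]; exact: part_oo_odd. Qed.

Lemma positive_all :
  0 \notin part_leaf Dl ++ part_oo Dl ++ part_leaf Dm ++ part_oo Dm.
Proof.
by rewrite catA mem_cat negb_or !part_pos.
Qed.

(** By parity there is exactly one other odd unrepeated entry, and the string joins it to [k]. If it
    also lies over [-oo], its weight differs from [k] because [part_0] has no repetitions; so the
    string cannot be reversed. *)
Lemma case_a k : k \in part_0 Dl ->
  let B := max_sign_changes k (dbl (part_tail Dl)) (dbl (part_tail Dm)) in
  at_least g lam mu P (fun=> True)
    ((size (part_oo Dl))`! * (size (part_oo Dm))`! * (B./2)`! * (uphalf B)`!).
Proof.
move=> kz B; have ok : odd k by exact: part_0_odd kz.
have k0 : 0 < k by case: (k) ok.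
have [s sA sB] := max_sign_changes_attained ok (all_items_steps
  (perm_refl (all_items (part_leaf Dl) (part_oo Dl) (part_leaf Dm) (part_oo Dm)))
  (perm_refl _) (perm_refl _)).
rewrite -!part_tailE in sB.
have sok := all_items_ok sA positive_all oddness_all.
have [i0 i0n [i0f _]] : exists2 i, i < size s & it_fork (nth item0 s i) /\ True.
  have [oE|oE] := eqVneq (part_oo Dl) [::].
    have oE' : part_oo Dm != [::] by apply/eqP => E; apply: oo_ne; rewrite oE E.
    by have [i ilt [h _]] := all_items_fork_index (side := true) sA oE'; exists i.
  by have [i ilt [h _]] := all_items_fork_index (side := false) sA oE; exists i.
pose D := ZData false s (Posz k) g i0.
have Wn : W D (ntail D) = (Posz (k + sumn (part_0 Dm)) - Posz (sumn (part_0 Dl)))%R.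
  rewrite W_total /= (all_items_sum sA).
  have := decomposition_sum Dl; have := decomposition_sum Dm.
  by case: lamP => _ _ ->; case: muP => _ _ ->; lia.
have oW : odd `|W D (ntail D)| by exact: odd_W.
have ends : [/\ perm_eq (string_ends D false) (part_0 Dl),
    perm_eq (string_ends D true) (part_0 Dm) & W D (ntail D) != (- Posz k)%R].
  rewrite /string_ends /=; move: size0 Wn oW kz (part_0_uniq Dl) (@part_0_pos _ Dl lam0)
    (@part_0_pos _ Dm mu0).
  rewrite size_cat.
  case: (part_0 Dl) => [//|x [|y [|z1 z2]]]; case: (part_0 Dm) => [|x' [|y' z]] //= _;
    move: (W D _) => w wE; rewrite wE !inE.
  (* If [k] were the only entry, the last weight would be zero, against its parity. *)
  - by move=> o1 /eqP E; move: o1; rewrite E; lia.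
  - move=> _ /eqP <- _ _ x'0.
    rewrite (_ : (_ < _)%R = true) /=; last by lia.
    split=> //; last by apply/eqP; lia.
    by rewrite perm_sym (_ : `|_| = x')//; lia.
  - move=> _ kxy /andP[xy _]; rewrite negb_or => /andP[x0 y0] _.
    rewrite (_ : (_ < _)%R = false) /=; last by case/orP: kxy => /eqP->; lia.
    split=> //.
      case/orP: kxy => /eqP->.
        by rewrite (_ : `|_| = y)//; lia.
      by rewrite (_ : `|_| = x) ?(perm_catC [:: y])//; lia.
    by apply/eqP; move/eqP: xy; case/orP: kxy => /eqP->; lia.
have [e1 e2 e3] := ends.
have fitD : fits g lam mu P D.
  apply: mk_fits => //=.
  - by move=> _; have [_] := its_ok_nth sok i0n; exact.
  - by move=> _; split; [by []|case=> _ /eqP; exact/negP].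
  - by rewrite addn0.
  - rewrite perm_sym (perm_trans (decomposition_perm Dl))// perm_sym.
    apply: perm_trans (perm_cat e1 (all_items_ends sA false)) _.
    by rewrite perm_catC /= -catA.
  - rewrite perm_sym (perm_trans (decomposition_perm Dm))// perm_sym.
    apply: perm_trans (perm_cat e2 (all_items_ends sA true)) _.
    by rewrite perm_catC /= -catA.
have [mxE mnE] := max_min_sizes (D := D) (B := B) isT ok k0 (sB _ _ _).
have := @zone_at_least R g lam mu P D fitD (fun=> True).
rewrite !(all_items_forks sA) mxE mnE => H.
apply: at_least_le (H _ _ _) => //.
- by rewrite -!mulnA; apply: eq_leq; congr (_ * _); rewrite mulnC -mulnA.
- have wfD := fit_wf fitD.
  apply: (anchored_open fitD) => //; first by move=> th; exact: zkey_valid.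
  by move=> t t' /eqP; rewrite (negPf e3).
Qed.
End CaseA.

(** * Part (b) *)

(** [h] injects the part of [V] outside [S] into the part inside. *)
Lemma card_half_in (T : finType) (V S : pred T) (h : T -> T) :
  injective h -> (forall t, V t -> ~~ S t -> V (h t) && S (h t)) ->
  #|V| <= 2 * #|[pred t | V t && S t]|.
Proof.
move=> hinj hS; have <- : #|[predI V & S]| + #|[predD V & S]| = #|V| := cardID S V.
rewrite mul2n -addnn; apply: leq_add.
  by apply: subset_leq_card; apply/fintype.subsetP => t; rewrite !inE andbC.
have <- := fintype.card_image hinj [predD V & S]; apply: subset_leq_card.
apply/fintype.subsetP => _ /fintype.imageP[t tS ->].
by move: tS; rewrite !inE => /andP[nS Vt]; exact: hS.
Qed.

Definition lefts (D : zdata) : seq nat := [seq i <- iota 0 (ntail D) | ~~ right D i].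
Definition rights (D : zdata) : seq nat := [seq i <- iota 0 (ntail D) | right D i].

Lemma mem_lefts D i : (i \in lefts D) = (i < ntail D) && ~~ right D i.
Proof. by rewrite mem_filter mem_iota andbC. Qed.
Lemma mem_rights D i : (i \in rights D) = (i < ntail D) && right D i.
Proof. by rewrite mem_filter mem_iota andbC. Qed.
Lemma lefts_uniq D : uniq (lefts D). Proof. by rewrite filter_uniq ?iota_uniq. Qed.
Lemma rights_uniq D : uniq (rights D). Proof. by rewrite filter_uniq ?iota_uniq. Qed.
Lemma lefts_n D : {in lefts D, forall i, i < ntail D}.
Proof. by move=> i; rewrite mem_lefts => /andP[]. Qed.
Lemma rights_n D : {in rights D, forall i, i < ntail D}.
Proof. by move=> i; rewrite mem_rights => /andP[]. Qed.
Lemma lefts_rights D : {in lefts D, forall i, i \notin rights D}.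
Proof. by move=> i; rewrite mem_lefts mem_rights => /andP[-> ->]. Qed.

Lemma size_lefts D : size (lefts D) = count (fun x => ~~ it_right x) (items D).
Proof.
by rewrite size_filter -[in RHS](mkseq_nth item0 (items D)) count_map.
Qed.
Lemma size_rights D : size (rights D) = count it_right (items D).
Proof.
by rewrite size_filter -[in RHS](mkseq_nth item0 (items D)) count_map.
Qed.

Section LowerZone.
Variables (D : zdata) (lo up : seq nat) (mid : nat -> nat) (M : nat).
Local Notation n := (ntail D).
Hypotheses (lo_uniq : uniq lo) (up_uniq : uniq up).
Hypotheses (lo_n : {in lo, forall i, i < n}) (up_n : {in up, forall i, i < n}).
Hypothesis lo_up : {in lo, forall i, i \notin up}.
Hypotheses (nM : n <= M) (cM : 2 * ncyc D <= M).
Hypothesis midM : forall i, i < n -> mid i < M.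

(** In every order respecting the zones the lower ones fill an initial segment of this length, so
    whether a point of [P] is low does not depend on the permutations. This is what separates the
    families below. *)
Definition lower_size : nat :=
  count (fun u => inner D u && (zone D lo up u <= 2)) (vs D).

Lemma lower_sizeE :
  lower_size = size (fork_side D false) + size lo +
    (if right D (cyci D) then 0 else 2 * ncyc D).
Proof.
clear nM cM midM lo_up up_n up_uniq.
rewrite /lower_size /vs !count_cat !count_map !count_bpairs.
have -> : count (preim VS (fun u => inner D u && (zone D lo up u <= 2))) (iota 0 n) = size lo.
  rewrite -size_filter; apply: perm_size; apply: uniq_perm => //.
    by rewrite filter_uniq ?iota_uniq.
  move=> i; rewrite mem_filter mem_iota /= add0n.
  case il : (i \in lo); first by rewrite (lo_n il).
  by case: ifP.
have -> : count (preim VT (fun u => inner D u && (zone D lo up u <= 2))) (iota 0 n) =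
    size (fork_side D false).
  rewrite -size_filter; congr size; apply: eq_filter => i /=.
  by case: (right D i); case: (fk D i).
rewrite (eq_count (a2 := fun=> ~~ right D (cyci D))); last by move=> i /=; case: ifP.
rewrite [count (fun i => inner D (VF i false) && _) _](eq_count (a2 := pred0)) ?count_pred0//.
rewrite [count _ (if _ then _ else _)](_ : _ = 0); last by case: (looped D).
by case: (right D (cyci D)) => /=; rewrite ?count_pred0 ?count_predT ?size_iota; lia.
Qed.

Lemma rank_initial (key : rvert -> nat) v :
  (forall u w, u \in vs D -> w \in vs D -> inner D u -> inner D w ->
     zone D lo up u <= 2 -> 2 < zone D lo up w -> key u < key w) ->
  v \in vs D -> inner D v -> (rank D key v < lower_size) = (zone D lo up v <= 2).
Proof.
move=> H vV iv; rewrite /rank /lower_size; case: (leqP (zone D lo up v) 2) => zv; last first.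
  apply/negbTE; rewrite -leqNgt; rewrite -!size_filter; apply: uniq_leq_size.
    by rewrite filter_uniq ?uniq_vs.
  move=> u; rewrite !mem_filter => /andP[/andP[iu zu] uV].
  by rewrite iu uV !andbT; exact: H.
rewrite -!size_filter -(@size_rcons _ _ v); apply: uniq_leq_size.
  by rewrite rcons_uniq mem_filter ltnn andbF filter_uniq ?uniq_vs.
move=> u; rewrite mem_rcons inE !mem_filter => /predU1P[->|/andP[/andP[iu ku] uV]].
  by rewrite iv zv vV.
rewrite iu uV !andbT; rewrite leqNgt; apply/negP => zu.
by have := H v u vV uV iv iu zv zu; rewrite ltnNge ltnW.
Qed.

Lemma rank_lower (th : zone_perms D lo up) v : v \in vs D -> inner D v ->
  (rank D (zone_key mid M th) v < lower_size) = (zone D lo up v <= 2).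
Proof.
apply: rank_initial => u w uV wV iu iw zu zw.
apply: (zone_key_zone_lt lo_uniq up_uniq lo_n up_n nM cM midM) => //.
exact: leq_ltn_trans zu zw.
Qed.
End LowerZone.

(** The signs alternate from a positive start, and a change from plus to minus needs a negative
    step, that is a right tail. *)
Lemma all_bends_sign (D : zdata) : odd `|base D| -> (0 < base D)%R ->
  (forall i, i < ntail D -> bend D i) ->
  (forall j, j <= ntail D -> (0 < W D j)%R = ~~ odd j) /\
  (forall i, i < ntail D -> right D i = ~~ odd i).
Proof.
move=> ob b0 H; have S j : j <= ntail D -> (0 < W D j)%R = ~~ odd j.
  elim: j => [|j IH] jn; first by rewrite W0 b0.
  have := H j jn; rewrite /bend /maxb /minb; have := IH (ltnW jn).
  by rewrite !W_pos//; case: (W D j < 0)%R; case: (W D j.+1 < 0)%R => //=; case: odd.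
split=> // i ilt; have := S i (ltnW ilt); have := S i.+1 ilt.
rewrite WS// /it_step -/(right D i) -/(hw D i) /=.
by case: (right D i); case: (odd i) => //=; lia.
Qed.

Lemma all_bends_extrema (D : zdata) : odd `|base D| -> (0 < base D)%R ->
  (forall i, i < ntail D -> bend D i) -> mins D = lefts D /\ maxs D = rights D.
Proof.
move=> ob b0 nb; have [sgn rgt] := all_bends_sign ob b0 nb.
split; apply: eq_in_filter => i; rewrite mem_iota /= => ilt.
  rewrite /minb rgt// W_pos// -[(W D i < 0)%R]negbK -W_pos// (sgn i (ltnW ilt)).
  by rewrite -W_pos// (sgn _ ilt) /=; case: odd.
rewrite /maxb rgt// (sgn i (ltnW ilt)) -[(W D i.+1 < 0)%R]negbK -W_pos// (sgn _ ilt) /=.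
by case: odd.
Qed.

Lemma perm_nseq_eq (T : eqType) (s : seq T) m x : perm_eq s (nseq m x) -> s = nseq m x.
Proof.
move=> sm; have sz := perm_size sm; rewrite size_nseq in sz.
rewrite -[in RHS]sz; apply/all_pred1P; apply/allP => y.
by rewrite (perm_mem sm) mem_nseq => /andP[_].
Qed.

(* Splices the second tail in front of the first one. *)
Definition swap01 (s : seq item) : seq item :=
  if s is x :: y :: s' then y :: x :: s' else s.

Lemma swap01_perm s : perm_eq (swap01 s) s.
Proof. by case: s => [|x [|y s]] //=; rewrite (perm_catCA [:: y] [:: x] s). Qed.

(** Only the partial sum between the two exchanged steps changes. *)
Lemma W_swap01 lp s b c i0 j : j != 1 ->
  W (ZData lp (swap01 s) b c i0) j = W (ZData lp s b c i0) j.
Proof.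
case: s => [|x [|y s]] //; case: j => [|[|j]] // _; rewrite ?W0//.
by rewrite /W /= !big_cons; congr (_ + _)%R; rewrite addrCA.
Qed.

Section OpenLeftEnds.
Variables (R : realType) (P : seq R) (D : zdata) (lo up : seq nat) (mid : nat -> nat) (M : nat).
Local Notation n := (ntail D).
Hypothesis wfD : wf_data D.
Hypothesis sizeP : size P = size (inner_vs D).
Hypothesis uniqP : uniq P.
Hypothesis opn : ~~ looped D.
Hypotheses (lo_uniq : uniq lo) (up_uniq : uniq up).
Hypotheses (lo_n : {in lo, forall i, i < n}) (up_n : {in up, forall i, i < n}).
Hypotheses (nM : n <= M) (cM : 2 * ncyc D <= M).
Hypothesis midM : forall i, i < n -> mid i < M.
Variable th : zone_perms D lo up.
Local Notation key := (zone_key mid M th).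
Hypothesis vkey : valid_key D key.

(* Some string end over [-oo] is attached below the first [t] inner vertices. *)
Definition low_left_end (k t : nat) (C : pl_map R) : Prop :=
  exists2 i, i < t & edge_count C -oo%E (nth 0%R (sort <=%R P) i)%:E k = 1.

Lemma low_left_end_first : zone D lo up (VS 0) <= 2 ->
  low_left_end `|base D| (lower_size D lo up) (cov P D key).
Proof.
move=> z0; have n0 := wf_n wfD; exists (rank D key (VS 0)).
  by rewrite rank_lower// mem_vs.
have E0 : ES 0 \in es D by rewrite mem_es /= opn addn1.
have := edge_count_string wfD vkey sizeP uniqP E0.
by rewrite /= (negPf opn) ltn_eqF// W0.
Qed.

Lemma not_low_left_end k : odd k ->
  2 < zone D lo up (VS 0) -> 2 < zone D lo up (VS n.-1) ->
  ~ low_left_end k (lower_size D lo up) (cov P D key).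
Proof.
move=> ok z0 z1 [i it /(edge_count1_string wfD ok)[j jE [_ [s sE]]]].
have n0 := wf_n wfD.
have bad v : v \in vs D -> inner D v -> 2 < zone D lo up v ->
    rphi P D key v = (nth 0%R (sort <=%R P) i)%:E -> False.
  move=> vV iv zv; rewrite /rphi iv => -[] /eqP.
  rewrite nth_uniq ?sort_uniq ?size_sort ?rank_max//; last first.
    apply: leq_trans it _; rewrite sizeP /lower_size /inner_vs size_filter.
    by apply: sub_count => u /andP[].
  move=> /eqP ri; move: it; rewrite -ri rank_lower// => h.
  by move: zv; rewrite ltnNge h.
move: jE; rewrite mem_es /= opn addn1 ltnS leq_eqVlt => /predU1P[jn|jn].
  have h : s = true.
    case: s sE => // sE; have := sE false; rewrite /= jn.
    by case: (n) n0 => // m _; rewrite /rphi.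
  have := sE false; rewrite h /= jn.
  have -> : (match n with | 0 => if looped D then VS n.-1 else VX false | j'.+1 =>
    VS j' end) = VS n.-1.
    by case: (n) n0.
  by apply: bad => //; rewrite mem_vs /= prednK.
case: j jn sE => [|j] jn sE.
  have h : s = false.
    by case: s sE => // sE; have := sE true; rewrite /= ltn_eqF// /rphi.
  by have := sE true; rewrite h /= ltn_eqF//; apply: bad => //; rewrite mem_vs.
case: s sE => sE; first by have := sE true; rewrite /= ltn_eqF// /rphi.
by have := sE false; rewrite /= /rphi.
Qed.
End OpenLeftEnds.

Lemma papp_tperm m (a b k : nat) (am : a < m) (bm : b < m) (p : {perm 'I_m}) : k < m ->
  papp (tperm (Ordinal am) (Ordinal bm) * p)%g k =
  papp p (if k == a then b else if k == b then a else k).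
Proof.
move=> km; have E (q : {perm 'I_m}) (i : 'I_m) : papp q i = q i := pappE q i.
rewrite -[k in papp _ k]/(val (Ordinal km)) E permM.
case: tpermP => [/(congr1 val)/= -> | /(congr1 val)/= -> | na nb].
- by rewrite eqxx -E.
- by rewrite eqxx -E; case: eqP => [->|].
have -> : (k == a) = false by apply/eqP => ka; apply: na; apply/val_inj.
have -> : (k == b) = false by apply/eqP => kb; apply: nb; apply/val_inj.
by rewrite -E.
Qed.

Lemma card_up_lt D lo up (a b : nat) : a < size up -> b < size up -> a != b ->
  #|zone_perms D lo up| <=
  2 * #|[pred x : zone_perms D lo up | papp (perm_up x) a < papp (perm_up x) b]|.
Proof.
move=> am bm ab; pose t := tperm (Ordinal am) (Ordinal bm).
apply: leq_trans (card_half_in (V := predT)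
    (S := fun x : zone_perms D lo up => papp (perm_up x) a < papp (perm_up x) b)
    (h := fun x => (x.1.1, (t * x.1.2)%g, x.2)) _ _) _ => //.
  by move=> [[x1 x2] x3] [[y1 y2] y3] /= [-> /mulgI -> ->].
move=> [[x1 x2] x3] _ /=; rewrite /perm_up /= !papp_tperm// eqxx eq_sym (negPf ab) eqxx.
rewrite -leqNgt leq_eqVlt => /orP[|//].
by move=> /eqP /(papp_inj bm am) E; rewrite E eqxx in ab.
Qed.

Section SideFamily.
Variable D : zdata.
Local Notation n := (ntail D).
Definition sM : nat := n + 2 * ncyc D.
Notation skey := (zone_key (D := D) (lo := lefts D) (up := rights D) id sM).

Lemma sM_n : n <= sM. Proof. by rewrite /sM; lia. Qed.
Lemma sM_c : 2 * ncyc D <= sM. Proof. by rewrite /sM; lia. Qed.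
Lemma id_sM i : i < n -> id i < sM. Proof. by rewrite /sM /=; lia. Qed.
Lemma side_zone_lt (th : zone_perms D (lefts D) (rights D)) i j :
  i < n -> j < n -> ~~ right D i -> right D j -> skey th (VS i) < skey th (VS j).
Proof.
move=> ilt jlt ri rj.
apply: (zone_key_zone_lt (lefts_uniq D) (rights_uniq D) (@lefts_n D) (@rights_n D) sM_n sM_c id_sM).
- by rewrite mem_vs.
- by [].
- by rewrite mem_vs.
- by [].
- by rewrite /= !mem_lefts !mem_rights ilt jlt ri rj.
Qed.

Lemma side_valid (th : zone_perms D (lefts D) (rights D)) : wf_data D ->
  string_valid id sM th -> valid_key D (skey th).
Proof.
move=> wfD; apply: (zone_key_valid wfD (lefts_uniq D) (rights_uniq D) (@lefts_n D) (@rights_n D)).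
- exact: sM_n.
- exact: sM_c.
- exact: id_sM.
- by [].
Qed.

Lemma side_rank_inj (th th' : zone_perms D (lefts D) (rights D)) :
  (forall v, v \in vs D -> inner D v -> rank D (skey th) v = rank D (skey th') v) ->
  th = th'.
Proof.
apply: zone_key_rank_inj; [exact: lefts_uniq|exact: rights_uniq|exact: lefts_n|exact: rights_n|].
exact: lefts_rights.
Qed.
End SideFamily.

Section CaseB.
Variables (R : realType) (d : nat) (lam mu : seq nat).
Variables (Dl : parity_decomposition lam) (Dm : parity_decomposition mu) (P : seq R).
Hypotheses (lamP : partition_of d lam) (muP : partition_of d mu).
Hypothesis excl :
  forall k, 1 <= k -> ~ {subset [:: lam; mu] <= [:: [:: 2 * k]; [:: k; k]]}.
Hypotheses (uP : uniq P) (sP : size P = size lam + size mu + 2 * 0 - 2).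
Hypothesis no0 : part_0 Dl ++ part_0 Dm = [::].
Variable k : nat.
Hypothesis koo : k \in part_oo Dl.

Let lam0 : 0 \notin lam. Proof. by case: lamP. Qed.
Let mu0 : 0 \notin mu. Proof. by case: muP. Qed.
Let zl : part_0 Dl = [::]. Proof. by case: (part_0 Dl) no0. Qed.
Let zm : part_0 Dm = [::]. Proof. by case: (part_0 Dl) no0. Qed.
Let ok : odd k. Proof. exact: part_oo_odd koo. Qed.
Let k0 : 0 < k. Proof. by case: (k) ok. Qed.
Let f := rem k (part_oo Dl).
Let items_b := all_items (part_leaf Dl) f (part_leaf Dm) (part_oo Dm).
Let oofE : perm_eq (part_oo Dl) (k :: f).
Proof. exact: perm_to_rem. Qed.

Let sums : sumn (part_leaf Dl) + (k + sumn f) = sumn (part_leaf Dm) + sumn (part_oo Dm).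
Proof.
have := decomposition_sum Dl; have := decomposition_sum Dm; rewrite zl zm /=.
have -> : sumn (part_oo Dl) = k + sumn f by rewrite (perm_sumn oofE).
by case: lamP => _ _ ->; case: muP => _ _ ->; clear; lia.
Qed.

(** The fork entry [k] stands for two parts of [lam]: they become the two ends of the string, and
    [f] keeps the other forks. *)
Let Db s := ZData false s (Posz k) 0 0.

Let Wb s : perm_eq s items_b -> W (Db s) (size s) = (- Posz k)%R.
Proof.
move=> sE; rewrite [LHS](W_total (Db s)) /= (all_items_sum sE).
by move: sums; clear; lia.
Qed.

(** With a single tail [lam] would be (k,k) and [mu] either (k,k) or (2k), which is the excluded
    pair. *)
Let size_b s : perm_eq s items_b -> size s != 1 /\ 0 < size s.
Proof.
move=> sE; have sz := all_items_size sE.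
have ne : 0 < size s.
  rewrite sz; case: (part_leaf Dm) (part_oo Dm) sums => [|? ?] [|? ?] //=; move: k0; clear; lia.
split=> //; apply/eqP => s1; move: sz; rewrite s1 => sz.
have [/size0nil l0 /size0nil f0] : size (part_leaf Dl) = 0 /\ size f = 0.
  case: (part_leaf Dm) (part_oo Dm) sums sz => [|? ?] [|? ?] /=; move: k0; clear; lia.
have lamE : lam = [:: k; k].
  apply: (@perm_nseq_eq _ _ 2); apply: perm_trans (decomposition_perm Dl) _.
  have oo1 : perm_eq (part_oo Dl) [:: k] by have := oofE; rewrite f0.
  by rewrite l0 zl cats0 /=; exact: (perm_cat oo1 oo1).
apply: (excl k0) => x; rewrite !inE => /orP[] /eqP->; rewrite ?lamE ?eqxx ?orbT//.
have := decomposition_perm Dm; rewrite zm cats0; move: sums sz; rewrite l0 f0 /=.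
case: (part_leaf Dm) (part_oo Dm) => [|y [|? ?]] [|y' [|? ?]] //=;
  rewrite ?cats0 => E sz; try (by move: E sz; clear; lia).
- have -> : y' = k by move: E; clear; lia.
  by move=> /(@perm_nseq_eq _ _ 2) ->; rewrite eqxx orbT.
- have -> : y = k by move: E; clear; lia.
  by move=> /(@perm_nseq_eq _ _ 1) ->; rewrite eqxx.
Qed.

Let b_ok s : perm_eq s items_b -> its_ok s.
Proof.
move=> sE; apply: all_items_ok sE _ _.
  have := part_pos Dl lam0; have := part_pos Dm mu0; rewrite !mem_cat !negb_or.
  move=> /andP[-> ->] /andP[-> h]; rewrite /= andbT.
  by apply: contraNN h => /mem_rem.
by move=> x; rewrite mem_cat => /orP[/mem_rem|]; exact: part_oo_odd.
Qed.

Let fits_b s : perm_eq s items_b -> fits 0 lam mu P (Db s).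
Proof.
move=> sE; have [s1 s0] := size_b sE.
apply: mk_fits => //=.
- exact: b_ok.
- by move=> _; split=> // -[E _]; move: s1; rewrite -E eqxx.
- rewrite /string_ends /= [ntail _]/(size s) (Wb sE).
  rewrite (_ : (0 < - Posz k)%R = false)/=; last by move: k0; clear; lia.
  apply/seq.permP => a; rewrite (seq.permP (decomposition_perm Dl)) zl cats0.
  rewrite !count_cat (seq.permP oofE) /= (seq.permP (all_items_ends sE false)) /= !count_cat
    abszN absz_nat.
  by clear; lia.
- rewrite /string_ends /= [ntail _]/(size s) (Wb sE).
  rewrite (_ : (0 < - Posz k)%R = false)/=; last by move: k0; clear; lia.
  apply/seq.permP => a; rewrite (seq.permP (decomposition_perm Dm)) zm cats0.
  exact: (seq.permP (all_items_ends sE true)).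
Qed.

Lemma case_b :
  let B := max_sign_changes k (dbl (rem k (part_tail Dl))) (dbl (part_tail Dm)) in
  at_least 0 lam mu P (fun=> True)
    ((size (part_oo Dl) - 1)`! * (size (part_oo Dm))`! * (B./2)`! * (uphalf B)`!).
Proof.
move=> B.
have tE : perm_eq (rem k (part_tail Dl)) (part_leaf Dl ++ f).
  rewrite -(perm_cons k) part_tailE.
  apply: (@perm_trans _ (part_leaf Dl ++ part_oo Dl)).
    by rewrite perm_sym perm_to_rem// mem_cat koo orbT.
  apply: (@perm_trans _ (part_leaf Dl ++ k :: f)); first by rewrite perm_cat2l.
  by rewrite -cat1s perm_catCA.
have tE' : perm_eq (part_tail Dm) (part_leaf Dm ++ part_oo Dm) by rewrite part_tailE.
have [s sA sB] := max_sign_changes_attained ok (all_items_steps (perm_refl items_b) tE tE').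
have {}sB : count (bend (Db s)) (iota 0 (size s)) = B by exact: sB.
pose D := Db s; have fitD : fits 0 lam mu P D := fits_b sA.
have wfD := fit_wf fitD.
have nD : ntail D = size s by [].
have [mxE mnE] := max_min_sizes (D := D) (B := B) isT ok k0 sB.
have fE : size f = size (part_oo Dl) - 1 by rewrite size_rem// subn1.
rewrite -fE.
have [nb|ab] := boolP (all (bend D) (iota 0 (ntail D))); last first.
  move: ab; rewrite -has_predC => /hasP[i]; rewrite mem_iota /= add0n => ilt nb.
  have := @zone_nonbend R 0 lam mu P D fitD (fun=> True) i.
  rewrite !(all_items_forks sA) mxE mnE => H; apply: at_least_le (H _ _ _ _) => //.
  by rewrite -!mulnA; apply: eq_leq; congr (_ * _); rewrite mulnC -mulnA.
have {}nb i : i < ntail D -> bend D i by move=> ilt; apply: (allP nb); rewrite mem_iota.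
have ob : odd `|base D| by exact: ok.
have [sgn rgt] := all_bends_sign ob k0 nb.
have [minsE maxsE] := all_bends_extrema (D := D) ob k0 nb.
have nodd : odd (ntail D).
  have := sgn _ (leqnn (ntail D)); rewrite [W _ _](Wb sA).
  by rewrite (_ : (0 < - Posz k)%R = false); [case: odd|move: k0; clear; lia].
have [n1 n0] := size_b sA.
have n3 : 2 < ntail D.
  by move: n1 n0 nodd; rewrite nD; case: (size s) => [|[|[|]]].
have lo_eq (E : seq item) : perm_eq E s -> size (lefts (Db E)) = (B./2).
  by move=> Es; rewrite size_lefts /= (seq.permP Es) -mnE minsE size_lefts.
have up_eq (E : seq item) : perm_eq E s -> size (rights (Db E)) = uphalf B.
  by move=> Es; rewrite size_rights /= (seq.permP Es) -mxE maxsE size_rights.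
pose X := (size f)`! * (B./2)`! * (uphalf B)`! * (size (part_oo Dm))`!.
pose thr := size f + B./2.
pose Q := low_left_end P k thr.
(* Alternating string: both ends are attached to right tails, above the threshold, and only the
   reversal can identify members. *)
have alt : exists2 m, X <= 2 * m & at_least 0 lam mu P (fun C => ~ Q C) m.
  pose key := zone_key (D := D) (lo := mins D) (up := maxs D) (zmid D) (zM D).
  have vk th : valid_key D (key th) by exact: zkey_valid.
  have XE : X = #|zone_perms D (mins D) (maxs D)|.
    by rewrite card_zone_perms !(all_items_forks sA) mxE mnE.
  rewrite XE; apply: (@at_least_fibers _ _ _ _ _ _ _ (fun th => cov P D (key th))).
    move=> th; split; first exact: (fits_cover fitD).
    have -> : Q = low_left_end P k (lower_size D (mins D) (maxs D)).
      by rewrite /Q (lower_sizeE _ (mins_uniq D) (@mins_n D)) (all_items_forks sA) mnE if_same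
        addn0.
    apply: not_low_left_end => //; rewrite ?mins_uniq ?maxs_uniq ?zM_n ?zM_c//.
    - by case: fitD.
    - exact: mins_n.
    - exact: maxs_n.
    - exact: zmid_lt.
    - have h : 0 < ntail D by exact: ltn_trans n3.
      by rewrite /= minsE maxsE mem_lefts mem_rights rgt// h.
    - have h : (ntail D).-1 < ntail D by rewrite prednK// (ltn_trans _ n3).
      rewrite /= minsE maxsE mem_lefts mem_rights rgt// h /=.
      by case: (ntail D) nodd => //= m ->.
  move=> t; set A := [pred t' | _].
  (* Within a fibre [VS 0] has at most two places, that of [VS 0] and that of the last string vertex
     in the reference cover [t]. The place fixes [ES 0], hence the whole order. *)
  pose h t' := rphi P D (key t') (VS 0) == rphi P D (key t) (VS 0).
  rewrite -card_bool -(@card_in_imset _ _ h A); first exact: max_card.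
  have sz := fit_P fitD.
  have fe t' : t' \in A -> rphi P D (key t') (VS 0) = if h t' then rphi P D (key t) (VS 0)
      else rphi P D (key t) (VS (ntail D).-1).
    rewrite inE => /asboolP E; rewrite /h.
    have [ag|[_ ag]] := first_edge wfD (vk t') sz uP E isT.
      have := ag true; rewrite /= ltn_eqF ?(ltn_trans _ n3)// => ->.
      by rewrite eqxx.
    by rewrite ag; case: eqP.
  move=> t1 t2 A1 A2 h12; apply: zkey_rank_inj.
  have E12 : edge_count (cov P D (key t1)) = edge_count (cov P D (key t2)).
    by move: A1 A2; rewrite !inE => /asboolP -> /asboolP ->.
  apply: (agree_rank wfD (vk t1) (vk t2) sz uP E12 (j0 := 0)) => //;
    first by rewrite mem_es /= addn1.
  case; last by rewrite /= /rphi.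
  by rewrite /= ltn_eqF ?(ltn_trans _ n3)// (fe _ A1) (fe _ A2) h12.
(* Exchanged string: it rises from a left tail through two right tails whose order is prescribed, so
   half of the permutations remain. Its last vertex still lies above the threshold, which excludes
   the reversal. *)
have chn : exists2 m, X <= 2 * m & at_least 0 lam mu P Q m.
  have s'A : perm_eq (swap01 s) items_b := perm_trans (swap01_perm s) sA.
  pose D' := Db (swap01 s); have fitD' : fits 0 lam mu P D' := fits_b s'A.
  have wfD' := fit_wf fitD'.
  have nE : ntail D' = ntail D by rewrite /ntail (perm_size (swap01_perm s)).
  have WE j : j != 1 -> W D' j = W D j by move=> j1; exact: W_swap01.
  have r' i : i < ntail D -> right D' i = if i < 2 then odd i else ~~ odd i.
    move=> ilt; have := rgt 0 (ltn_trans _ n3); have := rgt 1 (ltn_trans _ n3).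
    have := rgt i ilt; rewrite /right /D' /D /=; move: ilt n3; rewrite /ntail /= /Db.
    case: (s) => [|x [|y s2]] //= _ _; case: i => [|[|i]] //= _ h0 h1.
    - by rewrite h0.
    - by rewrite h1.
  have r1 : 1 \in rights D' by rewrite mem_rights nE r'// (ltn_trans _ n3).
  have r2 : 2 \in rights D' by rewrite mem_rights nE r'// n3.
  pose S (x : zone_perms D' (lefts D') (rights D')) :=
    papp (perm_up x) (index 1 (rights D')) < papp (perm_up x) (index 2 (rights D')).
  pose key := zone_key (D := D') (lo := lefts D') (up := rights D') id (sM D').
  have vk (x : {x | S x}) : valid_key D' (key (val x)).
    apply: side_valid => // j i i' jE iE i'E; move: (valP x); move: (val x) => {}x xS.
    have jlt : j < ntail D'.
      move: jE i'E; rewrite mem_es /= addn1 ltnS leq_eqVlt => /orP[/eqP->|//].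
      by rewrite eqxx.
    have i'j : i' = j by move: i'E; rewrite /= ltn_eqF// => -[].
    have {iE} ji : j = i.+1 by move: iE => /=; case: (j) => // m [->].
    rewrite {i' i'E}i'j ji in jlt jE *.
    rewrite -[zone_key _ _ _ (VS i)]/(key x (VS i)) -[zone_key _ _ _ (VS i.+1)]/(key x (VS i.+1)).
    have ilt : i < ntail D' := ltnW jlt.
    have r'i : right D' i = if i < 2 then odd i else ~~ odd i by rewrite r' -?nE.
    have r'j : right D' i.+1 = if i.+1 < 2 then odd i.+1 else ~~ odd i.+1 by rewrite r' -?nE.
    case: i => [|[|i]] in ilt jlt jE r'i r'j ji *.
    - have -> : (0 < W D' 1)%R.
        have := WS (D := D') ilt; rewrite W0 => ->.
        move: r'i; rewrite /right /it_step => ->; move: k0; rewrite /=; clear; lia.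
      by apply: side_zone_lt => //; rewrite ?r'i ?r'j.
    - rewrite WE// sgn ?nE// -?nE ?(ltnW jlt)//=.
      rewrite /key /= !mem_lefts r'i r'j /= r1 r2 /= !andbF ltn_add2l.
      exact: xS.
    - rewrite WE// sgn -?nE ?(ltnW jlt)//= negbK; case oi : (odd i).
        by apply: side_zone_lt => //; rewrite ?r'i ?r'j /= ?oi.
      by apply: side_zone_lt => //; rewrite ?r'i ?r'j /= ?oi.
  have qk (x : {x | S x}) : Q (cov P D' (key (val x))).
    have -> : Q = low_left_end P `|base D'| (lower_size D' (lefts D') (rights D')).
      by rewrite /Q (lower_sizeE _ (lefts_uniq D') (@lefts_n D')) (all_items_forks s'A) lo_eq
        ?swap01_perm// if_same addn0.
    apply: low_left_end_first => //.
    - by case: fitD'.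
    - exact: lefts_uniq.
    - exact: rights_uniq.
    - exact: lefts_n.
    - exact: rights_n.
    - exact: sM_n.
    - exact: id_sM.
    - by rewrite /= mem_lefts nE r' ?(ltn_trans _ n3).
  exists #|[the finType of {x | S x}]|.
    rewrite card_sig; have := @card_up_lt D' (lefts D') (rights D') (index 1 (rights D'))
      (index 2 (rights D')).
    rewrite !seq.index_mem r1 r2 => /(_ isT isT) H.
    have XE : X = #|zone_perms D' (lefts D') (rights D')|.
      by rewrite card_zone_perms !(all_items_forks s'A) lo_eq ?up_eq ?swap01_perm.
    rewrite XE; apply: H; apply/eqP => E.
    by have := nth_index 0 r1; rewrite E nth_index.
  apply: (family_at_least fitD' vk qk).
    apply: (anchored_open fitD') => // t t' _.
    have h0 : 0 < ntail D' by rewrite nE (ltn_trans _ n3).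
    have h1 : (ntail D').-1 < ntail D' by rewrite prednK.
    have v0 : VS 0 \in vs D' by rewrite mem_vs.
    have v1 : VS (ntail D').-1 \in vs D' by rewrite mem_vs.
    have lower x v : v \in vs D' -> inner D' v ->
      (rank D' (key x) v < lower_size D' (lefts D') (rights D'))
        = (zone D' (lefts D') (rights D') v <= 2).
      apply: rank_lower; [exact: lefts_uniq|exact: rights_uniq|exact: lefts_n|
        exact: rights_n|exact: sM_n|exact: sM_c|exact: id_sM].
    rewrite /rphi /inner => -[] /eqP.
    have rk x v : v \in vs D' -> inner D' v -> rank D' (key x) v < size (sort <=%R P).
      by rewrite size_sort; apply: rank_max; exact: fit_P fitD'.
    rewrite nth_uniq ?sort_uniq ?rk// => /eqP E.
    have := lower (val t) _ v0 isT; rewrite E lower//= !mem_lefts !mem_rights h0 h1 !r' -?nE//.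
    by rewrite nE; case: (ntail D) nodd n3 => [|[|[|m]]] //= ->.
  by move=> t t' H; apply/val_inj/side_rank_inj.
have [m1 Xm1 al1] := alt; have [m2 Xm2 al2] := chn.
apply: at_least_le (at_leastW _ (at_leastD _ al1 al2)) => //; last first.
  by move=> C C' nq q E; apply: nq; case: q => i it iE; exists i; rewrite ?E.
have -> : (size f)`! * (size (part_oo Dm))`! * (B./2)`! * (uphalf B)`! = X.
  by rewrite /X -!mulnA; congr (_ * _); rewrite mulnC -mulnA.
by move: Xm1 Xm2; clear; lia.
Qed.
End CaseB.

(** * Part (c) *)

Section LoopRotation.
Variables (x : item) (s : seq item) (b : int) (c i0 c' i0' : nat).
Local Notation D := (ZData true (x :: s) b c i0).
Local Notation D1 := (ZData true (rcons s x) (b + it_step x)%R c' i0').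
Hypothesis ob : odd `|b|.
Hypothesis closed : W D (ntail D) = b.

Lemma W_rot1 i : i <= size s -> W D1 i = W D i.+1.
Proof.
by move=> ile; rewrite /W /= -cats1 takel_cat// big_cons addrA.
Qed.

Lemma W_rot1_closed : W D1 (ntail D1) = base D1.
Proof.
move: closed; rewrite !W_total /= -cats1 big_cat !big_cons big_nil /=.
move: (\sum_(_ <- s) _)%R => S; clear; lia.
Qed.

Lemma bend_rot1 i : i < size s -> bend D1 i = bend D i.+1.
Proof.
by move=> ilt; rewrite !bendE ?odd_it_step// !W_rot1// ltnW.
Qed.

Lemma bend_rot1_last : bend D1 (size s) = bend D 0.
Proof.
rewrite !bendE ?odd_it_step// W_rot1//.
have -> : W D1 (size s).+1 = W D 1.
  have := W_rot1_closed; rewrite /ntail /= size_rcons => ->.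
  by rewrite -(W_rot1 (leq0n _)) W0.
by have := closed; rewrite /ntail /= => ->; rewrite W0 mulrC.
Qed.

Lemma count_bend_rot1 :
  count (bend D1) (iota 0 (ntail D1)) = count (bend D) (iota 0 (ntail D)).
Proof.
rewrite /ntail /= size_rcons -[X in iota 0 X]addn1 iotaD count_cat /= add0n bend_rot1_last addn0.
rewrite addnC -[iota 1 _]/(iota (1 + 0) _) iotaDl count_map; congr (_ + _).
by apply: eq_in_count => i; rewrite mem_iota /= => ilt; exact: bend_rot1.
Qed.
End LoopRotation.

(* A loop over [s0] whose string has [B] bends; it can be cut at any vertex. *)
Definition loop_data (s0 : seq item) (B : nat) (s : seq item) (b : int) : Prop :=
  let D := ZData true s b 0 0 in
  [/\ perm_eq s s0, odd `|b|, W D (size s) = b & count (bend D) (iota 0 (size s)) = B].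

Lemma loop_rot1 s0 B x s b : loop_data s0 B (x :: s) b ->
  loop_data s0 B (rcons s x) (b + it_step x)%R.
Proof.
move=> [sP ob Wn Bn]; split.
- by rewrite perm_rcons.
- by rewrite odd_it_step.
- exact: (W_rot1_closed _ _ Wn).
- by rewrite -Bn; exact: (@count_bend_rot1 x s b 0 0 0 0 ob Wn).
Qed.

(** Provides the cut at a bend that [zkey_valid] demands of a loop. *)
Lemma loop_cut_bend s0 B s b : 0 < B -> loop_data s0 B s b ->
  exists s' b', loop_data s0 B s' b' /\ bend (ZData true s' b' 0 0) 0.
Proof.
move=> B0 L; have [_ _ _ BE] := L.
have : has (bend (ZData true s b 0 0)) (iota 0 (size s)) by rewrite has_count BE.
move=> /hasP[i]; rewrite mem_iota /= => ilt bi.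
elim: i s b L {BE} ilt bi => [|i IH] s b L ilt bi; first by exists s, b.
case: s L ilt bi => [//|x s] L ilt bi; have [sP ob Wn _] := L.
apply: (IH _ _ (loop_rot1 L)); first by rewrite size_rcons ltnW.
by rewrite (@bend_rot1 x s b 0 0 0 0 ob).
Qed.

(** Position 1 is the one that [swap01] moves to the front: the chosen left fork is second on the
    alternating loop and first on the exchanged one. *)
Lemma loop_cut_second s0 B s b (a : pred item) : 1 < size s -> loop_data s0 B s b -> has a s ->
  exists s' b', loop_data s0 B s' b' /\ a (nth item0 s' 1).
Proof.
move=> s1 L /(has_nthP item0)[i ilt ai].
have [j jlt [s' [b' [L' sz aj]]]] : exists2 j, 0 < j & exists s' b',
    [/\ loop_data s0 B s' b', j < size s' & a (nth item0 s' j)].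
  case: i ilt ai => [|i] ilt ai; last by exists i.+1 => //; exists s, b.
  case: s L s1 ilt ai => [//|x s] L s1 ilt ai; exists (size s) => //.
  exists (rcons s x), (b + it_step x)%R; split; first exact: loop_rot1.
    by rewrite size_rcons.
  by rewrite nth_rcons ltnn eqxx.
case: j jlt aj sz => [//|j] _; elim: j s' b' L' => [|j IH] s' b' L' aj sz.
  by exists s', b'.
case: s' L' sz aj => [//|x s'] L' sz aj.
apply: (IH _ _ (loop_rot1 L')); last by rewrite size_rcons ltnW.
by rewrite nth_rcons ifT.
Qed.

Section Loops.
Variables (R : realType) (g : nat) (lam mu l f l' f' : seq nat) (P : seq R).
Hypotheses (lamE : perm_eq lam (dbl l ++ f ++ f)) (muE : perm_eq mu (dbl l' ++ f' ++ f')).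
Hypothesis pos : 0 \notin l ++ f ++ l' ++ f'.
Hypothesis fo : {in f ++ f', forall x, odd x}.
Hypotheses (uP : uniq P) (sP : size P = size lam + size mu + 2 * g - 2).
Hypothesis sums : sumn l + sumn f = sumn l' + sumn f'.
Hypothesis n3 : 2 < size l + size f + (size l' + size f').
Hypothesis g0 : 0 < g.
Local Notation its := (all_items l f l' f').

Lemma loop_fits B s b i0 : loop_data its B s b -> i0 < size s -> it_fork (nth item0 s i0) ->
  fits g lam mu P (ZData true s b g.-1 i0).
Proof.
move=> [sE ob Wn _] i0n i0f; have sok := all_items_ok sE pos fo.
apply: mk_fits => //=.
- by move=> _; have [_] := its_ok_nth sok i0n; exact.
- by move=> _; split=> //; rewrite /ntail /= (all_items_size sE).
- by rewrite addn1 prednK.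
- by rewrite perm_sym (perm_trans lamE)// perm_sym (all_items_ends sE false).
- by rewrite perm_sym (perm_trans muE)// perm_sym (all_items_ends sE true).
Qed.

Lemma loop_extrema_sizes B s b c i0 : loop_data its B s b ->
  size (maxs (ZData true s b c i0)) = B./2 /\ size (mins (ZData true s b c i0)) = B./2.
Proof.
move=> [_ ob Wn BE]; pose D := ZData true s b c i0.
have {}BE : count (bend D) (iota 0 (ntail D)) = B by exact: BE.
have := max_min_bends (D := D) ob (ntail D); rewrite W0 [W D (ntail D)]Wn.
have := BE; rewrite (count_bend D) => E.
rewrite -!size_filter -/(maxs D) -/(mins D) => /eqP; rewrite eqn_add2r => /eqP h.
by rewrite -E h addnn doubleK.
Qed.

(** Rotating the loop preserves the number of bends, so a nonbend survives when the cut is moved to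
    a bend. *)
Lemma loop_nonbend B s b : 0 < B -> f ++ f' != [::] -> loop_data its B s b ->
  ~~ all (bend (ZData true s b 0 0)) (iota 0 (size s)) ->
  at_least g lam mu P (fun=> True) ((size f)`! * (size f')`! * ((B./2)`!) ^ 2).
Proof.
move=> B0 ff L; have [sE _ _ BE] := L.
rewrite all_count BE size_iota => Bn.
have [s' [b' [L' b0]]] := loop_cut_bend B0 L.
have [s'E _ _ BE'] := L'.
have [i0 i0n i0f] : exists2 i, i < size s' & it_fork (nth item0 s' i).
  have [fE|fE] := eqVneq f [::].
    have fE' : f' != [::] by move: ff; rewrite fE.
    by have [i ilt [h _]] := all_items_fork_index (side := true) s'E fE'; exists i.
  by have [i ilt [h _]] := all_items_fork_index (side := false) s'E fE; exists i.
pose D := ZData true s' b' g.-1 i0; have fitD : fits g lam mu P D := loop_fits L' i0n i0f.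
have : ~~ all (bend D) (iota 0 (size s')).
  by rewrite all_count BE' size_iota (all_items_size s'E) -(all_items_size sE).
rewrite -has_predC => /hasP[i]; rewrite mem_iota /= => ilt nb.
have := @zone_nonbend R g lam mu P D fitD (fun=> True) i.
rewrite !(all_items_forks s'E); have [-> ->] := loop_extrema_sizes g.-1 i0 L' => H.
apply: at_least_le (H _ _ _ _) => //.
by apply: eq_leq; rewrite expnS expn1 -!mulnA; congr (_ * _); rewrite mulnC -mulnA.
Qed.

Lemma loop_max_data B : B = max_sign_changes 1 (dbl (l ++ f)) (dbl (l' ++ f')) ->
  0 < sumn l + sumn f ->
  exists2 s, loop_data its B s 1 & 0 < B.
Proof.
move=> BE sg; have [s sA sB] := max_sign_changes_attained (k := 1) isT
  (all_items_steps (perm_refl its) (perm_refl _) (perm_refl _)).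
exists s; first split=> //.
- rewrite W_total /= (all_items_sum sA); move: sums; clear; lia.
- by rewrite sB BE.
(* A test ordering with one bend at least: with the right tails in front, the first step leads from
   1 to a negative number. *)
pose s0 := tail_items true l' f' ++ tail_items false l f.
have s0P : perm_eq s0 its by rewrite /its /all_items perm_catC.
have := max_sign_changes_ge true 0 0 (k := 1) isT
  (all_items_steps (perm_refl its) (perm_refl _) (perm_refl _)) s0P.
rewrite -BE; apply: leq_trans; rewrite -has_count; apply/hasP.
have sz0 : 0 < size (tail_items true l' f').
  rewrite size_cat !size_map; move: sums sg; clear.
  by case: l' => [|? ?]; case: f' => [|? ?] /=; lia.
exists 0; first by rewrite mem_iota add0n /s0 size_cat (ltn_addr _ sz0).
rewrite bendE// W0 WS; last by rewrite /ntail /= size_cat ltn_addr.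
rewrite /= W0 /s0 nth_cat sz0.
have : nth item0 (tail_items true l' f') 0 \in tail_items true l' f' by exact: mem_nth.
have p x : x \in l' ++ f' -> 0 < x.
  move=> xl; rewrite lt0n; apply: contraNneq pos => <-; move: xl; rewrite !mem_cat.
  by case/orP=> ->; rewrite !orbT.
rewrite mem_cat => /orP[] /mapP[a al ->]; rewrite /it_step /it_right /it_half /= mul1r;
  have := p a; rewrite mem_cat al ?orbT => /(_ isT); clear; lia.
Qed.
End Loops.

(** * Orders with left forks among the minima *)

Section Place.
Variables (T : eqType) (s : seq T).
Implicit Types (p q : 'S_(size s)) (u v w : T).

Definition place p v : nat := papp p (index v s).

Lemma place_lt p v : v \in s -> place p v < size s.
Proof. by move=> vs; rewrite papp_lt ?index_mem. Qed.

Lemma place_inj p u v : u \in s -> v \in s -> place p u = place p v -> u = v.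
Proof.
move=> us vs /papp_inj E; rewrite -(nth_index u us) -(nth_index u vs).
by rewrite E ?index_mem.
Qed.

Lemma place_order p q : uniq s ->
  (forall u v, u \in s -> v \in s -> (place p u < place p v) = (place q u < place q v)) ->
  p = q.
Proof.
move=> us H; apply: papp_order => a b am bm.
have [x0 _] : exists x0 : T, true by case: (s) am => // x t; exists x.
have := H _ _ (mem_nth x0 am) (mem_nth x0 bm).
by rewrite /place !index_uniq.
Qed.

Section Pswap.
Variables (u v : T) (us : u \in s) (vs : v \in s).
Definition pswap : 'S_(size s) :=
  tperm (Ordinal (etrans (index_mem u s) us)) (Ordinal (etrans (index_mem v s) vs)).

Lemma place_swap p w : w \in s ->
  place (pswap * p)%g w = place p (if w == u then v else if w == v then u else w).
Proof.
move=> ws; have ix z : z \in s -> (index w s == index z s) = (w == z).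
  move=> zs; apply/eqP/eqP => [E|->//].
  by rewrite -(nth_index w ws) E nth_index.
rewrite /place papp_tperm ?index_mem// !ix//.
by case: eqP => // _; case: eqP.
Qed.
End Pswap.

(* Each pair involves entries of its own, so each order halves the count. *)
Lemma card_ordered_pairs (fs : seq (T * T)) :
  {in fs, forall x, x.1 \in s /\ x.2 \in s} -> uniq (map fst fs ++ map snd fs) ->
  (size s)`! <= 2 ^ size fs * #|[pred p | all (fun x => place p x.1 < place p x.2) fs]|.
Proof.
elim: fs => [|[F A] fs IH] fss ufs.
  by rewrite mul1n -[X in X <= _]card_Sn; apply: subset_leq_card; apply/fintype.subsetP.
have [Fs As] := fss _ (mem_head _ _).
have fss' : {in fs, forall x, x.1 \in s /\ x.2 \in s}.
  by move=> x xfs; apply: fss; rewrite inE xfs orbT.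
have : uniq (F :: A :: map fst fs ++ map snd fs).
  rewrite -(perm_uniq (s1 := map fst ((F, A) :: fs) ++ map snd ((F, A) :: fs)))//=.
  by rewrite perm_cons (perm_catCA (map fst fs) [:: A] (map snd fs)).
rewrite /= !inE !mem_cat !negb_or => /and3P[/and3P[FA F1 F2] /andP[A1 A2] ufs'].
have {}IH := IH fss' ufs'; apply: leq_trans IH _.
rewrite expnSr -mulnA leq_mul2l; apply/orP; right.
apply: leq_trans (card_half_in
  (S := fun p => place p F < place p A) (h := fun p => (pswap Fs As * p)%g) _ _) _.
- by move=> p q /mulgI.
- move=> p /allP pfs; rewrite -leqNgt leq_eqVlt => /orP[/eqP/place_inj E|lt].
    by rewrite (E As Fs) eqxx in FA.
  rewrite !place_swap// eqxx eq_sym (negPf FA) eqxx lt andbT.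
  apply/allP => x xfs; have [x1 x2] := fss' _ xfs; rewrite !place_swap//.
  have h1 := map_f fst xfs; have h2 := map_f snd xfs.
  have neq (a b : T) (l : seq T) : a \in l -> b \notin l -> (a == b) = false.
    by move=> al bl; apply/eqP => ab; rewrite -ab al in bl.
  by rewrite !(neq _ _ _ h1) ?(neq _ _ _ h2)//; exact: pfs.
- rewrite leq_mul2l; apply: subset_leq_card; apply/fintype.subsetP => p.
  by rewrite !inE /= andbC.
Qed.
End Place.

Lemma mixed_radix_lt K a b x y : x < K -> a < b -> K * a + x < K * b + y.
Proof.
move=> xK ab; have : K * a.+1 <= K * b by rewrite leq_mul2l ab orbT.
by rewrite mulnS; lia.
Qed.

Lemma mixed_radix_inj K a b x y : x < K -> y < K -> K * a + x = K * b + y -> a = b /\ x = y.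
Proof.
move=> xK yK E; case: (ltngtP a b) => ab.
- by have := mixed_radix_lt y xK ab; rewrite E ltnn.
- by have := mixed_radix_lt x yK ab; rewrite E ltnn.
- by move: E; rewrite ab => /addnI.
Qed.

Section FenceKey.
Variable D : zdata.
Local Notation n := (ntail D).
Local Notation c := (ncyc D).
Local Notation i0 := (cyci D).
Local Notation vs := (vs D).
Local Notation es := (es D).
Local Notation rbd := (rbd D).

Definition side_vs (side : bool) : seq rvert :=
  map VT (fork_side D side) ++ map VS (if side then rights D else lefts D).
Local Notation low := (side_vs false).
Local Notation high := (side_vs true).

Definition fence_perms : finType :=
  ('S_(size low) * 'S_(size (rights D)) * 'S_(size (fork_side D true)))%type.
Implicit Types th : fence_perms.

(* The factor [2 * c + 1] leaves room for the cycles right above their fork. *)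
Local Notation K := (2 * c).+1.

Definition hplace th (v : rvert) : nat :=
  match v with
  | VS i => place th.1.2 i
  | VT i => size (rights D) + place th.2 i
  | _ => 0
  end.

(** In the lower half forks and string vertices share one permutation; above, the string vertices
    precede the forks and each kind has its own. *)
Definition fence_key th (v : rvert) : nat :=
  match v with
  | VC t b => K * place th.1.1 (VT i0) + (2 * (c - 1 - t) + ~~ b).+1
  | _ => if v \in low then K * place th.1.1 v + 0 else K * (size low + hplace th v) + 0
  end.

Definition fork_pairs : seq (rvert * rvert) := [seq (VT i, VS i) | i <- fork_side D false].

Definition ordered (s : seq rvert) (p : 'S_(size s)) : pred (rvert * rvert) :=
  fun x => place p x.1 < place p x.2.

(** A left tail descends from the string, so its fork has to come below its own string vertex. *)
Definition forks_ok th : bool := all (ordered th.1.1) fork_pairs.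

Local Notation zone := (zone D (lefts D) (rights D)).
Hypothesis wfD : wf_data D.
Hypothesis i0l : i0 \in fork_side D false.

Lemma mem_side_vs side v : (v \in side_vs side) =
  match v with
  | VS i => (i < n) && (right D i == side)
  | VT i => [&& i < n, fk D i & right D i == side]
  | _ => false
  end.
Proof.
have nm (f : nat -> rvert) s : (forall i, v <> f i) -> (v \in map f s) = false.
  by move=> H; apply/mapP => -[i _ /H].
have VSi : injective VS by move=> ? ? [].
have VTi : injective VT by move=> ? ? [].
rewrite mem_cat; case: v nm => [i|t b|i|b|i b] nm.
- rewrite (nm VT)//= (mem_map VSi).
  by case: side; rewrite ?mem_rights ?mem_lefts ?eqb_id ?eqbF_neg.
- by rewrite !nm.
- by rewrite (nm VS)// (mem_map VTi) mem_fork_side orbF.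
- by rewrite !nm.
- by rewrite !nm.
Qed.

Lemma side_vs_uniq side : uniq (side_vs side).
Proof.
rewrite cat_uniq !map_inj_uniq => [|? ? []|? ? []] //.
rewrite fork_side_uniq /= (_ : uniq _ = true); last by case: side; rewrite ?rights_uniq ?lefts_uniq.
by rewrite andbT; apply/hasPn => _ /mapP[i _ ->]; apply/mapP => -[].
Qed.

Let i0_low : VT i0 \in low.
Proof. by move: i0l; rewrite mem_side_vs mem_fork_side. Qed.
Let i0_left : right D i0 = false.
Proof. by move: i0l; rewrite mem_fork_side => /and3P[_ _ /eqP]. Qed.

(* Where the lexicographic key of a vertex puts it, and how far above. *)
Let slot th v : nat :=
  match v with
  | VC t b => place th.1.1 (VT i0)
  | _ => if v \in low then place th.1.1 v else size low + hplace th v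
  end.
Let off v : nat := if v is VC t b then (2 * (c - 1 - t) + ~~ b).+1 else 0.

Let keyE th v : fence_key th v = K * slot th v + off v.
Proof. by case: v => *; rewrite /fence_key /slot /off; do ?case: ifP. Qed.

Let off_lt v : v \in vs -> off v < K.
Proof. by rewrite mem_vs; case: v => //= t b; case: b; lia. Qed.

Let inner_cases v : v \in vs -> inner D v ->
  [\/ exists t b, v = VC t b /\ t < c,
      v \in low /\ zone v <= 2 |
      [/\ v \in high, v \notin low & 2 < zone v]].
Proof.
rewrite mem_vs !mem_side_vs; case: v => [i|t b|i|b|i b] //=.
- by move=> ilt _; rewrite mem_lefts mem_rights ilt /=; case: (right D i);
  [constructor 3|constructor 2].
- by move=> tc _; constructor 1; exists t, b.
- by move=> -> ->; case: (right D i); [constructor 3|constructor 2].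
Qed.

Let slot_low th v : v \in vs -> inner D v -> (slot th v < size low) = (zone v <= 2).
Proof.
move=> vV iv; have [[t [b [vE tc]]]|[vl zv]|[vh vl zv]] := inner_cases vV iv.
- by rewrite /slot vE /= i0_left; exact: place_lt i0_low.
- rewrite zv /slot vl; have := place_lt th.1.1 vl; have := place_lt th.1.1 i0_low.
  by case: (v) => * /=.
- rewrite (leqNgt (zone v)) zv /slot (negPf vl).
  by case: (v) vh => [i|t b|i|b|i b] //; rewrite ?mem_side_vs// => _; rewrite ltnNge leq_addr.
Qed.

Lemma fence_key_zone th u w : u \in vs -> w \in vs -> inner D u -> inner D w ->
  zone u <= 2 -> 2 < zone w -> fence_key th u < fence_key th w.
Proof.
move=> uV wV iu iw zu zw; rewrite !keyE; apply: mixed_radix_lt; first exact: off_lt.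
by apply: (@leq_trans (size low)); rewrite ?slot_low// leqNgt slot_low// -ltnNge.
Qed.

Let hplace_inj th u v : u \in high -> v \in high -> hplace th u = hplace th v -> u = v.
Proof.
have inR i : (i < n) && (right D i == true) -> i \in rights D.
  by rewrite mem_rights eqb_id.
rewrite !mem_side_vs; case: u => [i|t b|i|b|i b] //; case: v => [j|t' b'|j|b'|j b'] //= ui vj.
- by move=> /place_inj ->//; exact: inR.
- by move=> E; have := place_lt th.1.2 (inR _ ui); rewrite E ltnNge leq_addr.
- by move=> E; have := place_lt th.1.2 (inR _ vj); rewrite -E ltnNge leq_addr.
- by move=> /addnI/place_inj ->//; rewrite mem_fork_side.
Qed.

Let slot_inj th u v : u \in vs -> v \in vs -> inner D u -> inner D v ->
  slot th u = slot th v -> off u = off v -> u = v.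
Proof.
move=> uV vV iu iv sE oE.
have zz : (zone u <= 2) = (zone v <= 2) by rewrite -!(slot_low th)// sE.
have zC t b : zone (VC t b) <= 2 by rewrite /= i0_left.
have [[t [b [uE tc]]]|[ul zu]|[uh ul zu]] := inner_cases uV iu;
have [[t' [b' [vE tc']]]|[vl zv]|[vh vl zv]] := inner_cases vV iv.
- rewrite uE vE /= in oE *; have [-> ->] : t = t' /\ b = b' by case: b b' oE {uE vE} => [] []; lia.
  by [].
- by move: oE vl; rewrite uE mem_side_vs /off; case: (v).
- by move: zz zv; rewrite uE zC ltnNge => <-.
- by move: oE ul; rewrite vE mem_side_vs /off; case: (u).
- apply: (place_inj (p := th.1.1) ul vl); move: sE; rewrite /slot ul vl.
  by move: ul vl; rewrite !mem_side_vs; case: (u) => [?|? ?|?|?|? ?] //; case: (v).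
- by move: zv; rewrite ltnNge -zz zu.
- by move: zz zu; rewrite vE zC ltnNge => ->.
- by move: zu; rewrite ltnNge zz zv.
- apply: (hplace_inj (th := th) uh vh); move: sE; rewrite /slot (negPf ul) (negPf vl).
  by move: uh vh; rewrite !mem_side_vs; case: (u) => [?|? ?|?|?|? ?] //;
    case: (v) => [?|? ?|?|?|? ?] // _ _ /addnI.
Qed.

Lemma fence_key_inj th : {in [pred v | (v \in vs) && inner D v] &, injective (fence_key th)}.
Proof.
move=> u v; rewrite !inE => /andP[uV iu] /andP[vV iv]; rewrite !keyE.
by case/mixed_radix_inj; rewrite ?off_lt// => sE oE; exact: (slot_inj uV vV iu iv sE oE).
Qed.

Lemma fence_key_low th v : v \in low -> fence_key th v = K * place th.1.1 v + 0.
Proof. by move=> vl; rewrite /fence_key vl; move: vl; rewrite mem_side_vs; case: v. Qed.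

Lemma fence_key_high th v : v \in high -> fence_key th v = K * (size low + hplace th v) + 0.
Proof.
move=> vh; have vl : (v \in low) = false.
  by move: vh; rewrite !mem_side_vs; case: (v) => [i|t b|i|b|i b] //=; case: right; rewrite ?andbF.
by rewrite /fence_key vl; move: vh; rewrite mem_side_vs; case: (v).
Qed.

Lemma fence_key_lt_low th u v : u \in low -> v \in low ->
  (fence_key th u < fence_key th v) = (place th.1.1 u < place th.1.1 v).
Proof. by move=> ul vl; rewrite !fence_key_low// !addn0 ltn_mul2l. Qed.

Lemma fence_key_lt_high th u v : u \in high -> v \in high ->
  (fence_key th u < fence_key th v) = (hplace th u < hplace th v).
Proof. by move=> ul vl; rewrite !fence_key_high// !addn0 ltn_mul2l ltn_add2l. Qed.

Lemma fork_pair_lt th i : forks_ok th -> i < n -> fk D i ->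
  if right D i then fence_key th (VS i) < fence_key th (VT i) else fence_key th (VT i) <
    fence_key th (VS i).
Proof.
move=> /allP oL ilt fi.
have inS : VS i \in side_vs (right D i) by rewrite mem_side_vs ilt eqxx.
have inT : VT i \in side_vs (right D i) by rewrite mem_side_vs ilt fi eqxx.
have inF : i \in fork_side D (right D i) by rewrite mem_fork_side ilt fi eqxx.
case ri : (right D i) inS inT inF => inS inT inF.
  rewrite fence_key_lt_high//= ltn_addr// place_lt// mem_rights ilt ri//.
rewrite fence_key_lt_low//; apply: (oL (VT i, VS i)).
exact: (map_f (fun i => (VT i, VS i)) inF).
Qed.

Lemma fence_key_valid th : looped D -> forks_ok th ->
  (forall j i, j < n -> rbd (ES j) false = VS i ->
     if (0 < W D j)%R then fence_key th (VS i) < fence_key th (VS j)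
     else fence_key th (VS j) < fence_key th (VS i)) ->
  valid_key D (fence_key th).
Proof.
move=> lp fok sv; split; first exact: fence_key_inj.
move=> e; rewrite mem_es; case: e => [j|t|t b|i|i b] //.
- rewrite /= lp addn0 => jlt; rewrite ltn_eqF//.
  by case: j jlt => [|j] jlt _ _; [apply: (sv 0)|apply: (sv j.+1)]; rewrite //= ?lp.
- move=> /= tc; rewrite i0_left => _ _; case: t tc => [|t] tc;
  last by rewrite /fence_key ltn_add2l; lia.
  have il : i0 < n := wf_i0 wfD.
  have Sl : VS i0 \in low by rewrite mem_side_vs il i0_left.
  have fi : fk D i0 by move: i0l; rewrite mem_fork_side => /and3P[].
  have := fork_pair_lt fok il fi; rewrite i0_left fence_key_lt_low// => H.
  (* The cycles stay below [VS i0]: it has a later place than the fork, and their offset is less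
     than the radix. *)
  by rewrite (fence_key_low _ Sl); apply: mixed_radix_lt => //; move: tc; clear; lia.
- by move=> /= tc; rewrite i0_left /fence_key ltn_add2l => _ _; lia.
- move=> ilt _ fi; rewrite [rbd (ET i) true]/= [rbd (ET i) false]/=.
  case E: ((i == i0) && (0 < c)); last exact: fork_pair_lt.
  move: E => /andP[/eqP ii c0].
  by rewrite ii /rdir i0_left fence_key_low// /fence_key ltn_add2l.
Qed.

Lemma fence_key_rank_inj th th' :
  (forall v, v \in vs -> inner D v -> rank D (fence_key th) v = rank D (fence_key th') v) ->
  th = th'.
Proof.
move=> H; have vsI side v : v \in side_vs side -> v \in vs /\ inner D v.
  by rewrite mem_side_vs mem_vs; case: v => //= i => [/andP[->]|/and3P[-> ->]].
have ord u v : u \in vs -> inner D u -> v \in vs -> inner D v ->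
    (fence_key th u < fence_key th v) = (fence_key th' u < fence_key th' v).
  move=> uV iu vV iv; rewrite -(rank_ltE (fence_key th) v uV iu).
  by rewrite -(rank_ltE (fence_key th') v uV iu) !H.
have e1 : th.1.1 = th'.1.1.
  apply: (place_order (side_vs_uniq _)) => u v us vs'.
  by rewrite -!fence_key_lt_low// ord//; case: (vsI _ _ us); case: (vsI _ _ vs').
have e2 : th.1.2 = th'.1.2.
  apply: (place_order (rights_uniq _)) => i j; rewrite !mem_rights => /andP[ilt ri] /andP[jlt rj].
  have iV : VS i \in high by rewrite mem_side_vs ilt ri.
  have jV : VS j \in high by rewrite mem_side_vs jlt rj.
  have := ord (VS i) (VS j); rewrite !mem_vs !fence_key_lt_high// => H'.
  exact: H'.
have e3 : th.2 = th'.2.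
  apply: (place_order (fork_side_uniq _ _)) => i j; rewrite !mem_fork_side.
  move=> /and3P[ilt fi /eqP ri] /and3P[jlt fj /eqP rj].
  have iV : VT i \in high by rewrite mem_side_vs ilt fi ri.
  have jV : VT j \in high by rewrite mem_side_vs jlt fj rj.
  have := ord (VT i) (VT j); rewrite !mem_vs !fence_key_lt_high//= !ltn_add2l => H'.
  exact: H'.
by case: th e1 e2 e3 {H ord} => [[? ?] ?]; case: th' => [[? ?] ?] /= -> -> ->.
Qed.

Lemma card_forks_ok :
  (size low)`! * (size (rights D))`! * (size (fork_side D true))`! <=
  2 ^ size (fork_side D false) * #|forks_ok|.
Proof.
have main : (size low)`! <= 2 ^ size (fork_side D false) *
    #|[pred p : 'S_(size low) | all (ordered p) fork_pairs]|.
  rewrite -(size_map (fun i => (VT i, VS i)) (fork_side D false)).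
  apply: card_ordered_pairs.
    move=> x /mapP[i]; rewrite mem_fork_side => /and3P[ilt fi /eqP ri] ->.
    by rewrite !mem_side_vs /= ilt fi ri.
  have uF : uniq (map VT (fork_side D false)).
    by rewrite map_inj_uniq ?fork_side_uniq// => ? ? [].
  have uA : uniq (map VS (fork_side D false)).
    by rewrite map_inj_uniq ?fork_side_uniq// => ? ? [].
  rewrite -!map_comp cat_uniq uF uA andbT /=.
  by apply/hasPn => x /mapP[i _ xE]; apply/mapP => -[j _]; rewrite xE.
have -> : #|forks_ok| = #|[pred p : 'S_(size low) | all (ordered p) fork_pairs]| *
    (size (rights D))`! * (size (fork_side D true))`!.
  rewrite -(card_Sn (size (rights D))) -(card_Sn (size (fork_side D true))) -!cardX.
  by apply: eq_card => -[[p q] q']; rewrite !inE /= !andbT.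
by rewrite !mulnA !leq_mul.
Qed.
End FenceKey.

(** * Loops all of whose vertices are bends *)

Section LowEdge.
Variables (R : realType) (P : seq R).

(* Some string edge joins two of the [t] lowest inner vertices. *)
Definition low_edge (t : nat) (C : pl_map R) : Prop :=
  exists i j w, [/\ i < t, j < t, odd w &
    edge_count C (nth 0%R (sort <=%R P) i)%:E (nth 0%R (sort <=%R P) j)%:E w = 1].

(* Some end over [-oo] belongs to the string. *)
Definition string_end (C : pl_map R) : Prop :=
  exists p w, odd w /\ edge_count C -oo%E p w = 1.

Variables (D : zdata) (key : rvert -> nat).
Local Notation n := (ntail D).
Hypotheses (wfD : wf_data D) (sizeP : size P = size (inner_vs D)) (uniqP : uniq P).
Hypotheses (lpD : looped D) (vk : valid_key D key).

Lemma rphi_rank v i : v \in vs D -> inner D v -> i < size P ->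
  rphi P D key v = (nth 0%R (sort <=%R P) i)%:E -> rank D key v = i.
Proof.
move=> vV iv iP; rewrite /rphi iv => -[] /eqP.
have rP : rank D key v < size (sort <=%R P) by rewrite size_sort; exact: (rank_max key sizeP vV iv).
by rewrite nth_uniq ?sort_uniq// ?size_sort// => /eqP.
Qed.

Lemma loop_rbd j b : j < n -> exists2 i, i < n & rbd D (ES j) b = VS i.
Proof.
move=> jlt; have n0 := wf_n wfD; case: b => /=; first by exists j; rewrite ?ltn_eqF.
by case: j jlt => [|j] jlt; [exists n.-1; rewrite ?lpD ?prednK|exists j => //; exact: ltnW].
Qed.

Lemma loop_string_end : ~ string_end (cov P D key).
Proof.
move=> [p [w [ow /(edge_count1_string wfD ow)[j jE [_ [s sE]]]]]].
have jlt : j < n by move: jE; rewrite mem_es /= lpD addn0.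
by have [i _ iE] := loop_rbd s jlt; have := sE s; rewrite iE addbb.
Qed.

Lemma low_edge_ends t : t <= size P -> low_edge t (cov P D key) ->
  exists2 j, j < n & forall b, rank D key (rbd D (ES j) b) < t.
Proof.
move=> tP [i [i' [w [it it' ow /(edge_count1_string wfD ow)[j jE [_ [s sE]]]]]]].
have jlt : j < n by move: jE; rewrite mem_es /= lpD addn0.
exists j => // b; have [k klt kE] := loop_rbd b jlt; rewrite kE.
have kV : VS k \in vs D by rewrite mem_vs.
have := sE b; rewrite kE; case: (s (+) b) => h.
  by rewrite (rphi_rank kV isT (leq_trans it' tP) h).
by rewrite (rphi_rank kV isT (leq_trans it tP) h).
Qed.

Lemma low_edge_first t : (forall b, rank D key (rbd D (ES 0) b) < t) ->
  low_edge t (cov P D key).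
Proof.
move=> H; have E0 : ES 0 \in es D by rewrite mem_es /= lpD addn0 (wf_n wfD).
exists (rank D key (rbd D (ES 0) false)), (rank D key (rbd D (ES 0) true)), `|W D 0|.
split=> //; first exact: odd_W (wf_base wfD).
have := edge_count_string wfD vk sizeP uniqP E0.
have [i _ iE] := loop_rbd false (wf_n wfD); have [j _ jE] := loop_rbd true (wf_n wfD).
by rewrite iE jE.
Qed.
End LowEdge.

Section LoopFamilies.
Variables (R : realType) (g : nat) (lam mu : seq nat) (P : seq R) (D : zdata).
Hypothesis fitD : fits g lam mu P D.
Local Notation n := (ntail D).
Local Notation i0 := (cyci D).
Hypothesis lpD : looped D.
Hypothesis i0l : i0 \in fork_side D false.
Local Notation low := (side_vs D false).
Definition threshold : nat := lower_size D (lefts D) (rights D).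

Let wfD := fit_wf fitD.
Let sizeP := fit_P fitD.
Let uniqP := fit_uniq fitD.
Let n2 : 2 < n. Proof. by have [] := wf_loop wfD lpD. Qed.

Let zVS i : i < n -> (zone D (lefts D) (rights D) (VS i) <= 2) = ~~ right D i.
Proof. by move=> ilt; rewrite /= mem_lefts mem_rights ilt; case: (right D i). Qed.

Let fence_key_side (th : fence_perms D) i j : i < n -> j < n -> ~~ right D i -> right D j ->
  fence_key th (VS i) < fence_key th (VS j).
Proof.
move=> ilt jlt ri rj; apply: (fence_key_zone i0l); rewrite ?mem_vs//.
  by rewrite zVS.
by rewrite ltnNge zVS// rj.
Qed.

Let thresholdP : threshold <= size P.
Proof.
rewrite sizeP /threshold /lower_size /inner_vs size_filter.
by apply: sub_count => u /andP[].
Qed.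

Let rank_threshold (th : fence_perms D) i : i < n ->
  (rank D (fence_key th) (VS i) < threshold) = ~~ right D i.
Proof.
move=> ilt; rewrite -zVS//; apply: rank_initial; rewrite ?mem_vs//.
by move=> u w uV wV iu iw; exact: (fence_key_zone i0l).
Qed.

Let rank_ends (th th' : fence_perms D) u v : u \in vs D -> v \in vs D -> inner D u -> inner D v ->
  rphi P D (fence_key th) u = rphi P D (fence_key th') v ->
    rank D (fence_key th) u = rank D (fence_key th') v.
Proof.
move=> uV vV iu iv E; apply: (@rphi_rank R P D (fence_key th) sizeP uniqP) => //.
  exact: (rank_max _ sizeP).
by rewrite E /rphi iv.
Qed.

(* Each string edge joins a vertex with a left tail to one with a right tail. *)
Section Alternating.
Hypothesis alt : forall j i, j < n -> rbd D (ES j) false = VS i ->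
  right D i = ~~ right D j /\ (0 < W D j)%R = right D j.
Local Notation T := {th : fence_perms D | forks_ok th}.

Let altkey_valid (th : T) : valid_key D (fence_key (val th)).
Proof.
apply: (fence_key_valid wfD i0l lpD (valP th)) => j i jlt iE; have [ri ->] := alt jlt iE.
have ilt : i < n by have [k klt] := loop_rbd wfD lpD false jlt; rewrite iE => -[->].
by case rj : (right D j) ri => /= ri; apply: fence_key_side; rewrite ?ri ?rj.
Qed.

Let alt_not_low (th : T) : ~ low_edge P threshold (cov P D (fence_key (val th))).
Proof.
move=> /(low_edge_ends wfD sizeP uniqP lpD thresholdP)[j jlt H].
have [i ilt iE] := loop_rbd wfD lpD false jlt; have [ri _] := alt jlt iE.
have := H false; have := H true; rewrite iE /= ltn_eqF// !rank_threshold//.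
by rewrite ri => ->.
Qed.

(* An isomorphism can only move the vertex [VS i0] to another fork. *)
Let anchor_fork (x y : T) i : i < n ->
  edge_count (cov P D (fence_key (val y))) = edge_count (cov P D (fence_key (val x))) ->
  rphi P D (fence_key (val y)) (VS i0) = rphi P D (fence_key (val x)) (VS i) -> fk D i.
Proof.
move=> ilt E yx; have [->|ii] := eqVneq i i0.
  by move: i0l; rewrite mem_fork_side => /and3P[].
have i0n := wf_i0 wfD.
have fi0 : fk D i0 by move: i0l; rewrite mem_fork_side => /and3P[].
(* The first edge of this tail is even and both its ends are inner. Its counterpart at [VS i] is the
   first edge of tail [i], which for [i] other than [i0] ends in an inner vertex only if the tail
   has a fork. *)
have eE : tl1 D i0 \in es D by rewrite mem_es /tl1; case: ifP => [/andP[_ h]|_].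
have uI : inner D (rbd D (tl1 D i0) true) by rewrite /tl1; case: ifP.
have e0 : rbd D (tl1 D i0) false = VS i0.
  by rewrite /tl1; case: ifP => [_ //|/= ->].
have [f fE [wE [s sE]]] := edge_match wfD wfD E eE.
have Vi : VS i \in vs D by rewrite mem_vs.
have fi : rbd D f s = VS i.
  apply: (rphi_inj (altkey_valid x) sizeP uniqP); rewrite ?rbd_vs//.
    by move: Vi => _; have := sE s; rewrite addbb e0 yx /rphi; case: (inner D _) => //; case: ifP.
  by rewrite sE addbb e0 yx.
have even1 : ~~ odd (rwt D (tl1 D i0)) by rewrite /tl1; case: ifP => _ /=; rewrite oddM.
have := mem_halves wfD (f, s) Vi; rewrite fE fi eqxx /= !inE => /or3P[]/eqP[fj sj].
- by move: even1; rewrite -wE fj /= (odd_W _ (wf_base wfD)).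
- by move: even1; rewrite -wE fj /= (odd_W _ (wf_base wfD)).
have := sE true; rewrite sj /= fj /tl1 (negPf ii) /= => h.
by move: h; rewrite -/(tl1 D i0) /rphi uI /=; case: (fk D i) => //; case: ifP.
Qed.

(** A member of a fibre is determined by the places of the two ends of one string edge at [VS i0].
    The vertex goes to the place of a left fork vertex and the edge to one of the two string edges
    there, whence the factor. *)
Lemma alt_at_least : exists2 M, #|forks_ok (D := D)| <= 2 * size (fork_side D false) * M &
  at_least g lam mu P (fun C => ~ low_edge P threshold C /\ ~ string_end C) M.
Proof.
have -> : #|forks_ok (D := D)| = #|[the finType of T]| by rewrite card_sig.
apply: (@at_least_fibers _ _ _ _ _ _ _ (fun th : T => cov P D (fence_key (val th)))).
  move=> th; split; last by split; [exact: alt_not_low|exact: loop_string_end].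
  by apply: (fits_cover fitD); exact: altkey_valid.
move=> x; set A := [pred y | _]; pose e := sout D i0.
have i0n := wf_i0 wfD; have Vi0 : VS i0 \in vs D by rewrite mem_vs.
have elt : e < n by have := sout_es i0n; rewrite mem_es /= lpD addn0.
have ef : rbd D (ES e) false = VS i0.
  have := mem_halves wfD (ES e, false) Vi0.
  by rewrite /= !inE eqxx orbT => /esym/andP[_ /eqP].
have eE : ES e \in es D by exact: sout_es.
pose rx v := rphi P D (fence_key (val x)) v.
pose h (y : T) := (rphi P D (fence_key (val y)) (VS i0),
  rphi P D (fence_key (val y)) (rbd D (ES e) true)).
pose L := [seq (rx (VS i), rx (rbd D (ES i) false)) | i <- fork_side D false] ++
  [seq (rx (VS i), rx (rbd D (ES (sout D i)) true)) | i <- fork_side D false].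
have hinj : {in A &, injective h}.
  move=> y1 y2; rewrite !inE => /asboolP E1 /asboolP E2 h12.
  apply/val_inj/fence_key_rank_inj => v vV iv.
  apply: (agree_rank wfD (altkey_valid y1) (altkey_valid y2) sizeP uniqP _ eE _ vV iv).
    by rewrite E1.
  by move=> [|]; rewrite ?ef; [exact: (congr1 snd h12)|exact: (congr1 fst h12)].
rewrite cardE -(size_map h); apply: (@leq_trans (size L)); last first.
  by rewrite size_cat !size_map mul2n addnn.
apply: uniq_leq_size.
  rewrite map_inj_in_uniq ?enum_uniq// => y1 y2; rewrite !mem_enum; exact: hinj.
move=> _ /mapP[y + ->]; rewrite mem_enum inE => /asboolP E.
have [k kE [_ [s sE]]] := string_edge_match wfD wfD (altkey_valid y) sizeP uniqP E eE.
have klt : k < n by move: kE; rewrite mem_es /= lpD addn0.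
have [i ilt iE] := loop_rbd wfD lpD s klt.
have yx : rphi P D (fence_key (val y)) (VS i0) = rx (VS i) by rewrite /rx -iE sE addbb ef.
have fi := anchor_fork ilt E yx.
have ri : right D i = false.
  apply/negbTE; rewrite -(rank_threshold (val x))//.
  have Vi : VS i \in vs D by rewrite mem_vs.
  rewrite -(@rank_ends (val y) (val x) (VS i0) (VS i))//.
  rewrite rank_threshold//; by move: i0l; rewrite mem_fork_side => /and3P[_ _ /eqP->].
have ifl : i \in fork_side D false by rewrite mem_fork_side ilt fi ri.
have hE : h y = (rx (VS i), rx (rbd D (ES k) (~~ s))).
  by rewrite /h yx /rx sE addbN addbb.
rewrite hE mem_cat; have [[[->] ->]|[[->] ->]] := string_half (e :=
  ES k) wfD ilt (odd_W k (wf_base wfD)) kE iE.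
  by rewrite (map_f (fun i => (rx (VS i), rx (rbd D (ES i) false))) ifl).
by rewrite orbC (map_f (fun i => (rx (VS i), rx (rbd D (ES (sout D i)) true))) ifl).
Qed.
End Alternating.

(* The string goes up through two left and then two right tails, and alternates
   afterwards. *)
Section Chained.
Hypotheses (i00 : i0 = 0) (n4 : 3 < n) (r0 : right D 0 = false).
Hypotheses (r1 : right D 1) (r2 : right D 2) (rn : right D n.-1 = false).
Hypotheses (W0p : (0 < W D 0)%R) (W1p : (0 < W D 1)%R) (W2p : (0 < W D 2)%R).
Hypothesis alt : forall j, 2 < j < n -> right D j.-1 = ~~ right D j /\ (0 < W D j)%R = right D j.

(** The string rises along [ES 2] from [VS 1] to [VS 2], both above, and along [ES 0] from [VS n.-1]
    to [VS 0], both below. These edges stay within one half, so their direction has to be imposed on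
    the permutations. *)
Definition chain_ok : pred (fence_perms D) := fun th =>
  [&& forks_ok th, place th.1.2 1 < place th.1.2 2 & place th.1.1 (VS n.-1) < place th.1.1 (VS 0)].
Local Notation T := {th : fence_perms D | chain_ok th}.

Let lt_n1 : n.-1 < n. Proof. by rewrite prednK// (ltn_trans _ n2). Qed.
Let lt_0 : 0 < n. Proof. exact: ltn_trans n2. Qed.
Let R1 : 1 \in rights D. Proof. by rewrite mem_rights r1 (ltn_trans _ n2). Qed.
Let R2 : 2 \in rights D. Proof. by rewrite mem_rights r2 n2. Qed.
Let L0 : VS 0 \in low. Proof. by rewrite mem_side_vs lt_0 r0. Qed.
Let Ln : VS n.-1 \in low. Proof. by rewrite mem_side_vs lt_n1 rn. Qed.
Let f0 : fk D 0. Proof. by move: i0l; rewrite i00 mem_fork_side => /and3P[]. Qed.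
Let T0 : VT 0 \in low. Proof. by rewrite mem_side_vs lt_0 f0 r0. Qed.

Lemma card_chain_ok : #|forks_ok (D := D)| <= 4 * #|chain_ok|.
Proof.
have h1 := @card_half_in (fence_perms D) (@forks_ok D) (fun th => place th.1.2 1 < place th.1.2 2)
  (fun th => (th.1.1, (pswap R1 R2 * th.1.2)%g, th.2)).
apply: leq_trans (h1 _ _) _.
- by move=> [[? ?] ?] [[? ?] ?] /= [-> /mulgI -> ->].
- move=> th V; rewrite -leqNgt leq_eqVlt => /predU1P[/place_inj -/(_ R2 R1) //|lt].
  by apply/andP; split; [exact: V|rewrite /= !place_swap].
rewrite -[4]/(2 * 2) -mulnA leq_mul2l /=.
pose nT : bool := VT n.-1 \in low.
have n0 : n.-1 != 0 by rewrite -lt0n -ltnS prednK// (ltn_trans _ n2).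
pose sg k := if k == n.-1 then 0 else if k == 0 then n.-1 else k.
(* Exchanging two left string vertices has to preserve [forks_ok]: if tail [n.-1] has a fork too,
   the two forks are exchanged along with them. *)
have [t tS tT] : exists2 t : 'S_(size low),
    forall p k, VS k \in low -> place (t * p)%g (VS k) = place p (VS (sg k)) &
    forall p k, VT k \in low ->
      place (t * p)%g (VT k) = place p (VT (if nT then sg k else k)).
  have VSE i j : (VS i == VS j) = (i == j) by apply/eqP/eqP => [[]|->].
  have VTE i j : (VT i == VT j) = (i == j) by apply/eqP/eqP => [[]|->].
  have STE i j : (VS i == VT j) = false by apply/eqP.
  have TSE i j : (VT i == VS j) = false by apply/eqP.
  case: (boolP nT) => hT; [exists (pswap hT T0 * pswap Ln L0)%g|exists (pswap Ln L0)] => p k kl.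
  - by rewrite -mulgA place_swap// !STE place_swap// !VSE /sg; do ?case: ifP.
  - rewrite -mulgA place_swap// !VTE /sg.
    by case: ifP => _; [|case: ifP => _]; rewrite place_swap// !TSE.
  - by rewrite place_swap// !VSE /sg; do ?case: ifP.
  - by rewrite place_swap// !TSE.
have h2 := @card_half_in (fence_perms D) (fun th => forks_ok th &&
  (place th.1.2 1 < place th.1.2 2))
  (fun th => place th.1.1 (VS n.-1) < place th.1.1 (VS 0)) (fun th =>
    ((t * th.1.1)%g, th.1.2, th.2)).
apply: leq_trans (h2 _ _) _.
- by move=> [[? ?] ?] [[? ?] ?] /= [/mulgI -> -> ->].
- move=> [[p q] q'] /= /andP[/allP V ->]; rewrite -leqNgt leq_eqVlt.
  move=> /predU1P[/place_inj -/(_ L0 Ln) [E]|lt]; first by rewrite -E in n0.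
  have s0 : sg 0 = n.-1 by rewrite /sg eq_sym (negPf n0).
  have sn : sg n.-1 = 0 by rewrite /sg eqxx.
  rewrite andbT !tS// s0 sn lt andbT.
  have V' k : k \in fork_side D false -> place p (VT k) < place p (VS k).
    by move=> kf; apply: (V (VT k, VS k)); exact: (map_f (fun i => (VT i, VS i)) kf).
  have fl k : (k \in fork_side D false) = (VT k \in low) by rewrite mem_side_vs mem_fork_side.
  apply/allP => v /mapP[k kf ->]; rewrite /ordered /=.
  have kS : VS k \in low by move: kf; rewrite mem_fork_side mem_side_vs => /and3P[-> _ ->].
  rewrite tS// tT -?fl//; case hT : nT.
    apply: V'; rewrite fl /sg; case: ifP => // _; case: ifP => // _; by rewrite -fl.
  rewrite /sg; case: eqP => [kn|_]; first by move: hT; rewrite /nT -kn -fl kf.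
  case: eqP => [k0|_]; last exact: V'.
  (* Tail [n.-1] has no fork here: the fork of tail 0 stays in place while its string vertex moves
     up. *)
  by apply: ltn_trans lt; rewrite k0; apply: V'; rewrite fl.
rewrite leq_mul2l; apply: subset_leq_card; apply/fintype.subsetP => th.
by rewrite !inE /chain_ok -andbA.
Qed.

Let chain_rbd j i : j < n -> rbd D (ES j) false = VS i -> i = if j is j'.+1 then j' else n.-1.
Proof. by case: j => [|j] _ /=; rewrite ?lpD => -[]. Qed.

Let chain_valid (th : T) : valid_key D (fence_key (val th)).
Proof.
have /and3P[fo s12 sn0] := valP th.
apply: (fence_key_valid wfD i0l lpD fo) => j i jlt /chain_rbd -/(_ jlt) ->.
case: j jlt => [|[|[|j]]] jlt.
- by rewrite W0p fence_key_lt_low.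
- by rewrite W1p fence_key_side ?r0.
- rewrite W2p fence_key_lt_high//=.
    by rewrite mem_side_vs r1 (ltn_trans _ n2).
  by rewrite mem_side_vs r2 n2.
have [/= rj ->] := alt (j := j.+3) jlt.
by case rj' : (right D j.+3) rj => /= rj; apply: fence_key_side; rewrite ?rj ?rj' // ltnW.
Qed.

Let low_only_first (th : T) j : j < n ->
  (forall b, rank D (fence_key (val th)) (rbd D (ES j) b) < threshold) -> j = 0.
Proof.
move=> jlt H; have [i ilt iE] := loop_rbd wfD lpD false jlt.
have jE : rbd D (ES j) true = VS j by rewrite /= ltn_eqF.
have := H false; have := H true; rewrite iE jE !rank_threshold//.
rewrite (chain_rbd jlt iE); case: j jlt {H iE jE} => [|[|[|j]]] jlt //=; rewrite ?r1 ?r2//.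
by have [/= -> _] := alt (j := j.+3) jlt => ->.
Qed.

Let low_first (th : T) b : rank D (fence_key (val th)) (rbd D (ES 0) b) < threshold.
Proof. by case: b; rewrite /= ?lpD ?ltn_eqF// rank_threshold// ?r0 ?rn. Qed.

(** [ES 0] is the only string edge with both ends in the lower half, so it can only correspond to
    itself, and as it is not level it cannot be turned around. *)
Lemma chain_at_least :
  at_least g lam mu P (fun C => low_edge P threshold C /\ ~ string_end C) #|chain_ok|.
Proof.
have -> : #|chain_ok| = #|[the finType of T]| by rewrite card_sig.
apply: (@family_at_least _ _ _ _ _ D fitD _ (fun th : T => fence_key (val th))).
- exact: chain_valid.
- move=> th; split; last exact: loop_string_end.
  by apply: (low_edge_first wfD sizeP uniqP lpD (chain_valid th)); exact: low_first.
- move=> x y E; have E0 : ES 0 \in es D by rewrite mem_es /= lpD addn0.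
  exists 0 => //.
  have [k kE [_ [s sE]]] := string_edge_match wfD wfD (chain_valid x) sizeP uniqP E E0.
  have klt : k < n by move: kE; rewrite mem_es /= lpD addn0.
  have k0 : k = 0.
    apply: (low_only_first (th := y)) => // b.
    have [i ilt iE] := loop_rbd wfD lpD b klt.
    have [j jlt jE] := loop_rbd wfD lpD (s (+) b) lt_0.
    have := sE b; rewrite iE jE => /rank_ends ->; rewrite ?mem_vs//.
    by rewrite -jE; exact: low_first.
  rewrite k0 in sE; case: s sE => sE; last by move=> b; rewrite sE.
  have := rphi_dir wfD (chain_valid y) sizeP uniqP E0.
  have := rphi_dir wfD (chain_valid x) sizeP uniqP E0.
  by rewrite /rdir W0p !sE /= => h1 /(lt_trans h1); rewrite ltxx.
- by move=> x y H; apply/val_inj/fence_key_rank_inj.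
Qed.
End Chained.
End LoopFamilies.

(** * The binomial estimate *)

(** C(2l+2,l+1) is 2 C(2l,l) + 2 C(2l,l+1), and C(2l,l+1) is l/(l+1), hence at least half, of
    C(2l,l). *)
Lemma central_bin_step l : 0 < l -> 3 * 'C(2 * l, l) <= 'C(2 * l.+1, l.+1).
Proof.
move=> l0; rewrite mulnS !addSn add0n !binS.
have h : l.+1 * 'C(2 * l, l.+1) = l * 'C(2 * l, l).
  by rewrite mul_bin_left; congr (_ * _); lia.
have [k lk] : exists k, l = k.+1 by exists l.-1; rewrite prednK.
have h' : 'C(2 * l, l.-1) = 'C(2 * l, l.+1).
  by rewrite -[in LHS]bin_sub; [congr 'C(_, _); lia|lia].
move: h h'; rewrite lk /= !binS => h h'.
nia.
Qed.

(** This says that C(p+l,l) (1/(2l) + 1/4) is at least 2^l, the two fractions being the shares of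
    the two families. For l at least 3 the case p = l suffices, by induction with the growth of the
    central coefficient from 96 against 100. At l = p = 2 it would read 32 against 24. *)
Lemma bin_weight_ge l p : 0 < l -> l <= p -> 1 < p -> ~ (l = 2 /\ p = 2) ->
  4 * l * 2 ^ l <= 'C(p + l, l) * (l + 2).
Proof.
move=> l0 lp p2 ne; have [l3|l3] := leqP 3 l.
  have : 4 * l * 2 ^ l <= 'C(2 * l, l) * (l + 2).
    elim: l l3 {l0 lp ne} => // l IH; rewrite ltnS leq_eqVlt => /predU1P[<- //|l3].
    have := IH l3; have := @central_bin_step l; rewrite (ltn_trans _ l3)// => /(_ isT).
    by rewrite expnS; move: (2 ^ l) 'C(_, _) 'C(_, _) => u C C'; nia.
  move=> H; apply: leq_trans H _; rewrite leq_mul2r; apply/orP; right.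
  by apply: leq_bin2l; lia.
case: l l0 lp ne l3 => [//|[|[|//]]] _ lp ne _.
  by rewrite bin1; lia.
have p3 : 3 <= p by move: lp ne; case: (p) => [|[|[|?]]] // _ h; case: h.
have : 'C(5, 2) <= 'C(p + 2, 2) by apply: leq_bin2l; lia.
by rewrite (_ : 'C(5, 2) = 10)//; lia.
Qed.

Section LoopBends.
Variables (R : realType) (g : nat) (lam mu l f l' f' : seq nat) (P : seq R).
Hypotheses (lamE : perm_eq lam (dbl l ++ f ++ f)) (muE : perm_eq mu (dbl l' ++ f' ++ f')).
Hypothesis pos : 0 \notin l ++ f ++ l' ++ f'.
Hypothesis fo : {in f ++ f', forall x, odd x}.
Hypotheses (uP : uniq P) (sP : size P = size lam + size mu + 2 * g - 2).
Hypothesis sums : sumn l + sumn f = sumn l' + sumn f'.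
Hypothesis n3 : 2 < size l + size f + (size l' + size f').
Hypothesis g0 : 0 < g.
Local Notation its := (all_items l f l' f').

(** [M1] belongs to the alternating loop, where the choice of a left fork and of a direction costs
    [2 * size f]; [M2] to the loop with the first two tails exchanged, where two order conditions
    cost 4. Both pay [2 ^ size f] for keeping the left forks below their vertices. *)
Lemma loop_bends_at_least s b : f != [::] -> loop_data its (size s) s b ->
  exists M1 M2, let p := (size s)./2 in
    [/\ (size f + p)`! * p`! * (size f')`! <= 2 ^ size f * (2 * size f) * M1,
        (size f + p)`! * p`! * (size f')`! <= 2 ^ size f * 4 * M2,
        size l + size f = p /\ size l' + size f' = p &
        at_least g lam mu P (fun C => ~ string_end C) (M1 + M2)].
Proof.
move=> fne L0; have [s0E _ _ _] := L0.
have hs : has (fun x => it_fork x && ~~ it_right x) s.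
  have [i ilt [fi ri]] := all_items_fork_index (side := false) s0E fne.
  by apply/(has_nthP item0); exists i; rewrite // fi ri.
have s1 : 1 < size s by rewrite (all_items_size s0E); exact: ltnW.
have szE : size s = size l + size f + (size l' + size f') by exact: all_items_size s0E.
have [s' [b' [L /andP[i1f i1r]]]] := loop_cut_second s1 L0 hs.
have [sE ob Wn BE] := L; have sz : size s' = size s by rewrite (perm_size sE) -(perm_size s0E).
rewrite -sz in s1 szE L BE *; clear s b L0 hs s0E sz; rename s' into s; rename b' into b.
pose D := ZData true s b g.-1 1; have nD : ntail D = size s by [].
have fitD : fits g lam mu P D by exact: loop_fits L s1 i1f.
have wfD := fit_wf fitD.
have bd i : i < ntail D -> bend D i.
  move=> ilt; have : all (bend D) (iota 0 (size s)) by rewrite all_count size_iota; apply/eqP.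
  by move/allP; apply; rewrite mem_iota.
(* A loop has as many maxima as minima, so three bends are impossible. *)
have n3' : 3 < ntail D.
  have n2 : 2 < ntail D by rewrite nD szE.
  rewrite ltn_neqAle n2 andbT; apply/eqP => n3'.
  have := max_min_bends (D := D) ob (ntail D); rewrite [W D (ntail D)]Wn W0 => /eqP.
  rewrite eqn_add2r -!size_filter => /eqP h.
  have : count (bend D) (iota 0 (ntail D)) = 3 by rewrite -n3' in BE *; rewrite n3'; exact: BE.
  by rewrite count_bend /maxs /mins h addnn => /(congr1 odd); rewrite odd_double.
(* The left tail makes [VS 1] a minimum, so [VS 0] is a maximum and the string arrives there
   rising. *)
have b0 : (0 < base D)%R.
  have := bd 1 (ltn_trans _ n3') => /(_ isT); have := bd 0 (ltn_trans _ n3') => /(_ isT).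
  have := WS (D := D) (i := 1) (ltn_trans _ n3') => /(_ isT).
  rewrite /bend /maxb /minb -[base D](W0 D).
  have i1r' : it_right (nth item0 s 1) = false by apply/negbTE.
  rewrite /it_step [it_right _]i1r'; clear; lia.
have [sgn rgt] := all_bends_sign (D := D) ob b0 bd.
have ev : ~~ odd (ntail D) by rewrite -sgn// [W D (ntail D)]Wn.
have [minsE maxsE] := all_bends_extrema (D := D) ob b0 bd.
have [mxE mnE] : size (maxs D) = (size s)./2 /\ size (mins D) = (size s)./2.
  exact: loop_extrema_sizes L.
rewrite maxsE in mxE; rewrite minsE in mnE.
have cnt (q : seq item) : perm_eq q s -> count (fun x => ~~ it_right x) q = (size s)./2 /\
    count it_right q = (size s)./2.
  by move=> qs; rewrite !(seq.permP qs) -{1}mnE -mxE size_lefts size_rights.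
have cits : size l + size f = (size s)./2 /\ size l' + size f' = (size s)./2.
  have [] := cnt its; first by rewrite perm_sym.
  have cc (a : pred nat) (t : seq nat) x : (forall y, a y = x) ->
      count a t = if x then size t else 0.
    by move=> H; rewrite (eq_count H); case: (x); rewrite ?count_predT ?count_pred0.
  rewrite /all_items /tail_items !count_cat !count_map.
  rewrite (cc _ l true)// (cc _ f true)// (cc _ l' false)// (cc _ f' false)//.
  rewrite (cc _ l false)// (cc _ f false)// (cc _ l' true)// (cc _ f' true)//.
  by rewrite /= !addn0.
have alt1 : exists2 M, #|forks_ok (D := D)| <= 2 * size (fork_side D false) * M &
    at_least g lam mu P (fun C => ~ low_edge P (threshold D) C /\ ~ string_end C) M.
  apply: alt_at_least => //.
    by rewrite mem_fork_side /right /fk i1f (negbTE i1r) s1.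
  move=> j i jlt /= iE; have ij : i = if j is j'.+1 then j' else (ntail D).-1.
    by case: (j) iE => [|j'] [].
  have n0 : 0 < ntail D by exact: ltn_trans n3'.
  have ilt : i < ntail D.
    by rewrite ij; case: (j) jlt => [|j'] jlt'; [rewrite prednK|exact: ltnW].
  rewrite (sgn j (ltnW jlt)) !rgt//; split=> //.
  rewrite ij; case: (j) => [|j'] /=; last by rewrite negbK.
  move: ev; rewrite -{1}(prednK n0) /=.
  by rewrite negbK => ->.
pose s2 := swap01 s; pose D' := ZData true s2 b g.-1 0.
have s2E : perm_eq s2 s := swap01_perm s.
have s2P : perm_eq s2 its := perm_trans s2E sE.
have nE : ntail D' = ntail D by rewrite /ntail (perm_size s2E).
have WE j : j != 1 -> W D' j = W D j by exact: (@W_swap01 true s b g.-1).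
have nth2 j : nth item0 s2 j = nth item0 s (if j == 0 then 1 else if j == 1 then 0 else j).
  by rewrite /s2; case: (s) s1 => [|x [|y q]] //= _; case: j => [|[|j]].
have L' : loop_data its (count (bend (ZData true s2 b 0 0)) (iota 0 (size s2))) s2 b.
  split=> //; rewrite (perm_size s2E); have h : size s != 1 by rewrite neq_ltn s1 orbT.
  exact: (etrans (WE _ h) Wn).
have fitD' : fits g lam mu P D'.
  by apply: loop_fits L' _ _; rewrite ?(perm_size s2E) ?(ltn_trans _ s1)// nth2.
have i0l' : cyci D' \in fork_side D' false.
  by rewrite mem_fork_side nE /right /fk /= nth2/= i1f (negbTE i1r) (ltn_trans _ n3').
have r' j : right D' j = right D (if j == 0 then 1 else if j == 1 then 0 else j).
  by rewrite /right /= nth2.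
have chain1 : at_least g lam mu P
    (fun C => low_edge P (threshold D') C /\ ~ string_end C) #|chain_ok (D := D')|
    /\ #|forks_ok (D := D')| <= 4 * #|chain_ok (D := D')|.
  have h1 : 3 < ntail D' by rewrite nE.
  have h2 : right D' 0 = false by rewrite r'/= rgt// (ltn_trans _ n3').
  have h3 : right D' 1 by rewrite r'/= rgt// (ltn_trans _ n3').
  have h4 : right D' 2 by rewrite r'/= rgt// (ltn_trans _ n3').
  have h5 : right D' (ntail D').-1 = false.
    rewrite nE r' rgt; last by case: (ntail D) n3' => [|[|[|m]]].
    by case: (ntail D) n3' ev => [|[|[|m]]] //= _; rewrite !negbK => ->.
  have h6 : (0 < W D' 0)%R by rewrite W0.
  have h7 : (0 < W D' 1)%R.
    have := WS (D := D') (i := 0) (ltn_trans _ h1) => /(_ isT) ->; rewrite W0 /it_step.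
    rewrite -[it_right _]/(right D' 0) h2; move: b0; clear; rewrite /=; lia.
  have h8 : (0 < W D' 2)%R by rewrite WE// sgn// ltnW// ltnW.
  split; last by apply: (card_chain_ok fitD').
  apply: chain_at_least => // j /andP[j2 jlt]; rewrite nE in jlt.
  case: j j2 jlt => [|[|[|j]]] // _ jlt.
  by rewrite WE// sgn ?(ltnW jlt)// !r' /= !rgt ?(ltnW jlt)//= !negbK.
(* Exchanging tails does not change the size of the lower half, so [low_edge] with one threshold
   separates the families. *)
have thE : threshold D' = threshold D.
  rewrite /threshold !lower_sizeE ?lefts_uniq//; try exact: lefts_n.
  have -> : right D (cyci D) = false by rewrite rgt//= (ltn_trans _ n3').
  have -> : right D' (cyci D') = false by rewrite r'/= rgt// (ltn_trans _ n3').
  have [c1 _] := cnt _ s2E; have [c2 _] := cnt _ (perm_refl s).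
  by rewrite !size_lefts /= c1 c2 (all_items_forks s2P) (all_items_forks sE).
have [M1 M1E al1] := alt1; have [al2 M2E] := chain1.
have forksX D0 : perm_eq (items D0) s -> (size f + (size s)./2)`! * ((size s)./2)`! * (size f')`! <=
    2 ^ size f * #|forks_ok (D := D0)|.
  move=> Es; have EP := perm_trans Es sE; have [c1 c2] := cnt _ Es.
  have fE side : size (fork_side D0 side) = if side then size f' else size f.
    by case: (D0) EP => ? ? ? ? ? /= EP; rewrite (all_items_forks EP).
  by have := card_forks_ok D0; rewrite size_rights c2 size_cat !size_map size_lefts c1 !fE.
exists M1, #|chain_ok (D := D')|; split=> //.
- apply: leq_trans (forksX D (perm_refl s)) _; rewrite -mulnA leq_mul2l; apply/orP; right.
  by apply: leq_trans M1E _; rewrite (all_items_forks sE).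
- apply: leq_trans (forksX D' s2E) _; rewrite -mulnA leq_mul2l; apply/orP; right.
  exact: M2E.
apply: at_leastW (at_leastD _ al1 al2) => [C [[]|[]] //|C C' [nl _] [lo _] E].
by apply: nl; rewrite -thE; case: lo => i [j [w H]]; exists i, j, w; rewrite E.
Qed.

Lemma loop_bends_generic s b : f != [::] -> loop_data its (size s) s b ->
  ~ (size f = 2 /\ (size s)./2 = 2) ->
  at_least g lam mu P (fun=> True) ((size f)`! * (size f')`! * (((size s)./2)`!) ^ 2).
Proof.
move=> fne L ne; have [M1 [M2 [X1 X2 [pE pE'] al]]] := loop_bends_at_least fne L.
apply: at_least_le (at_leastW _ al) => //.
set p := (size s)./2 in X1 X2 pE pE' ne *.
have l0 : 0 < size f by rewrite lt0n size_eq0.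
have p2 : 1 < p by move: n3; rewrite pE pE'; clear; lia.
have lp : size f <= p by rewrite -pE leq_addl.
have := bin_weight_ge l0 lp p2 ne.
have := bin_fact (n := p + size f) (m := size f) (leq_addl _ _).
rewrite addnK => bE; move: X1 X2; rewrite (addnC (size f) p) -bE => X1 X2 H.
set Y := (size f)`! * (size f')`! * (p`!) ^ 2.
have YE : 'C(p + size f, size f) * ((size f)`! * p`!) * p`! * (size f')`! =
    'C(p + size f, size f) * Y.
  rewrite /Y expnS expn1 -!mulnA; congr (_ * (_ * _)).
  by rewrite mulnA [RHS]mulnC -mulnA.
rewrite YE in X1 X2.
(* The common denominator of the two lower bounds. *)
have d0 : 0 < 2 ^ size f * (4 * size f) by rewrite muln_gt0 expn_gt0 muln_gt0 l0.
rewrite -(leq_pmul2l d0).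
have e1 : 2 * ('C(p + size f, size f) * Y) <= 2 ^ size f * (4 * size f) * M1.
  apply: leq_trans (leq_mul (leqnn 2) X1) _; rewrite !mulnA.
  by apply: eq_leq; congr (_ * _); clear; lia.
have e2 : size f * ('C(p + size f, size f) * Y) <= 2 ^ size f * (4 * size f) * M2.
  apply: leq_trans (leq_mul (leqnn (size f)) X2) _.
  by apply: eq_leq; clear; rewrite !mulnA; congr (_ * _); lia.
rewrite mulnDr; apply: leq_trans (leq_add e1 e2).
rewrite -mulnDl [X in _ <= X]mulnA leq_mul2r; apply/orP; right.
by rewrite mulnC addnC [X in _ <= X]mulnC.
Qed.
End LoopBends.

(** * Open strings for two left forks against two right tails *)

Section OpenTriple.
Variables (R : realType) (g : nat) (lam mu : seq nat) (P : seq R) (D : zdata).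
Hypothesis fitD : fits g lam mu P D.
Hypotheses (opn : ~~ looped D) (n3 : ntail D = 3) (W2 : (0 < W D 2)%R).
Local Notation lo := (if (W D 1 < 0)%R then [:: 1] else [::]).
Local Notation key := (zone_key (D := D) (lo := lo) (up := [:: 2]) id (sM D)).

Let wfD := fit_wf fitD.
Let lo_uniq : uniq lo. Proof. by case: ifP. Qed.
Let up_uniq : uniq [:: 2]. Proof. by []. Qed.
Let lo_n : {in lo, forall i, i < ntail D}.
Proof. by rewrite n3; case: ifP => // _ i; rewrite inE => /eqP->. Qed.
Let up_n : {in [:: 2], forall i, i < ntail D}.
Proof. by rewrite n3 => i; rewrite inE => /eqP->. Qed.
Let lo_up : {in lo, forall i, i \notin [:: 2]}.
Proof. by case: ifP => // _ i; rewrite inE => /eqP->. Qed.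

Let key_lt th th' i j : i < 3 -> j < 3 ->
  zone D lo [:: 2] (VS i) < zone D lo [:: 2] (VS j) -> key th (VS i) < key th' (VS j).
Proof.
move=> ilt jlt; apply: (zone_key_zone_lt lo_uniq up_uniq lo_n up_n (sM_n D) (sM_c D) (@id_sM D)).
- by rewrite mem_vs /= n3.
- by [].
- by rewrite mem_vs /= n3.
- by [].
Qed.

Let key_valid th : valid_key D (key th).
Proof.
apply: (zone_key_valid wfD lo_uniq up_uniq lo_n up_n (sM_n D) (sM_c D) (@id_sM D)) => //.
move=> j i i' jE iE i'E.
have jlt : j < 4 by move: jE; rewrite mem_es /= opn n3.
have i'j : i' = j /\ j < 3.
  by move: i'E; rewrite /= n3; case: eqP => // j3 [<-]; split=> //; move: jlt j3; clear; lia.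
have {iE} ji : j = i.+1 by move: iE => /=; rewrite (negPf opn); case: (j) => // m [->].
have [-> {}jlt] := i'j; rewrite {}ji in jlt *; case: i jlt => [|[|//]] _.
  have ob := wf_base wfD; rewrite (W_pos (D := D) ob) /=; case: ifP => w /=.
    have h0 : (0 \in lo) = false by case: ifP.
    have h1 : (1 \in lo) = false by rewrite (negbTE w).
    by rewrite /zone_key h0 h1 /= ltn_add2l.
  by apply: key_lt => //; rewrite /= (negbFE w).
have h2 : (2 \in lo) = false by case: ifP.
by rewrite W2; apply: key_lt => //; rewrite /zone h2 /=; case: (1 \in lo).
Qed.

(** [VS 0] is in the middle zone, so its rank is fixed and below that of [VS 2]; this excludes the
    reversal. [VS 1] is put into [lo] exactly when the string descends to it. *)
Lemma triple_at_least (Q : pl_map R -> Prop) :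
  (forall k, valid_key D k -> Q (cov P D k)) ->
  at_least g lam mu P Q (size (fork_side D true))`!.
Proof.
move=> QD; have sizeP := fit_P fitD; have uniqP := fit_uniq fitD.
apply: (@at_least_le _ _ _ _ _ Q _ #|zone_perms D lo [:: 2]|).
  by rewrite card_zone_perms leq_pmull// !muln_gt0 !fact_gt0.
apply: (family_at_least fitD (key := fun th => key th)) => //.
- by move=> th; exact: QD.
- apply: (anchored_open fitD) => // t t' _; rewrite n3 /= => E.
  have V0 : VS 0 \in vs D by rewrite mem_vs /= n3.
  have V2 : VS 2 \in vs D by rewrite mem_vs /= n3.
  have r2 := rank_max (key t') sizeP V2 isT.
  have := rphi_rank sizeP uniqP V0 isT r2 E.
  rewrite (zone_key_mid_rank lo_uniq up_uniq lo_n up_n (sM_n D) (sM_c D) (@id_sM D) t t')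
    ?n3//; last by case: ifP.
  have : key t' (VS 0) < key t' (VS 2).
    have h0 : (0 \in lo) = false by case: ifP.
    have h2 : (2 \in lo) = false by case: ifP.
    by apply: key_lt => //; rewrite /zone h0 h2.
  by rewrite -(rank_ltE (key t') (VS 2) V0 isT) => + E'; rewrite E' ltnn.
- by move=> t t'; exact: zone_key_rank_inj.
Qed.
End OpenTriple.

(* An end of the string is attached to a vertex whose tail hangs over [-oo]. *)
Definition end_at_left_tail (R : realType) (C : pl_map R) : Prop :=
  exists (p q : R) w w', [/\ odd w, edge_count C -oo%E p%:E w = 1, (q < p)%R, ~~ odd w' &
    0 < edge_count C q%:E p%:E w'].

Section OpenEnds.
Variables (R : realType) (P : seq R) (D : zdata) (key : rvert -> nat).
Hypotheses (wfD : wf_data D) (sizeP : size P = size (inner_vs D)) (uniqP : uniq P).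
Hypotheses (opn : ~~ looped D) (vk : valid_key D key).

Let n0 : 0 < ntail D. Proof. exact: wf_n wfD. Qed.
Let E0 : ES 0 \in es D. Proof. by rewrite mem_es /= opn addn1. Qed.

Let first_end : edge_count (cov P D key) -oo%E (rphi P D key (VS 0)) `|W D 0| = 1.
Proof.
have := edge_count_string wfD vk sizeP uniqP E0.
by rewrite /= (negPf opn) ltn_eqF.
Qed.

Lemma open_string_end : string_end (cov P D key).
Proof. by exists (rphi P D key (VS 0)), `|W D 0|; split; [exact: odd_W (wf_base wfD)|]. Qed.

Lemma open_left_tail : cyci D = 0 -> fk D 0 -> right D 0 = false ->
  end_at_left_tail (cov P D key).
Proof.
move=> c0 f0 r0; have eE : tl1 D 0 \in es D.
  by rewrite mem_es /tl1; case: ifP => [/andP[_ h]|_].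
have e0 : rbd D (tl1 D 0) false = VS 0 by rewrite /tl1; case: ifP => [_|/= ->]; rewrite /= ?c0.
have ie : inner D (rbd D (tl1 D 0) true) by rewrite /tl1; case: ifP.
exists (posn P D key (VS 0)), (posn P D key (rbd D (tl1 D 0) true)), `|W D 0|, (rwt D (tl1 D 0)).
split.
- exact: odd_W (wf_base wfD).
- exact: first_end.
- have := rphi_dir wfD vk sizeP uniqP eE; rewrite e0 /rphi ie /=.
  have -> : rdir D (tl1 D 0) = false by rewrite /tl1; case: ifP => _ /=; rewrite ?c0.
  by rewrite lte_fin.
- by rewrite /tl1; case: ifP => _ /=; rewrite oddM.
- have := edge_count_gt0 P key wfD true eE; rewrite e0 /=.
  by rewrite {1 2}/rphi ie.
Qed.

Lemma open_no_left_tail : cyci D != 0 -> cyci D != (ntail D).-1 ->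
  right D 0 -> right D (ntail D).-1 -> ~ end_at_left_tail (cov P D key).
Proof.
move=> c0 cn r0 rn [p [q [w [w' [ow /(edge_count1_string wfD ow)[j jE [_ [s sE]]] qp ew h]]]]].
have [i [ilt [ri ic pE]]] : exists i, i < ntail D /\
    [/\ right D i, i != cyci D & rphi P D key (VS i) = p%:E].
  have jlt : j < (ntail D).+1 by move: jE; rewrite mem_es /= opn addn1.
  have hs := sE s; have hns := sE (~~ s); rewrite addbb in hs; rewrite addbN addbb /= in hns.
  case: s {sE} hs hns => hs hns.
    have jn : j = ntail D by move: hs => /=; case: eqP.
    exists (ntail D).-1; rewrite prednK// eq_sym; split=> //; split=> //.
    by move: hns; rewrite jn /=; case: (ntail D) n0.
  have j0 : j = 0 by move: hs => /=; case: (j).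
  exists 0; rewrite eq_sym; split=> //; split=> //.
  by move: hns; rewrite j0 /= ltn_eqF.
have [e eE [wE [s' s'E]]] := edge_count_gt0_ex wfD h.
have Vi : VS i \in vs D by rewrite mem_vs.
have hp := s'E (~~ s'); have hq := s'E s'; rewrite addbb in hq; rewrite addbN addbb /= in hp.
have ei : rbd D e (~~ s') = VS i.
  by apply/esym/(rphi_inj vk sizeP uniqP) => //; [exact: rbd_vs|rewrite pE hp].
have := mem_halves wfD (e, ~~ s') Vi; rewrite eE ei eqxx /= !inE => /or3P[]/eqP[eE' sE'].
- by move: ew; rewrite -wE eE' /= (odd_W _ (wf_base wfD)).
- by move: ew; rewrite -wE eE' /= (odd_W _ (wf_base wfD)).
have {}sE' : s' = true by case: (s') sE'.
have := rphi_dir wfD vk sizeP uniqP eE.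
have rE : rdir D e = true by rewrite eE' /tl1 (negPf ic).
rewrite rE; rewrite sE' /= in hp hq; rewrite hp hq lte_fin => /(lt_trans qp).
by rewrite ltxx.
Qed.
End OpenEnds.

Section LoopException.
Variables (R : realType) (g : nat) (lam mu l' f' : seq nat) (a1 a2 : nat) (P : seq R).
Local Notation f := [:: a1; a2].
Hypotheses (lamE : perm_eq lam (f ++ f)) (muE : perm_eq mu (dbl l' ++ f' ++ f')).
Hypothesis pos : 0 \notin f ++ l' ++ f'.
Hypothesis fo : {in f ++ f', forall x, odd x}.
Hypotheses (uP : uniq P) (sP : size P = size lam + size mu + 2 * g - 2).
Hypothesis sums : a1 + a2 = sumn l' + sumn f'.
Local Notation its := (all_items [::] [:: a2] l' f').

Let oa1 : odd a1. Proof. by apply: fo; rewrite mem_head. Qed.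
Let a1p : 0 < a1. Proof. by case: (a1) oa1. Qed.
Let oa2 : odd a2. Proof. by apply: fo; rewrite !inE eqxx orbT. Qed.
Let a2p : 0 < a2. Proof. by case: (a2) oa2. Qed.

(** One of the two fork entries provides both string ends over [-oo]; the other remains as the only
    left tail and carries all the cycles. *)
Let triple_fits s i0 : perm_eq s its -> i0 < size s -> 1 < size s ->
  it_half (nth item0 s i0) = a2 ->
  fits g lam mu P (ZData false s (Posz a1) g i0).
Proof.
move=> sE i0n s1 hi; pose D := ZData false s (Posz a1) g i0.
have Wn : W D (size s) = (- Posz a1)%R.
  rewrite (W_total D) /= (all_items_sum sE) /= addn0; move: sums; clear; lia.
have ng : (0 < - Posz a1)%R = false by move: a1p; clear; lia.
apply: mk_fits => //=.
- apply: (all_items_ok sE).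
    by move: pos; rewrite /= !inE !negb_or => /and3P[_ -> ->].
  by move=> x; rewrite inE => xf; apply: fo; rewrite !inE; case/orP: xf => ->; rewrite !orbT.
- by rewrite /hw /= hi.
- by move=> _; split=> [|[E _]]; [move: a1p; clear; lia|move: s1; rewrite -[size s]/(ntail D) E].
- by rewrite addn0.
- rewrite /string_ends /= [ntail _]/(size s) Wn ng /=; apply/seq.permP => q.
  have := seq.permP (all_items_ends sE false) q;
    rewrite (seq.permP lamE) /= ?count_cat /= ?abszN ?absz_nat => ->.
  by clear; lia.
- rewrite /string_ends /= [ntail _]/(size s) Wn ng /=.
  by rewrite perm_sym (perm_trans muE)// perm_sym (all_items_ends sE true).
Qed.

(** The left tail stands first or second among the three. In the first case an end of the string is
    attached at it, in the second both ends are attached at right tails. *)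
Lemma open_triples : size l' + size f' = 2 ->
  at_least g lam mu P (@string_end R) ((size f')`! + (size f')`!).
Proof.
move=> sz2; pose r := tail_items true l' f'.
have rr z : z \in r -> it_right z by rewrite mem_cat => /orP[]/mapP[? _ ->].
have rsum : (\sum_(z <- r) it_half z)%N = a1 + a2.
  by rewrite big_cat !big_map /it_half /= sums !sumnE.
(* With the lighter right tail before the heavier one, twice its half weight is at most [a1 + a2],
   so the weight before the last vertex is positive in both orders. *)
have [x [y [rE xy]]] : exists x y, perm_eq [:: x; y] r /\ it_half x <= it_half y.
  have : size r = 2 by rewrite size_cat !size_map.
  case: (r) => [|x [|y [|]]] // _; case: (leqP (it_half x) (it_half y)) => h.
    by exists x, y.
  by exists y, x; split; [rewrite (perm_catC [:: y] [:: x])|exact: ltnW].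
have xr : it_right x by apply: rr; rewrite -(perm_mem rE) mem_head.
have yr : it_right y by apply: rr; rewrite -(perm_mem rE) !inE eqxx orbT.
have xyS : it_half x + it_half y = a1 + a2.
  by rewrite -rsum -(perm_big _ rE) !big_cons big_nil /= addn0.
pose A : item := (false, a2, true).
have e1 : perm_eq [:: A; x; y] its by rewrite /all_items /tail_items /= perm_cons.
have e2 : perm_eq [:: x; A; y] its.
  by apply: perm_trans e1; rewrite (perm_catCA [:: x] [:: A] [:: y]).
pose D1 := ZData false [:: A; x; y] (Posz a1) g 0.
pose D2 := ZData false [:: x; A; y] (Posz a1) g 1.
have fit1 : fits g lam mu P D1 by apply: triple_fits e1 _ _ _.
have fit2 : fits g lam mu P D2 by apply: triple_fits e2 _ _ _.
have sA : it_step A = Posz (2 * a2) by [].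
have sx : it_step x = (- Posz (2 * it_half x))%R by rewrite /it_step xr.
have W21 : (0 < W D1 2)%R.
  by rewrite /W /= ?take0 !big_cons big_nil /= sA sx; move: xyS xy a1p a2p; clear; lia.
have W22 : (0 < W D2 2)%R.
  by rewrite /W /= ?take0 !big_cons big_nil /= sA sx; move: xyS xy a1p a2p; clear; lia.
have fE : size (fork_side D1 true) = size f' /\ size (fork_side D2 true) = size f'.
  by rewrite (all_items_forks e1) (all_items_forks e2).
have al1 := @triple_at_least R g lam mu P D1 fit1 isT erefl W21
  (fun C => end_at_left_tail C /\ string_end C).
have al2 := @triple_at_least R g lam mu P D2 fit2 isT erefl W22
  (fun C => ~ end_at_left_tail C /\ string_end C).
rewrite (proj1 fE) in al1; rewrite (proj2 fE) in al2.
have [u1 u2] := (fit_uniq fit1, fit_uniq fit2).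
have [z1 z2] := (fit_P fit1, fit_P fit2); have [w1 w2] := (fit_wf fit1, fit_wf fit2).
have := at_leastD _ (al1 _) (al2 _) => H; apply: at_leastW (H _ _ _) => {H}.
- by move=> C [[]|[]].
- by move=> C C' [E _] [nE _] CC'; apply: nE; move: E; rewrite /end_at_left_tail CC'.
- move=> k vk; split; [exact: open_left_tail|exact: open_string_end].
- move=> k vk; split; last exact: open_string_end.
  by apply: open_no_left_tail.
Qed.
End LoopException.

(** * Mirror images *)

Section Mirror.
Variable R : realType.
Implicit Types C : pl_map R.

Definition mirror C : pl_map R :=
  @PLMap R (source C) (@len _ C) (fun v => - phi v)%E (@wt _ C).

Lemma edge_count_mirror C p q w :
  edge_count (mirror C) p q w = edge_count C (- p)%E (- q)%E w.
Proof.
apply: eq_card => e; rewrite !inE; congr (_ && _).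
by apply: eq_existsb => b; rewrite /= !(can2_eq oppeK oppeK).
Qed.

Lemma edge_image_mirror C (e e' : edge C) :
  @edge_image R (mirror C) e = @edge_image R (mirror C) e' <->
  @edge_image R C e = @edge_image R C e'.
Proof.
have E (x : edge C) y : @edge_image R (mirror C) x y = @edge_image R C x (- y)%E.
  by rewrite /edge_image /= -oppe_max -oppe_min leeNl leeNr andbC.
split=> H; apply/funext => y; last by rewrite !E H.
by rewrite -[y]oppeK -!E H.
Qed.

Lemma symmetric_cycle_mirror C (a b : edge C) (u w : vert C) :
  @symmetric_cycle R (mirror C) a b u w <-> @symmetric_cycle R C a b u w.
Proof. by split=> -[h1 h2 h3 h4 /edge_image_mirror h5]; split. Qed.

Lemma symmetric_fork_mirror C (a b : edge C) (u : vert C) :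
  @symmetric_fork R (mirror C) a b u <-> @symmetric_fork R C a b u.
Proof. by split=> -[h1 h2 h3 h4 /edge_image_mirror h5]; split. Qed.

Lemma chain_mirror C (v : vert C) K : @chain R C v K -> @chain R (mirror C) v K.
Proof.
elim=> [{}v u e a b ee j sf oa|{}v u e m j eu om we|{}v u w e a b {}K ee j sc oa _ IH dis].
- by apply: (@chain_fork R (mirror C) v u e a b) => //; apply/symmetric_fork_mirror.
- exact: (@chain_leaf R (mirror C) v u e m).
- by apply: (@chain_cycle R (mirror C) v u w e a b K) => //; apply/symmetric_cycle_mirror.
Qed.

Lemma zigzag_mirror C : is_zigzag C -> is_zigzag (mirror C).
Proof.
move=> [SV [SE [h1 h2 h3]]]; exists SV, SE; split; first exact: h1.
  move=> e f eS oe; have [n1 n2] := h2 e f eS oe; split.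
    by move=> [u [w /symmetric_cycle_mirror h]]; apply: n1; exists u, w.
  by move=> [u /symmetric_fork_mirror h]; apply: n2; exists u.
move=> e eS; have [v vS t] := h3 e eS; exists v => //; case: t => [t|t].
  by left; exact: chain_mirror.
by right.
Qed.

Lemma leaf_weights_mirror C p : leaf_weights (mirror C) p = leaf_weights C (- p)%E.
Proof.
rewrite /leaf_weights; congr map; apply: eq_filter => e.
by apply: eq_existsb => b; rewrite /= (can2_eq oppeK oppeK).
Qed.

Lemma tropical_mirror C g lam mu (P : seq R) : sumn lam = sumn mu ->
  is_tropical_cover g lam mu P C ->
  is_tropical_cover g mu lam (map -%R%R P) (mirror C).
Proof.
move=> E [h1 [[pl1 pl2] h3] [h4 h5] [h6 h7] h8]; split; first exact: h1.
- split; first split; last by move=> v; rewrite /= fin_numN; exact: h3.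
    by move=> e le; rewrite /= !fineN -opprD normrN; exact: pl1.
  exact: pl2.
- split.
    move=> v nv; rewrite (_ : weight_left _ = weight_right (C := C) v); last first.
      by apply: eq_bigl => h; rewrite /= lteN2.
    rewrite (_ : weight_right (C := mirror C) _ = weight_left (C := C) v); last first.
      by apply: eq_bigl => h; rewrite /= lteN2.
    exact/esym/h4.
  by rewrite /degree leaf_weights_mirror /= (perm_big _ h7) sumnE.
- by rewrite !leaf_weights_mirror.
move=> _ /mapP[p pP ->]; have [v [nv vE]] := h8 p pP.
by exists v; split; rewrite //= vE.
Qed.

(** The families of loops without nonbends rely on a left fork; reflecting the line provides one
    when only right forks exist. *)
Lemma at_least_mirror g lam mu (P : seq R) Q N : sumn lam = sumn mu ->
  at_least g lam mu P Q N -> at_least g mu lam (map -%R%R P) (fun=> True) N.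
Proof.
move=> E [T [F [NT FT Finj]]]; exists T, (fun t => mirror (F t)); split=> //.
  move=> t; have [[tF zF] _] := FT t; split=> //; split; last exact: zigzag_mirror.
  exact: tropical_mirror.
move=> t t' H; apply: Finj; apply/funext => p; apply/funext => q; apply/funext => w.
by have := congr1 (fun J => J (- p)%E (- q)%E w) H; rewrite /= !edge_count_mirror !oppeK.
Qed.
End Mirror.

Definition flip (x : item) : item := (~~ it_right x, it_half x, it_fork x).

Lemma it_step_flip x : it_step (flip x) = (- it_step x)%R.
Proof. by case: x => [[[] a] b]; rewrite /it_step /flip /it_right /it_half /= ?opprK. Qed.

Lemma W_flip lp s b c i0 c' i0' j :
  W (ZData lp (map flip s) (- b)%R c i0) j = (- W (ZData lp s b c' i0') j)%R.
Proof.
rewrite /W /= -map_take big_map opprD -sumrN; congr (_ + _)%R.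
by apply: eq_bigr => x _; exact: it_step_flip.
Qed.

Lemma loop_data_flip l f l' f' B s b : loop_data (all_items l f l' f') B s b ->
  loop_data (all_items l' f' l f) B (map flip s) (- b)%R.
Proof.
move=> [sE ob Wn BE]; split.
- apply: perm_trans (perm_map flip sE) _.
  by rewrite /all_items /tail_items !map_cat -!map_comp perm_catC.
- by rewrite abszN.
- by rewrite size_map (W_flip _ _ _ _ _ 0 0) Wn.
- rewrite size_map -BE; apply: eq_count => i; rewrite !bendE ?abszN//.
  by rewrite !(W_flip _ _ _ _ _ 0 0) mulrNN.
Qed.

(** * Assembling the bound for positive genus *)

Section CaseC.
Variables (R : realType) (g d : nat) (lam mu : seq nat).
Hypothesis g0 : 0 < g.

Lemma loop_bends l f l' f' (P : seq R) lam1 mu1 s b :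
  perm_eq lam1 (dbl l ++ f ++ f) -> perm_eq mu1 (dbl l' ++ f' ++ f') ->
  0 \notin l ++ f ++ l' ++ f' -> {in f ++ f', forall x, odd x} ->
  uniq P -> size P = size lam1 + size mu1 + 2 * g - 2 ->
  sumn l + sumn f = sumn l' + sumn f' ->
  2 < size l + size f + (size l' + size f') ->
  f != [::] -> loop_data (all_items l f l' f') (size s) s b ->
  at_least g lam1 mu1 P (fun=> True) ((size f)`! * (size f')`! * (((size s)./2)`!) ^ 2).
Proof.
move=> lamE muE pos fo uP sP sums n3 fne L.
have [[f2 p2]|ne] : (size f = 2 /\ (size s)./2 = 2) \/ ~ (size f = 2 /\ (size s)./2 = 2).
- by case: (size f =P 2); case: ((size s)./2 =P 2) => *; [left|right; case..]; try by case.
- have [M1 [M2 [X1 X2 [pE pE'] al]]] :=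
    loop_bends_at_least lamE muE pos fo uP sP n3 g0 fne L.
  rewrite f2 p2 in X1 X2 pE pE' *.
  have l0 : l = [::] by apply/size0nil; move: pE; clear; lia.
  clear L fne pE n3; case: f f2 lamE fo pos sums => [|a1 [|a2 []]] // _.
  rewrite l0 /= add0n addn0 => lamE fo pos sums.
  (* The bound is 8 times the factorial of [size f']. Each loop family gives 3 of these multiples,
     and the open strings give the remaining 2. *)
  have alO := open_triples lamE muE pos fo uP sP sums pE'.
  apply: at_least_le (at_leastW _ (at_leastD _ al alO)) => //; last first.
    by move=> C C' nC [p [w [ow E]]] CC'; apply: nC; exists p, w; rewrite CC'.
  have f4 : (2 + 2)`! = 24 by [].
  have f2 : 2`! = 2 by [].
  by rewrite f4 f2 in X1 X2 *; move: X1 X2; clear; rewrite /=; lia.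
exact: loop_bends_generic L ne.
Qed.

Variables (Dl : parity_decomposition lam) (Dm : parity_decomposition mu) (P : seq R).
Hypotheses (d0 : 0 < d) (lamP : partition_of d lam) (muP : partition_of d mu).
Hypothesis excl :
  forall k, 1 <= k -> ~ {subset [:: lam; mu] <= [:: [:: 2 * k]; [:: k; k]]}.
Hypotheses (uP : uniq P) (sP : size P = size lam + size mu + 2 * g - 2).
Hypothesis oo_ne : part_oo Dl ++ part_oo Dm <> [::].
Hypothesis no0 : part_0 Dl ++ part_0 Dm = [::].

Let zl : part_0 Dl = [::]. Proof. by case: (part_0 Dl) no0. Qed.
Let zm : part_0 Dm = [::]. Proof. by case: (part_0 Dl) no0. Qed.
Local Notation l := (part_leaf Dl).
Local Notation f := (part_oo Dl).
Local Notation l' := (part_leaf Dm).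
Local Notation f' := (part_oo Dm).

Let lamE : perm_eq lam (dbl l ++ f ++ f).
Proof. by have := decomposition_perm Dl; rewrite zl cats0. Qed.
Let muE : perm_eq mu (dbl l' ++ f' ++ f').
Proof. by have := decomposition_perm Dm; rewrite zm cats0. Qed.
Let sl : sumn l + sumn f + (sumn l + sumn f) = d.
Proof.
have := decomposition_sum Dl; rewrite zl; case: lamP => _ _ -> /=; clear; lia.
Qed.
Let sm : sumn l' + sumn f' + (sumn l' + sumn f') = d.
Proof.
have := decomposition_sum Dm; rewrite zm; case: muP => _ _ -> /=; clear; lia.
Qed.
Let sums : sumn l + sumn f = sumn l' + sumn f'.
Proof. by move: sl sm; clear; lia. Qed.
Let pos : 0 \notin l ++ f ++ l' ++ f'.
Proof. by apply: positive_all; [exact: lamP|exact: muP]. Qed.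

Let single (nu : seq nat) (t u : seq nat) : perm_eq nu (dbl t ++ u ++ u) ->
  size t + size u <= 1 -> 0 < sumn t + sumn u ->
  nu \in [:: [:: 2 * (sumn t + sumn u)]; [:: sumn t + sumn u; sumn t + sumn u]].
Proof.
case: t => [|x [|? ?]]; case: u => [|y [|? ?]] //= E _ _; rewrite !inE ?addn0 ?add0n.
- by rewrite (@perm_nseq_eq _ _ 2 y E) eqxx orbT.
- by rewrite (@perm_nseq_eq _ _ 1 _ E) eqxx.
Qed.

(** Positive sums force a tail on each side. With two tails in all, both partitions would be (2k) or
    (k,k) for the same k, which is excluded. *)
Let n3 : 2 < size l + size f + (size l' + size f').
Proof.
rewrite ltnNge; apply/negP => n2.
have p0 : 0 < sumn l + sumn f by move: sl d0; clear; lia.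
have p0' : 0 < sumn l' + sumn f' by rewrite -sums.
have ne (t u : seq nat) : 0 < sumn t + sumn u -> 0 < size t + size u.
  by case: t => [|? ?]; case: u.
have q := ne _ _ p0; have q' := ne _ _ p0'.
apply: (excl p0) => x; rewrite !inE => /orP[]/eqP->.
  have := single lamE _ p0; rewrite !inE; apply; move: n2 q q'; clear; lia.
have := single muE _ p0'; rewrite -sums !inE; apply; move: n2 q q'; clear; lia.
Qed.

Lemma case_c :
  let B := max_sign_changes 1 (dbl (part_tail Dl)) (dbl (part_tail Dm)) in
  at_least g lam mu P (fun=> True) ((size f)`! * (size f')`! * ((B./2)`!) ^ 2).
Proof.
move=> B; have BE : B = max_sign_changes 1 (dbl (l ++ f)) (dbl (l' ++ f')).
  by rewrite /B !part_tailE.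
have p0 : 0 < sumn l + sumn f by move: sl d0; clear; lia.
have fo := @oddness_all _ _ Dl Dm.
have [s L B0] := loop_max_data pos sums BE p0.
have ff : f ++ f' != [::] by apply/eqP.
have [ab|nb] := boolP (all (bend (ZData true s 1 0 0)) (iota 0 (size s))); last first.
  exact: (loop_nonbend lamE muE pos fo uP sP n3 g0 B0 ff L nb).
have Bs : B = size s.
  by have [_ _ _ <-] := L; move: ab; rewrite all_count size_iota => /eqP.
rewrite {}Bs in L *; have [fE|fne] := eqVneq f [::]; last first.
  exact: (loop_bends lamE muE pos fo uP sP sums n3 fne L).
(* No left fork: pass to the mirror image, where the roles of [lam] and [mu] are exchanged and the
   bound is the same. *)
have f'ne : f' != [::] by move: ff; rewrite fE.
have pos' : 0 \notin l' ++ f' ++ l ++ f.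
  by move: pos; rewrite !mem_cat !negb_or => /and4P[-> -> -> ->].
have fo' : {in f' ++ f, forall x, odd x}.
  by move=> x; rewrite mem_cat orbC -mem_cat; exact: fo.
have uP' : uniq (map -%R%R P) by rewrite map_inj_uniq//; exact: oppr_inj.
have sP' : size (map -%R%R P) = size mu + size lam + 2 * g - 2.
  by rewrite size_map sP (addnC (size mu)).
have n3' : 2 < size l' + size f' + (size l + size f) by rewrite addnC.
have := loop_bends muE lamE pos' fo' uP' sP' (esym sums) n3' f'ne (s := map flip s).
rewrite size_map => /(_ _ (loop_data_flip L)) al.
have E : sumn mu = sumn lam by case: lamP => _ _ ->; case: muP.
have := at_least_mirror E al; rewrite -map_comp (eq_map (@opprK R)) map_id => al'.
by apply: at_least_le al'; rewrite (mulnC (size f)`!).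
Qed.
End CaseC.

Theorem theorem5p7 (R : realType) (g d r : nat) (lam mu : seq nat)
    (Dl : parity_decomposition lam) (Dm : parity_decomposition mu)
    (P : seq R) :
  0 < d -> partition_of d lam -> partition_of d mu ->
  r = size lam + size mu + 2 * g - 2 -> 0 < r ->
  (forall k, 1 <= k -> ~ {subset [:: lam; mu] <= [:: [:: 2 * k]; [:: k; k]]}) ->
  uniq P -> size P = r ->
  size (part_0 Dl ++ part_0 Dm) <= 2 ->
  part_oo Dl ++ part_oo Dm <> [::] ->
  [/\ (* (a) *)
      forall k, k \in part_0 Dl ->
        let B := max_sign_changes k (dbl (part_tail Dl)) (dbl (part_tail Dm)) in
        (((size (part_oo Dl))`! * (size (part_oo Dm))`!
            * (B./2)`! * (uphalf B)`!)%:R%:E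
         <= zigzag_number g lam mu P)%E,
      (* (b) *)
      part_0 Dl ++ part_0 Dm = [::] -> g = 0 ->
      forall k, k \in part_oo Dl ->
        let B := max_sign_changes k (dbl (rem k (part_tail Dl)))
                                    (dbl (part_tail Dm)) in
        (((size (part_oo Dl) - 1)`! * (size (part_oo Dm))`!
            * (B./2)`! * (uphalf B)`!)%:R%:E
         <= zigzag_number g lam mu P)%E
    & (* (c) *)
      part_0 Dl ++ part_0 Dm = [::] -> 0 < g ->
        let B := max_sign_changes 1 (dbl (part_tail Dl)) (dbl (part_tail Dm)) in
        (((size (part_oo Dl))`! * (size (part_oo Dm))`!
            * ((B./2)`!) ^ 2)%:R%:E
         <= zigzag_number g lam mu P)%E].
Proof.
move=> d0 lamP muP rE _ excl uP sP size0 oo_ne; rewrite rE in sP; split.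
- move=> k kz; apply: at_least_zigzag.
  exact: (case_a lamP muP uP sP size0 oo_ne kz).
- move=> no0 g0 k koo; rewrite g0 in sP *; apply: at_least_zigzag.
  exact: (case_b lamP muP excl uP sP no0 koo).
- move=> no0 g0; apply: at_least_zigzag.
  exact: (case_c g0 d0 lamP muP excl uP sP oo_ne no0).
Qed.
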